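(* Let $G$ be a strongly non-degenerate dimer model on $T=\mathbb{R}^2/\mathbb{Z}^2$. If every corner perfect matching of $G$ is multiplicity-free, then the zigzag polygon of $G$ coincides with the characteristic polygon of $G$ (up to translation).
   Context: **Dimer models.** Let $T=\mathbb{R}^2/\mathbb{Z}^2$ be the oriented real 2-torus. A bicolored graph on $T$ consists of a finite set $B\subset T$ of black nodes, a finite set $W\subset T$ of white nodes, and a finite set $E$ of edges, which are embedded closed intervals in $T$ with one endpoint in $B$ and the other in $W$, two edges meeting only at endpoints (multiple edges are allowed). A face is a connected component of $T\setminus\bigcup_{e\in E}e$. A bicolored graph is a dimer model if it has no univalent node and every face is simply-connected. **Characteristic polygon.** A perfect matching is a subset $D\subset E$ such that each node is incident to exactly one edge of $D$. Orient each edge so that $\partial e=w-b$ (from its black node $b$ to its white node $w$) and regard $D$ as the 1-chain $\sum_{e\in D}e$. For perfect matchings $D,D'$, the difference $D-D'$ is a 1-cycle supported on the symmetric difference; its class in $H_1(T;\mathbb{Z})$ is denoted $[D\triangle D']$. The height change $h(D,D')\in H^1(T;\mathbb{Z})\cong\mathbb{Z}^2$ is defined by $h(D,D')(C)=\langle C,[D\triangle D']\rangle$ for $C\in H_1(T;\mathbb{Z})$, with $\langle-,-\rangle$ the intersection pairing. Fixing a reference matching $D'$, write $h(D)=h(D,D')$. The characteristic polygon is the convex hull of $\{h(D): D \text{ a perfect matching}\}$; changing the reference matching translates it. A perfect matching $D$ is a corner perfect matching if $h(D)$ is a corner (vertex) of the characteristic polygon. The multiplicity of $D$ is the number of perfect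 matchings with the same height change as $D$; $D$ is multiplicity-free if its multiplicity is $1$. A dimer model is strongly non-degenerate if every edge is contained in at least one corner perfect matching. **Zigzag polygon.** A zigzag path is a path on the graph, without endpoints, i.e. a sequence $(e_i)_{i\in\mathbb{Z}}$ of edges up to shift of the index, which makes a maximum turn to the right at each white node and a maximum turn to the left at each black node; on $T$ it is periodic, and its homology class $[z]\in H_1(T;\mathbb{Z})\cong\mathbb{Z}^2$ (of one period) is its slope. The slopes of all zigzag paths sum to $0$. Let $z_1,\dots,z_k$ be all the zigzag paths, indexed so that their slopes are cyclically ordered counter-clockwise (slopes may coincide; zero slopes may be placed anywhere). Put $w_0=0$ and $w_{i+1}=w_i+[z_{i+1}]'$ for $i=0,\dots,k-1$, where $'$ is rotation by $90$ degrees counter-clockwise; then $w_k=0$. The zigzag polygon is the convex hull of $w_1,\dots,w_k$; it is considered up to translation. *)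

(* Defs.v *)
From mathcomp Require Import all_boot all_order all_algebra all_fingroup.
From mathcomp Require Import all_classical all_reals.
From mathcomp Require Import convex.

Set Implicit Arguments.
Unset Strict Implicit.
Unset Printing Implicit Defensive.

Import Order.TTheory GRing.Theory Num.Theory.
Local Open Scope ring_scope.

(** * Plane vectors *)

Notation Z2 := 'rV[int]_2.

(* For [u], [v] in [H_1(R^2/Z^2; Z) = Z^2] this is the intersection pairing
   [<u, v>], normalised by [<(1,0), (0,1)> = 1]. *)
Definition pairing (u v : Z2) : int := u 0 0 * v 0 1 - u 0 1 * v 0 0.

Definition rot90 (v : Z2) : Z2 :=
  \row_(j < 2) if j == 0 then - v 0 1 else v 0 0.

(* Twice the signed area (shoelace formula) enclosed by the closed polygonal
   line with successive steps [s], counter-clockwise being positive. *)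
Definition area2 (s : seq Z2) : int :=
  \sum_(i < size s) pairing (\sum_(j < i) s`_j) s`_i.

(* Upper half plane [0 <= arg < pi], for nonzero vectors. *)
Definition upper (v : Z2) : bool :=
  (0 < v 0 1) || (v 0 1 == 0) && (0 < v 0 0).

(* Comparison of the arguments in [[0, 2 pi[] of two nonzero vectors. *)
Definition arg_le (u v : Z2) : bool :=
  if upper u == upper v then 0 <= pairing u v else upper u.

(* Cyclic counter-clockwise order: up to the choice of the starting point the
   arguments increase; zero vectors may occur anywhere. *)
Definition ccw_sorted (s : seq Z2) : bool :=
  [exists n : 'I_(size s).+1, sorted arg_le (rot n [seq v <- s | v != 0])].

(** * Dimer models *)

(* A bicolored graph embedded in the oriented torus [R^2/Z^2] with simply
   connected faces, up to isotopy, is recorded by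
   - its rotation system: [rotb e] (resp. [rotw e]) is the edge following [e]
     in counter-clockwise order around the black (resp. white) end of [e];
   - displacements: choosing one lift of every node to [R^2], the lift of [e]
     that starts at the chosen lift of its black end stops at the chosen lift
     of its white end translated by [disp e]. Hence the class in
     [H_1 = Z^2] of a cycle [sum_e c_e e], edges being oriented from black to
     white, is [sum_e c_e (disp e)], whatever the choice of the lifts.
   [on_torus] below states that this data does come from such an embedding. *)
Record bicolored_graph := BicoloredGraph {
  black : finType;
  white : finType;
  edge : finType;
  bend : edge -> black;
  wend : edge -> white;
  rotb : {perm edge};
  rotw : {perm edge};
  disp : edge -> Z2;
  rotbP : forall e e', (e' \in porbit rotb e) = (bend e' == bend e);
  rotwP : forall e e', (e' \in porbit rotw e) = (wend e' == wend e)
}.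

Section DimerModel.
Variable G : bicolored_graph.
Implicit Types (e : edge G) (D : {set edge G}).

(* Follow [e] from black to white with a given face on the left, then
   [rotw^-1 e] from white to black: the next edge bordering that face that is
   followed from black to white is [face_perm e]. The faces are the cycles. *)
Definition face_perm : {perm edge G} := ((rotw G)^-1 * (rotb G)^-1)%g.

Definition face_boundary e : seq Z2 :=
  flatten [seq [:: disp x; - disp ((rotw G)^-1%g x)]
          | x <- traject face_perm e #|porbit face_perm e|].

Definition connected : Prop := forall e e',
  connect [rel x y | (bend x == bend y) || (wend x == wend y)] e e'.

(* Gluing a disc along each face yields a closed oriented surface, which is
   connected and has Euler characteristic 0. As the displacements add up to 0
   around each face they define a map from this surface to [R^2/Z^2], up to
   homotopy. Its degree is the total signed area of the images of the faces;
   degree 1 means that the map is homotopic to an orientation preserving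
   homeomorphism. Isolated nodes (which bound no edge, hence do not affect the
   faces) are not counted. *)
Definition on_torus : Prop :=
  [/\ connected,
      (#|[set bend e | e in edge G]| + #|[set wend e | e in edge G]|
         + #|porbits face_perm| = #|edge G|)%N,
      forall e, \sum_(v <- face_boundary e) v = 0 &
      \sum_(e in froots face_perm) area2 (face_boundary e) = 2].

Definition no_univalent_node : Prop :=
  (forall b : black G, #|[set e | bend e == b]| != 1%N) /\
  (forall w : white G, #|[set e | wend e == w]| != 1%N).

Definition dimer_model : Prop := on_torus /\ no_univalent_node.

(** * Perfect matchings and the characteristic polygon *)

Definition perfect_matching D : bool :=
  [forall b : black G, #|[set e in D | bend e == b]| == 1%N] &&
  [forall w : white G, #|[set e in D | wend e == w]| == 1%N].

(* The class [[D triangle D']] in [H_1]. *)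
Definition matching_class D D' : Z2 :=
  \sum_(e in D) disp e - \sum_(e in D') disp e.

(* [h(D, D')] in [H^1], in the basis dual to the basis [(1,0), (0,1)] of
   [H_1]. *)
Definition height_change D D' : Z2 :=
  \row_(j < 2) pairing (delta_mx 0 j) (matching_class D D').

(* [D0] is the reference matching. *)
Definition multiplicity D0 D : nat :=
  #|[set D' | perfect_matching D' & height_change D' D0 == height_change D D0]|.

Definition multiplicity_free D0 D : bool := multiplicity D0 D == 1%N.

(** * Zigzag paths *)

(* The zigzag path that follows [e] from black to white turns maximally right
   onto [rotw e], followed from white to black, and then maximally left onto
   [zigzag_perm e]. So one period of a zigzag path is given by the cycle [z] of
   [zigzag_perm] made of the edges it follows from black to white; the edges it
   follows from white to black are the [rotw e] for [e] in [z]. *)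
Definition zigzag_perm : {perm edge G} := (rotw G * (rotb G)^-1)%g.

Definition zigzags : {set {set edge G}} := porbits zigzag_perm.

Definition slope (z : {set edge G}) : Z2 :=
  \sum_(e in z) (disp e - disp (rotw G e)).

Definition zigzag_enumeration (zs : seq {set edge G}) : bool :=
  perm_eq zs (enum zigzags) && ccw_sorted [seq slope z | z <- zs].

(* The points [w_1, ..., w_k]. *)
Definition zigzag_points (zs : seq {set edge G}) : seq Z2 :=
  scanl +%R 0 [seq rot90 (slope z) | z <- zs].

End DimerModel.

(** * Convex hulls and polygons *)

Section Polygons.
Local Open Scope classical_set_scope.
Variable R : realType.
Local Notation R2 := 'rV[R]_2.

Definition real_pt (v : Z2) : R2 := map_mx intr v.

Definition convex_hull (A : set R2) : set R2 :=
  smallest (fun B => convex_set B) A.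

(* Extreme points; for a polygon, its corners. *)
Definition vertex (A : set R2) (p : R2) : Prop :=
  A p /\ forall (x y : R2) (t : R), A x -> A y -> 0 < t < 1 ->
    p = t *: x + (1 - t) *: y -> x = p /\ y = p.

Definition translate (t : R2) (A : set R2) : set R2 := [set p + t | p in A].

Variable G : bicolored_graph.
Implicit Types D : {set edge G}.

Definition characteristic_polygon D0 : set R2 :=
  convex_hull
    [set real_pt (height_change D D0) | D in [set D | perfect_matching D]].

Definition corner_matching D0 D : Prop :=
  perfect_matching D /\
  vertex (characteristic_polygon D0) (real_pt (height_change D D0)).

Definition strongly_nondegenerate D0 : Prop :=
  forall e : edge G, exists2 D, corner_matching D0 D & e \in D.

Definition zigzag_polygon (zs : seq {set edge G}) : set R2 :=
  convex_hull [set real_pt w | w in [set` zigzag_points zs]].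

End Polygons.

Arguments characteristic_polygon R {G} D0.
Arguments corner_matching R {G} D0 D.
Arguments strongly_nondegenerate R {G} D0.
Arguments zigzag_polygon R {G} zs.

(* Main.v *)
Require Import Defs.
From mathcomp Require Import all_boot all_order all_algebra all_fingroup.
From mathcomp Require Import all_classical all_reals.
From mathcomp Require Import interval_inference convex zify ring lra.

Set Implicit Arguments.
Unset Strict Implicit.
Unset Printing Implicit Defensive.

Import Order.TTheory GRing.Theory Num.Theory.
Local Open Scope ring_scope.

(** Up to a translation and a quarter turn, the characteristic polygon is the
    convex hull of the homology classes [cls (chi D)] of the perfect matchings
    [D], the number [height v D] being the value at [D] of the linear form with
    outer normal [v]. The proof shows that its sides are swept by the zigzag
    paths, each exactly once.

    A cycle that is nonnegative off [D] is a sum of differences [D' - D]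
    ([circulation_decomposition]). Hence at a multiplicity-free corner [D] no
    nonzero such cycle has class zero: [D] is [rigid]. The topology of the torus
    enters through one formula, [intersection]. A function on the corners of the
    faces defines a cycle, its jumps across the edges, and a cocycle, its
    variations along the edges, and these are Poincare dual; the formula comes
    from a count of ranks, which uses the Euler characteristic, and from the
    area condition.

    Let [F v] and [L v] be the two ends of the supporting face of the polygon
    with outer normal [v]. The heart of the proof is that the loops of
    [F v - L v] are zigzag paths ([loops_are_zigzags]). These loops are
    homologous, with a primitive class. Call an edge bad when it reaches a loop
    from the right at a white node, or leaves it to the left at a black node; a
    loop is a zigzag path when there is none. An edge that is bad belongs to
    some rigid matching, along which one finds an excursion: a directed path
    from loop to loop through nodes where [F v] and [L v] agree. No excursion
    arrives on the side from which it left ([no_same_side]), so those issued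
    from bad edges go from left to right, and they cannot be chained cyclically
    ([no_closed_chain]), because a cycle directed along [L v] crosses the loops
    in one direction only. If there were bad edges, some loop would therefore
    have some on its left only, and another one on its right only. But the Euler
    characteristic forces a rigid matching to leave exactly one white corner
    uncovered in each face ([rigid_face]), and it follows that, in a rigid
    matching, the number of bad edges on the right minus the number on the left
    is the same for all loops ([side_balance]), a contradiction.

    Turning around the polygon, the end of one side is the start of the next
    ([gift_wrapping]), so differences of ends are sums over the zigzag paths
    whose slopes lie in a sector ([telescope]). Over a full turn this shows that
    lying on the supporting face of its slope is a property shared by all the
    edges or by none, and it cannot fail for all ([on_boundary_all]). Therefore
    the partial sums of the slopes, in the order of their arguments, are points
    of the sides ([boundary_point_on_edge]); and the closed line through these
    points, which turns counterclockwise around the class of every perfect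
    matching, encloses it ([boundary_encloses]). So the two hulls agree. *)

(** * Orbits of permutations *)

Lemma sum_porbit (T : finType) (s : {perm T}) (V : nmodType) (F : T -> V) x :
  \sum_(y in porbit s x) F y = \sum_(i < #|porbit s x|) F (iter i s x).
Proof.
rewrite (eq_bigl _ _ (porbit_traject s x)) -big_uniq ?uniq_traject_porbit //=.
rewrite (big_nth x) size_traject big_mkord; apply: eq_bigr => i _.
by rewrite nth_traject.
Qed.

Lemma porbitS (T : finType) (s : {perm T}) x : porbit s (s x) = porbit s x.
Proof. by have := porbit_perm s 1 x; rewrite expg1. Qed.

Lemma mem_porbitS (T : finType) (s : {perm T}) x y :
  (s y \in porbit s x) = (y \in porbit s x).
Proof. by rewrite porbit_sym porbitS porbit_sym. Qed.

(** On each orbit, sum [d] from a chosen origin; the total being zero, the sum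
    closes up. *)
Lemma orbit_potential (T : finType) (s : {perm T}) (V : zmodType) (d : T -> V) :
  (forall x, \sum_(y in porbit s x) d y = 0) ->
  exists Q : T -> V, forall x, Q (s x) = Q x + d x.
Proof.
move=> d0; pose r x := odflt x [pick y in porbit s x].
have rP x : r x \in porbit s x.
  by rewrite /r; case: pickP => [y //|_] /=; apply: porbit_id.
have rS x : r (s x) = r x.
  rewrite /r porbitS; case: pickP => [//|/(_ x)] /=.
  by rewrite porbit_id.
pose k x := index x (traject s (r x) #|porbit s (r x)|).
have kP x : (k x < #|porbit s (r x)|)%N /\ iter (k x) s (r x) = x.
  have xr : x \in traject s (r x) #|porbit s (r x)|.
    by rewrite -porbit_traject porbit_sym.
  have kl : (k x < #|porbit s (r x)|)%N by rewrite -index_mem size_traject in xr.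
  split=> //; rewrite -(nth_traject s kl (r x)); exact: nth_index.
have kU x i : (i < #|porbit s (r x)|)%N -> iter i s (r x) = x -> k x = i.
  move=> il ix; rewrite /k -{1}ix -(nth_traject s il (r x)).
  by rewrite index_uniq ?size_traject ?uniq_traject_porbit.
exists (fun x => \sum_(i < k x) d (iter i s (r x))) => x.
have [kl kx] := kP x.
have [lt|ge] := ltnP (k x).+1 #|porbit s (r x)|.
  have -> : k (s x) = (k x).+1.
    by apply: kU; rewrite rS //= kx.
  by rewrite rS big_ord_recr /= kx.
have e : #|porbit s (r x)| = (k x).+1 by apply/eqP; rewrite eqn_leq kl ge.
have -> : k (s x) = 0%N.
  apply: kU; rewrite rS ?(leq_trans _ kl) //=.
  by rewrite -kx -iterS -e iter_porbit kx.
rewrite big_ord0 -[LHS](d0 (r x)) sum_porbit e big_ord_recr /=.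
by rewrite kx.
Qed.

(** * Corner functions on a ribbon graph *)

Section Ribbon.
Variables (E : finType) (sw sb : {perm E}).
Implicit Types (e : E) (g : E -> int).

Let sw' e := (sw^-1)%g e.
Let sb' e := (sb^-1)%g e.

(** A corner function gives the value [rw e] (resp. [rb e]) to the corner that
    follows [e] counterclockwise at its white (resp. black) end. Compatibility
    says that its jump across [e] is the same at both ends, hence that its
    variation along [e] is the same on both sides. *)
Definition compat (rw rb : E -> int) : Prop :=
  forall e, rw e - rw ((sw^-1)%g e) = rb ((sb^-1)%g e) - rb e.

Definition jump (rw : E -> int) e := rw e - rw ((sw^-1)%g e).

Definition coch (rw rb : E -> int) e := rw e - rb ((sb^-1)%g e).

Lemma sum_permV (V : nmodType) (s : {perm E}) (F : E -> V) :
  \sum_e F ((s^-1)%g e) = \sum_e F e.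
Proof. by rewrite [RHS](reindex_inj (@perm_inj _ (s^-1)%g)). Qed.

Lemma sum_perm (V : nmodType) (s : {perm E}) (F : E -> V) :
  \sum_e F (s e) = \sum_e F e.
Proof. by rewrite [RHS](reindex_inj (@perm_inj _ s)). Qed.

(** Edge by edge, the two sides differ by differences of products of values at
    successive corners, which telescope around the nodes. *)
Lemma jump_antisym (rw rb qw qb : E -> int) :
  compat rw rb -> compat qw qb ->
  \sum_e coch rw rb e * jump qw e = - \sum_e coch qw qb e * jump rw e.
Proof.
move=> cr cq; apply/eqP; rewrite -addr_eq0 -big_split /=.
under eq_bigr => e _.
  have -> : coch rw rb e * jump qw e + coch qw qb e * jump rw e =
      (rw e * qw e - (rw (sw' e) * qw (sw' e))) +
      (rb e * qb e - (rb (sb' e) * qb (sb' e))).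
    have := cr e; have := cq e; rewrite /coch /jump /sw' /sb'.
    set a := rw e; set a' := rw _; set b := rb e; set b' := rb _.
    set c := qw e; set c' := qw _; set d := qb e; set d' := qb _.
    move=> h1 h2.
    have -> : c' = c - (d' - d) by rewrite -h1; ring.
    have -> : a' = a - (b' - b) by rewrite -h2; ring.
    ring.
  over.
rewrite !big_split /= !sumrN.
by rewrite (sum_permV sw (fun e => rw e * qw e)) (sum_permV sb (fun e => rb e * qb e)) !subrr.
Qed.

Lemma sum_porbit_jump (V : zmodType) (s : {perm E}) (F : E -> V) x :
  \sum_(y in porbit s x) (F y - F ((s^-1)%g y)) = 0.
Proof.
rewrite sumrB; apply/eqP; rewrite subr_eq0; apply/eqP.
rewrite (reindex_inj (@perm_inj _ (s^-1)%g)) /=; apply: eq_bigl => y.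
by rewrite -[in RHS](permKV s y) mem_porbitS.
Qed.

Definition ribbon_face : {perm E} := (sw^-1 * sb^-1)%g.

Lemma ribbon_faceE e : ribbon_face e = sb' (sw' e). Proof. by rewrite permM. Qed.

Lemma ribbon_face_sw e : ribbon_face (sw e) = sb' e.
Proof. by rewrite ribbon_faceE /sw' permK. Qed.

(** Integrating around each face gives the values at its black corners, and
    the cochain itself then gives those at its white corners. *)
Lemma coch_exists (q : E -> int) :
  (forall x, \sum_(y in porbit ribbon_face x) (q y - q ((sw^-1)%g y)) = 0) ->
  exists rw rb : E -> int, compat rw rb /\ coch rw rb =1 q.
Proof.
move/(@orbit_potential _ ribbon_face _ (fun y => q y - q (sw' y))) => [Q HQ].
have HQ' e : Q (sb' e) = Q (sw e) + (q (sw e) - q e).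
  by rewrite -(ribbon_face_sw e) HQ /sw' permK.
exists (fun e => Q (sw e) + q (sw e)), Q; split=> e.
  by rewrite permKV -/(sb' e) HQ'; ring.
by rewrite /coch -/(sb' e) HQ'; ring.
Qed.

End Ribbon.

(** * The pairing and the area of closed lines *)

Lemma pairingDl u v w : pairing (u + v) w = pairing u w + pairing v w.
Proof. by rewrite /pairing !mxE; ring. Qed.
Lemma pairingDr u v w : pairing u (v + w) = pairing u v + pairing u w.
Proof. by rewrite /pairing !mxE; ring. Qed.
Lemma pairingNl u v : pairing (- u) v = - pairing u v.
Proof. by rewrite /pairing !mxE; ring. Qed.
Lemma pairingNr u v : pairing u (- v) = - pairing u v.
Proof. by rewrite /pairing !mxE; ring. Qed.
Lemma pairingC u v : pairing u v = - pairing v u.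
Proof. by rewrite /pairing; ring. Qed.
Lemma pairing0l u : pairing 0 u = 0.
Proof. by rewrite /pairing !mxE; ring. Qed.
Lemma pairing0r u : pairing u 0 = 0.
Proof. by rewrite /pairing !mxE; ring. Qed.
Lemma pairingZl a u v : pairing (a *: u) v = a * pairing u v.
Proof. by rewrite /pairing !mxE; ring. Qed.
Lemma pairingZr a u v : pairing u (a *: v) = a * pairing u v.
Proof. by rewrite /pairing !mxE; ring. Qed.
Lemma pairing_suml (I : Type) (r : seq I) (P : pred I) (F : I -> Z2) v :
  pairing (\sum_(i <- r | P i) F i) v = \sum_(i <- r | P i) pairing (F i) v.
Proof.
apply: (big_morph (fun u => pairing u v)) => [x y|]; first exact: pairingDl.
exact: pairing0l.
Qed.
Lemma pairing_sumr (I : Type) (r : seq I) (P : pred I) (F : I -> Z2) v :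
  pairing v (\sum_(i <- r | P i) F i) = \sum_(i <- r | P i) pairing v (F i).
Proof.
apply: (big_morph (fun u => pairing v u)) => [x y|]; first exact: pairingDr.
exact: pairing0r.
Qed.

Lemma area2_rcons s v :
  area2 (rcons s v) = area2 s + pairing (\sum_(x <- s) x) v.
Proof.
rewrite /area2 size_rcons big_ord_recr /=; congr (_ + _).
  apply: eq_bigr => i _; rewrite nth_rcons ltn_ord; congr (pairing _ _).
  by apply: eq_bigr => j _; rewrite nth_rcons (ltn_trans (ltn_ord j) (ltn_ord i)).
rewrite nth_rcons ltnn eqxx (big_nth 0) big_mkord; congr (pairing _ _).
by apply: eq_bigr => j _; rewrite nth_rcons ltn_ord.
Qed.

Lemma area2_cat2 s u v :
  area2 (s ++ [:: u; v]) = area2 s + pairing (\sum_(x <- s) x) u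
     + pairing (\sum_(x <- s) x + u) v.
Proof. by rewrite -cat_rcons cats1 !area2_rcons -cats1 big_cat /= big_seq1. Qed.

(** * Cycles and the area of the faces *)

Section Torus.
Variable G : bicolored_graph.
Local Notation E := (edge G).
Local Notation sw := (rotw G).
Local Notation sb := (rotb G).
Local Notation fp := (face_perm G).
Implicit Types (e : E) (g : E -> int).

Definition bsum g b : int := \sum_(e | bend e == b) g e.
Definition wsum g w : int := \sum_(e | wend e == w) g e.
Definition cycle_chain g := (forall b, bsum g b = 0) /\ (forall w, wsum g w = 0).
(** The class in [H_1] of a cycle. *)
Definition cls g : Z2 := \sum_e g e *: disp e.

Lemma bend_rotb e : bend (sb e) = bend e.
Proof. by apply/eqP; rewrite -rotbP mem_porbitS porbit_id. Qed.
Lemma wend_rotw e : wend (sw e) = wend e.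
Proof. by apply/eqP; rewrite -rotwP mem_porbitS porbit_id. Qed.
Lemma bend_rotbV e : bend ((sb^-1)%g e) = bend e.
Proof. by rewrite -{2}(permKV sb e) bend_rotb. Qed.
Lemma wend_rotwV e : wend ((sw^-1)%g e) = wend e.
Proof. by rewrite -{2}(permKV sw e) wend_rotw. Qed.

Lemma cls0E g : cls g 0 0 = \sum_e g e * disp e 0 0.
Proof. by rewrite /cls summxE; apply: eq_bigr => e _; rewrite mxE. Qed.
Lemma cls1E g : cls g 0 1 = \sum_e g e * disp e 0 1.
Proof. by rewrite /cls summxE; apply: eq_bigr => e _; rewrite mxE. Qed.

Lemma cycle_jump rw rb : compat sw sb rw rb -> cycle_chain (jump sw rw).
Proof.
move=> c; split=> [b|w].
  rewrite /bsum; case: (pickP (fun e => bend e == b)) => [e /eqP eb|no]; last first.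
    by rewrite big_pred0.
  rewrite -eb (eq_bigl (fun x => x \in porbit sb e)) => [|x]; last by rewrite rotbP eq_sym.
  rewrite -[RHS](sum_porbit_jump sb (fun x => - rb x) e).
  by apply: eq_bigr => x _; rewrite /jump c; ring.
rewrite /wsum; case: (pickP (fun e => wend e == w)) => [e /eqP eb|no]; last first.
  by rewrite big_pred0.
rewrite -eb (eq_bigl (fun x => x \in porbit sw e)) => [|x]; last by rewrite rotwP eq_sym.
exact: sum_porbit_jump sw rw e.
Qed.

Hypothesis closed : forall e, \sum_(v <- face_boundary e) v = 0.

Lemma sum_face_boundary e :
  \sum_(v <- face_boundary e) v =
  \sum_(y in porbit fp e) (disp y - disp ((sw^-1)%g y)).
Proof.
rewrite (eq_bigl _ _ (porbit_traject _ _)) -big_uniq ?uniq_traject_porbit //=.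
rewrite /face_boundary; elim: traject => [|x s IH]; first by rewrite /= !big_nil.
by rewrite /= !big_cons IH addrA.
Qed.

Lemma closed_coord j e :
  \sum_(y in porbit fp e) (disp y 0 j - disp ((sw^-1)%g y) 0 j) = 0.
Proof.
have := congr1 (fun v : Z2 => v 0 j) (closed e).
rewrite sum_face_boundary summxE [RHS]mxE => h; rewrite -[RHS]h.
by apply: eq_bigr => y _; rewrite !mxE.
Qed.

Section Area.
Variables (xw xb yw yb : E -> int).
Hypotheses (cx : compat sw sb xw xb) (cy : compat sw sb yw yb).
Hypotheses (hx : coch sb xw xb =1 fun e => disp e 0 0).
Hypotheses (hy : coch sb yw yb =1 fun e => disp e 0 1).

Let V e : Z2 := \row_j (if j == 0 then xb e else yb e).
Let U e := pairing (V e) (disp e) - pairing (V e + disp e) (disp ((sw^-1)%g e)).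

Let V_phi e : V (fp e) = V e + disp e - disp ((sw^-1)%g e).
Proof.
have H rw rb e1 : compat sw sb rw rb ->
    rb (fp e1) = rb e1 + coch sb rw rb e1 - coch sb rw rb ((sw^-1)%g e1).
  by move=> c; rewrite /coch /face_perm permM; have := c e1; set a := rb _ => h; lia.
apply/rowP => j; rewrite !mxE; case: (altP (j =P 0)) => [->|j1].
  by rewrite (H xw) // !hx.
have -> : j = 1 by apply/eqP; move: j1; case: j => [[|[|]]].
by rewrite (H yw) // !hy.
Qed.

Let area_traject n e :
  let s := flatten [seq [:: disp x; - disp ((sw^-1)%g x)] | x <- traject fp e n] in
  \sum_(v <- s) v = V (iter n fp e) - V e /\
  area2 s = \sum_(i < n) (U (iter i fp e)
     - pairing (V e) (disp (iter i fp e) - disp ((sw^-1)%g (iter i fp e)))).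
Proof.
elim: n => [|n [IH1 IH2]]; first by rewrite /= big_nil /area2 !big_ord0 subrr.
rewrite trajectSr map_rcons flatten_rcons /=; set x := iter n fp e.
rewrite area2_cat2 big_cat /= !big_cons big_nil addr0.
rewrite IH1 IH2 V_phi; split; first by rewrite addrAC addrA.
rewrite big_ord_recr /= -/x -addrA; congr (_ + _).
by rewrite /U !(pairingDl, pairingDr, pairingNl, pairingNr); ring.
Qed.

(** The shoelace formula from the origin, for the polygon whose vertices are
    the values [V] at the corners of the face. *)
Lemma area_face e : area2 (face_boundary e) = \sum_(x in porbit fp e) U x.
Proof.
rewrite /face_boundary (area_traject _ e).2 sum_porbit sumrB -pairing_sumr.
rewrite -(sum_porbit _ (fun x => disp x - disp ((sw^-1)%g x))).
by rewrite -sum_face_boundary closed pairing0r subr0.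
Qed.

Lemma porbit_fconnect (T : finType) (s : {perm T}) x y : (y \in porbit s x) = fconnect s x y.
Proof.
apply/idP/idP => [/porbitP [i ->]|/iter_findex <-].
  by rewrite permX fconnect_iter.
by rewrite -permX mem_porbit.
Qed.

Lemma sum_froots (T : finType) (s : {perm T}) (F : T -> int) :
  \sum_(e in froots s) \sum_(x in porbit s e) F x = \sum_x F x.
Proof.
have sy : connect_sym (frel s) by apply: fconnect_sym; exact: perm_inj.
rewrite [RHS](partition_big (fun x => froot s x) (mem (froots s))) /=; last first.
  by move=> x _; exact: roots_root.
apply: eq_bigr => e re; apply: eq_bigl => x.
rewrite porbit_fconnect -(root_connect sy).
by rewrite (eqP (re : froots s e)) eq_sym.
Qed.

(** Summed over all faces, the shoelace terms regroup by edges into the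
    pairing of the two coordinate corner functions. *)
Lemma area_jump :
  \sum_(e in froots fp) area2 (face_boundary e) =
  2 * \sum_e coch sb xw xb e * jump sw yw e.
Proof.
rewrite (eq_bigr _ (fun e _ => area_face e)) sum_froots.
have -> : \sum_e U e = \sum_e (pairing (V e) (disp e)
     - (xw e * disp e 0 1 - yw e * disp e 0 0)).
  rewrite /U sumrB [RHS]sumrB; congr (_ - _).
  rewrite -[RHS](sum_permV sw (fun e => xw e * disp e 0 1 - yw e * disp e 0 0)).
  apply: eq_bigr => e _; rewrite /pairing !mxE /=.
  have -> : xb e + disp e 0 0 = xw ((sw^-1)%g e).
    by rewrite -hx /coch; have := cx e; lia.
  have -> // : yb e + disp e 0 1 = yw ((sw^-1)%g e).
  by rewrite -hy /coch; have := cy e; lia.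
rewrite mulr_natl mulr2n {2}(jump_antisym cx cy) -sumrN -big_split /=.
apply: eq_bigr => e _; rewrite /pairing !mxE /= -hx -hy /jump /coch.
by have := cx e; have := cy e => h1 h2; lia.
Qed.

End Area.
End Torus.

(** * Homology of the torus *)

Lemma common_denominator (T : finType) (u : T -> rat) :
  exists2 M : int, M != 0 & forall x, exists k : int, M%:~R * u x = k%:~R.
Proof.
exists (\prod_x denq (u x)); first by apply/prodf_neq0 => x _; apply: denq_neq0.
move=> x; rewrite (bigD1 x) //=; set P := \prod_(_ | _) _.
exists (numq (u x) * P); rewrite rmorphM mulrAC rmorphM; congr (_ * _).
by rewrite mulrC -{1}(divq_num_den (u x)) divfK // intr_eq0 denq_neq0.
Qed.

Lemma rank_le1 (F : fieldType) m n (A : 'M[F]_(m, n)) (v : 'rV[F]_n) :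
  (forall u : 'rV[F]_n, (u <= A)%MS -> exists a, u = a *: v) -> (\rank A <= 1)%N.
Proof.
move=> h; apply: leq_trans (rank_leq_row v); apply: mxrankS; apply/row_subP => i.
by have [a ->] := h _ (row_sub i A); exact: scalemx_sub.
Qed.

Lemma sum_enum_val (T : finType) (V : nmodType) (F : T -> V) :
  \sum_(i < #|T|) F (enum_val i) = \sum_x F x.
Proof. by rewrite -big_enum_val. Qed.

Lemma sum_porbit_next (T : finType) (s : {perm T}) (V : zmodType) (F : T -> V) x :
  \sum_(y in porbit s x) (F (s y) - F y) = 0.
Proof.
rewrite -[RHS](sum_porbit_jump s F x) [RHS](reindex_inj (@perm_inj _ s)) /=.
by apply: eq_big => y; rewrite ?mem_porbitS ?permK.
Qed.

(** The data of [on_torus] when no node is isolated, which is so as soon as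
    there is a perfect matching. *)
Record torus_graph (G : bicolored_graph) : Prop := TorusGraph {
  torus_connected : connected G;
  torus_euler : (#|black G| + #|white G| + #|porbits (face_perm G)| = #|edge G|)%N;
  torus_bend : forall b : black G, exists e, bend e = b;
  torus_wend : forall w : white G, exists e, wend e = w;
  torus_closed : forall e : edge G, \sum_(v <- face_boundary e) v = 0;
  torus_area : \sum_(e in froots (face_perm G)) area2 (face_boundary e) = 2
}.

Section Homology.
Variable G : bicolored_graph.
Local Notation E := (edge G).
Local Notation sw := (rotw G).
Local Notation sb := (rotb G).
Local Notation fp := (face_perm G).
Implicit Types (e : E) (g : E -> int).

Hypothesis torus : torus_graph G.
Let conn := torus_connected torus.
Let euler := torus_euler torus.
Let bsurj := torus_bend torus.
Let wsurj := torus_wend torus.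
Let closed := torus_closed torus.
Let area := torus_area torus.

Lemma conn_const (T : Type) (f : E -> T) :
  (forall e, f (sb e) = f e) -> (forall e, f (sw e) = f e) -> forall e e', f e = f e'.
Proof.
move=> hb hw e e'; have iterE (s : {perm E}) x y : (forall e, f (s e) = f e) ->
    y \in porbit s x -> f x = f y.
  move=> hs /porbitP [i ->]; rewrite permX.
  by elim: i => //= i IH; rewrite hs.
have /connectP [p + ->] := conn e e'.
elim: p e => //= x p IH e /andP [ex px]; rewrite -(IH x px).
case/orP: ex => h; [apply: (iterE sb)|apply: (iterE sw)] => //.
  by rewrite rotbP eq_sym.
by rewrite rotwP eq_sym.
Qed.

(** The coordinates of [disp] are closed cochains, hence come from corner
    functions. That the area is that of one torus gives the classes of the
    cycles of their jumps: these are the curves dual to the two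
    coordinates. *)
Lemma coord_corners : exists xw xb yw yb : E -> int,
  [/\ compat sw sb xw xb, compat sw sb yw yb,
      forall g, cls g 0 0 = \sum_e coch sb xw xb e * g e,
      forall g, cls g 0 1 = \sum_e coch sb yw yb e * g e &
      [/\ cls (jump sw xw) 0 0 = 0, cls (jump sw xw) 0 1 = -1,
          cls (jump sw yw) 0 0 = 1 & cls (jump sw yw) 0 1 = 0]].
Proof.
have [xw [xb [cx hx]]] := coch_exists (closed_coord closed 0).
have [yw [yb [cy hy]]] := coch_exists (closed_coord closed 1).
have clsx g : cls g 0 0 = \sum_e coch sb xw xb e * g e.
  by rewrite cls0E; apply: eq_bigr => e _; rewrite hx mulrC.
have clsy g : cls g 0 1 = \sum_e coch sb yw yb e * g e.
  by rewrite cls1E; apply: eq_bigr => e _; rewrite hy mulrC.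
have := area; rewrite (area_jump closed cx cy hx hy) => B.
exists xw, xb, yw, yb; split=> //; rewrite !(clsx, clsy).
by have := (jump_antisym cx cx, jump_antisym cy cy, jump_antisym cx cy) => -[[]]; split; lia.
Qed.

Local Notation N := (black G + white G + bool)%type.

Let inc e (n : N) : int :=
  match n with
  | inl (inl b) => (bend e == b)%:R
  | inl (inr w) => (wend e == w)%:R
  | inr c => if c then disp e 0 0 else disp e 0 1
  end.

Let M : 'M[rat]_(#|E|, #|{: N}|) :=
  \matrix_(i, j) (inc (enum_val i) (enum_val j))%:~R.

Let inF (f : {set E}) e : int := (sw e \in f)%:R - (e \in f)%:R.

Let Bd : 'M[rat]_(#|porbits fp|, #|E|) :=
  \matrix_(f, i) (inF (enum_val f) (enum_val i))%:~R.

(** The rows of [M] are the edges, with their ends and their displacements, so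
    its kernel is the space of cycles of class zero; the rows of [Bd] are the
    boundaries of the faces. *)
Lemma Bd_M : Bd *m M = 0.
Proof.
apply/matrixP => f j; rewrite !mxE.
under eq_bigr do rewrite !mxE -rmorphM.
rewrite -rmorph_sum /= -[RHS](rmorph0 (intr : int -> rat)); congr (_%:~R).
rewrite (sum_enum_val (fun e => inF (enum_val f) e * inc e (enum_val j))).
set n := enum_val j.
have /imsetP [x _ ->] := enum_valP f.
rewrite /inF; under eq_bigr do rewrite mulrBl.
rewrite sumrB -(sum_permV sw (fun e => (sw e \in porbit fp x)%:R * inc e n)).
under eq_bigr do rewrite permKV.
rewrite -sumrB; under eq_bigr do rewrite -mulrBr mulr_natl mulrb.
rewrite -big_mkcond /=; case: n => [[b|w]|c] /=.
- rewrite -[RHS](sum_porbit_next fp (fun e => (bend e == b)%:R : int) x).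
  by apply: eq_bigr => e _; rewrite /face_perm permM bend_rotbV.
- by apply: big1 => e _; rewrite wend_rotwV subrr.
rewrite -[LHS]opprK -sumrN; under eq_bigr do rewrite opprB.
by case: c; rewrite closed_coord ?oppr0.
Qed.

Let rank_Bd : (#|porbits fp| <= (\rank Bd).+1)%N.
Proof.
have h : (\rank (kermx Bd) <= 1)%N.
  apply: (@rank_le1 _ _ _ _ (const_mx 1)) => u /sub_kermxP uB.
  (* [u] takes equal values on the two faces along an edge. *)
  have t e : forall i j : 'I_#|porbits fp|, enum_val i = porbit fp e ->
     enum_val j = porbit fp (sw e) -> u 0 i = u 0 j.
    move=> i j hi hj; have := congr1 (fun v : 'rV_ _ => v 0 (enum_rank e)) uB.
    rewrite !mxE; have [->//|ij] := eqVneq i j.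
    rewrite (bigD1 i) //= (bigD1 j) 1?eq_sym //= big1 ?addr0 => [|k /andP [ki kj]].
      rewrite !mxE enum_rankK /inF hi hj !porbit_id.
      have nij : porbit fp e != porbit fp (sw e).
        by rewrite -hi -hj (inj_eq enum_val_inj).
      rewrite eq_porbit_mem in nij; rewrite (negPf nij) porbit_sym (negPf nij).
      rewrite subr0 sub0r mulr1 rmorphN mulrN mulr1 => /eqP.
      by rewrite addrC subr_eq0 => /eqP.
    rewrite !mxE enum_rankK /inF.
    have /imsetP [x _ hx] := enum_valP k.
    rewrite hx -!eq_porbit_mem -hx -hi -hj !(inj_eq enum_val_inj) ?[_ == k]eq_sym.
    by rewrite (negPf ki) (negPf kj) subrr mulr0.
  have fin (e : E) : porbit fp e \in porbits fp by apply: imset_f.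
  pose f e := u 0 (enum_rank_in (fin e) (porbit fp e)).
  have fE e i : enum_val i = porbit fp e -> u 0 i = f e.
    move=> hi; rewrite /f; congr (u 0 _).
    by apply: enum_val_inj; rewrite enum_rankK_in ?hi ?fin.
  have fs e : f (sw e) = f e.
    rewrite /f; apply/esym/(t e); rewrite enum_rankK_in //.
  have fb e : f (sb e) = f e.
    have fphi e0 : f (fp e0) = f e0.
      by apply/esym/fE; rewrite enum_rankK_in ?fin // -(porbitS fp).
    by rewrite -[in LHS]fs -fphi ribbon_face_sw permK.
  have [i|no] := pickP 'I_#|porbits fp|; last first.
    by exists 0; apply/rowP => i; have := no i.
  move=> _; exists (u 0 i); apply/rowP => k; rewrite !mxE mulr1.
  have /imsetP [x _ hx] := enum_valP i; have /imsetP [y _ hy] := enum_valP k.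
  by rewrite (fE x i hx) (fE y k hy); exact: conn_const.
by move: h; rewrite mxrank_ker; lia.
Qed.

Let rank_M : (#|black G| + #|white G| + 1 <= \rank M)%N.
Proof.
have h : (\rank (kermx M^T) <= 1)%N.
  pose v0 : 'rV[rat]_#|{: N}| := \row_j match enum_val j with
    | inl (inl _) => 1 | inl (inr _) => -1 | inr _ => 0 end.
  apply: (@rank_le1 _ _ _ _ v0) => u /sub_kermxP uM.
  pose f n := u 0 (enum_rank n).
  have ue e : f (inl (inl (bend e))) + f (inl (inr (wend e))) +
      f (inr true) * (disp e 0 0)%:~R + f (inr false) * (disp e 0 1)%:~R = 0.
    have := congr1 (fun v : 'rV_ _ => v 0 (enum_rank e)) uM.
    rewrite !mxE; under eq_bigr => j _.
      rewrite !mxE enum_rankK -[u 0 j]/(u 0 j) -{1}(enum_valK j) -/(f _).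
      over.
    rewrite (sum_enum_val (fun n => f n * (inc e n)%:~R)) => <-.
    rewrite big_sumType /= big_sumType /= big_bool /= addrA; congr (_ + _ + _ + _).
      rewrite (bigD1 (bend e)) //= eqxx mulr1 big1 ?addr0 // => b.
      by rewrite eq_sym => /negPf ->; rewrite mulr0.
    rewrite (bigD1 (wend e)) //= eqxx mulr1 big1 ?addr0 // => b.
    by rewrite eq_sym => /negPf ->; rewrite mulr0.
  have fcyc g : cycle_chain g ->
      f (inr true) * (cls g 0 0)%:~R + f (inr false) * (cls g 0 1)%:~R = 0.
    case=> gb gw; have : \sum_e (g e)%:~R * (f (inl (inl (bend e))) + f (inl (inr (wend e))) +
        f (inr true) * (disp e 0 0)%:~R + f (inr false) * (disp e 0 1)%:~R) = 0.
      by apply: big1 => e _; rewrite ue mulr0.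
    under eq_bigr do rewrite !mulrDr.
    rewrite !big_split /=.
    rewrite (partition_big (@bend G) predT) //= big1 => [|b _]; last first.
      rewrite -[RHS](mul0r (f (inl (inl b)))) -[0 in RHS](rmorph0 (intr : int -> rat)).
      rewrite -(gb b) rmorph_sum mulr_suml.
      by apply: eq_bigr => e /eqP ->.
    rewrite (partition_big (@wend G) predT) //= big1 => [|w _]; last first.
      rewrite -[RHS](mul0r (f (inl (inr w)))) -[0 in RHS](rmorph0 (intr : int -> rat)).
      rewrite -(gw w) rmorph_sum mulr_suml.
      by apply: eq_bigr => e /eqP ->.
    rewrite !add0r cls0E cls1E !rmorph_sum !mulr_sumr => h.
    by rewrite -[RHS]h; congr (_ + _); apply: eq_bigr => e _; rewrite rmorphM mulrCA.
  have [xw [xb [yw [yb [cx cy _ hy [x0 x1 y0 y1]]]]]] := coord_corners.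
  have f1 : f (inr true) = 0.
    by have := fcyc _ (cycle_jump cy); rewrite y0 y1 mulr1 mulr0 addr0.
  have f0 : f (inr false) = 0.
    have := fcyc _ (cycle_jump cx); rewrite x0 x1 mulr0 add0r rmorphN mulrN mulr1.
    by move/eqP; rewrite oppr_eq0 => /eqP.
  have [e1 _|no] := pickP E; last by move: y0; rewrite cls0E big_pred0.
  have fbw e : f (inl (inr (wend e))) = - f (inl (inl (bend e))).
    have := ue e; rewrite f1 f0 !mul0r !addr0 => /eqP.
    by rewrite addrC addr_eq0 => /eqP.
  have fb e : f (inl (inl (bend e))) = f (inl (inl (bend e1))).
    apply: (conn_const (f := fun e => f (inl (inl (bend e))))) => {}e.
      by rewrite bend_rotb.
    by apply: oppr_inj; rewrite -!fbw wend_rotw.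
  exists (f (inl (inl (bend e1)))); apply/rowP => j; rewrite !mxE.
  rewrite -[u 0 j]/(u 0 j) -{1}(enum_valK j) -/(f _).
  case: (enum_val j) => [[b|w]|c].
  - by have [e <-] := bsurj b; rewrite fb mulr1.
  - by have [e <-] := wsurj w; rewrite fbw fb mulrN1.
  - by rewrite mulr0; case: c.
have cN : #|{: N}| = (#|black G| + #|white G| + 2)%N by rewrite !card_sum card_bool.
by move: h; rewrite mxrank_ker mxrank_tr; lia.
Qed.

(** Only multiples of the sum of all faces are killed by [Bd], as the graph is
    connected, and [M] has at least the rank of the nodes plus one; by the
    Euler characteristic the boundaries then span the cycles of class zero.
    The factor [m] clears the denominators. *)
Lemma boundary_of_cls0 g : cycle_chain g -> cls g = 0 ->
  exists (m : int) (t : E -> int), [/\ m != 0, forall e, t (fp e) = t e &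
    forall e, m * g e = t (sw e) - t e].
Proof.
move=> [gb gw] g0; pose v : 'rV[rat]_#|E| := \row_i (g (enum_val i))%:~R.
have vM : v *m M = 0.
  apply/rowP => j; rewrite !mxE; under eq_bigr do rewrite !mxE -rmorphM.
  rewrite -rmorph_sum -[RHS](rmorph0 (intr : int -> rat)); congr (_%:~R).
  rewrite (sum_enum_val (fun e => g e * inc e (enum_val j))).
  case: (enum_val j) => [[b|w]|c] /=.
  - rewrite -[RHS](gb b) /bsum [RHS]big_mkcond /=.
    by apply: eq_bigr => e _; case: (_ == _); rewrite ?mulr1 ?mulr0.
  - rewrite -[RHS](gw w) /wsum [RHS]big_mkcond /=.
    by apply: eq_bigr => e _; case: (_ == _); rewrite ?mulr1 ?mulr0.
  - by case: c; rewrite -?cls0E -?cls1E g0 mxE.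
have BM : (Bd <= kermx M)%MS by apply/sub_kermxP; exact: Bd_M.
have /eqmxP eqBM : (Bd == kermx M)%MS.
  rewrite -(mxrank_leqif_eq BM); apply/eqP/anti_leq; rewrite (mxrankS BM) mxrank_ker /=.
  rewrite leq_subLR; apply: (leq_trans _ (leq_add rank_M (leqnn _))).
  apply: (@leq_trans (#|black G| + #|white G| + #|porbits fp|)); first by rewrite euler.
  by rewrite -[X in (_ <= X)%N]addnA leq_add2l add1n; apply: rank_Bd.
have /submxP [w vw] : (v <= Bd)%MS by rewrite eqBM; apply/sub_kermxP.
have [m m0 mw] := common_denominator (fun i => w 0 i).
have fin (e : E) : porbit fp e \in porbits fp by apply: imset_f.
pose idx e := enum_rank_in (fin e) (porbit fp e).
have idxE e i : enum_val i = porbit fp e -> i = idx e.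
  by move=> hi; apply: enum_val_inj; rewrite enum_rankK_in ?hi ?fin.
pose t e := numq (m%:~R * w 0 (idx e)).
have tE e : (t e)%:~R = m%:~R * w 0 (idx e).
  by rewrite /t; have [k ->] := mw (idx e); rewrite numq_int.
exists m, t; split=> // e.
  rewrite /t; congr (numq (_ * w 0 _)); apply/idxE.
  by rewrite enum_rankK_in ?fin // porbitS.
have := congr1 (fun v : 'rV_ _ => v 0 (enum_rank e)) vw; rewrite !mxE enum_rankK => ge.
apply: (@intr_inj rat); rewrite rmorphM rmorphB /= ge !tE -mulrBr; congr (_ * _).
under eq_bigr => i _ do rewrite !mxE enum_rankK rmorphB mulrBr.
rewrite sumrB; congr (_ - _).
  rewrite (bigD1 (idx (sw e))) //= big1 ?addr0 => [|i ni].
    by rewrite enum_rankK_in ?fin // porbit_id mulr1.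
  case: (boolP (sw e \in enum_val i)) => [h|]; last by rewrite mulr0.
  case/eqP: ni; apply: idxE; have /imsetP [x _ hx] := enum_valP i.
  by move: h; rewrite hx -eq_porbit_mem => /eqP.
rewrite (bigD1 (idx e)) //= big1 ?addr0 => [|i ni].
  by rewrite enum_rankK_in ?fin // porbit_id mulr1.
case: (boolP (e \in enum_val i)) => [h|]; last by rewrite mulr0.
case/eqP: ni; apply: idxE; have /imsetP [x _ hx] := enum_valP i.
by move: h; rewrite hx -eq_porbit_mem => /eqP.
Qed.

(** A function of the faces is itself a compatible corner function, with
    vanishing cochain. *)
Lemma face_fun_coch rw rb (t : E -> int) : compat sw sb rw rb ->
  (forall e, t (fp e) = t e) ->
  \sum_e coch sb rw rb e * (t (sw e) - t e) = 0.
Proof.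
move=> c ht; have ht' e : t ((sb^-1)%g e) = t (sw e) by rewrite -(ribbon_face_sw sw) ht.
have cf : compat sw sb (fun e => t (sw e)) t by move=> e; rewrite permKV ht'.
have := jump_antisym c cf; rewrite [X in _ = - X]big1 ?oppr0 => [h|e _].
  by rewrite -[RHS]h; apply: eq_bigr => e _; rewrite /jump permKV.
by rewrite /coch ht' subrr mul0r.
Qed.

Lemma coch_cls0 rw rb g : compat sw sb rw rb -> cycle_chain g -> cls g = 0 ->
  \sum_e coch sb rw rb e * g e = 0.
Proof.
move=> c cg g0; have [m [t [m0 ht tg]]] := boundary_of_cls0 cg g0.
apply: (mulfI m0); rewrite mulr0 mulr_sumr.
rewrite -[RHS](face_fun_coch c ht); apply: eq_bigr => e _.
by rewrite -tg mulrCA.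
Qed.

Lemma cycle_lin a b g g' : cycle_chain g -> cycle_chain g' ->
  cycle_chain (fun e => a * g e + b * g' e).
Proof.
move=> [hb hw] [hb' hw']; split=> [x|x].
  by rewrite /bsum big_split -!mulr_sumr -!/(bsum _ _) hb hb' !mulr0.
by rewrite /wsum big_split -!mulr_sumr -!/(wsum _ _) hw hw' !mulr0.
Qed.

Lemma cls_lin a b g g' :
  cls (fun e => a * g e + b * g' e) = a *: cls g + b *: cls g'.
Proof.
rewrite /cls !scaler_sumr -big_split; apply: eq_bigr => e _ /=.
by rewrite scalerDl !scalerA.
Qed.

Lemma Z2P (u v : Z2) : u 0 0 = v 0 0 -> u 0 1 = v 0 1 -> u = v.
Proof.
move=> h0 h1; apply/rowP => -[[|[|//]] i].
  by move: h0; congr (u _ _ = v _ _); apply: val_inj.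
by move: h1; congr (u _ _ = v _ _); apply: val_inj.
Qed.

(** Both sides depend on [g] through its class only, since they vanish on
    boundaries of faces; and for the two coordinate cycles the formula is the
    antisymmetry of the pairing of corner functions. The right-hand side is
    the intersection number of [g] with the cycle of jumps of the corner
    function. *)
Theorem intersection rw rb g : compat sw sb rw rb -> cycle_chain g ->
  \sum_e coch sb rw rb e * g e = pairing (cls (jump sw rw)) (cls g).
Proof.
move=> c cg; have [xw [xb [yw [yb [cx cy hx hy [x0 x1 y0 y1]]]]]] := coord_corners.
(* The combination of the two coordinate cycles that has the class of [g]. *)
pose h := fun e => cls g 0 0 * jump sw yw e + (- cls g 0 1) * jump sw xw e.
have ch : cycle_chain h by apply: cycle_lin; apply: cycle_jump; eassumption.
have clsh : cls h = cls g.
  by rewrite cls_lin; apply: Z2P; rewrite !mxE ?x0 ?x1 ?y0 ?y1; ring.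
have : \sum_e coch sb rw rb e * (1 * g e + (-1) * h e) = 0.
  apply: coch_cls0 => //; first exact: cycle_lin.
  by rewrite cls_lin clsh scale1r scaleN1r subrr.
under eq_bigr do rewrite mul1r mulN1r mulrBr.
rewrite sumrB => /eqP; rewrite subr_eq0 => /eqP ->.
under eq_bigr do rewrite mulrDr mulrCA (mulrCA _ (- _)).
rewrite big_split /= -!mulr_sumr.
by rewrite (jump_antisym c cy) (jump_antisym c cx) -hx -hy /pairing; ring.
Qed.

Lemma cycle_of_cls (v : Z2) : exists2 g : E -> int, cycle_chain g & cls g = v.
Proof.
have [xw [xb [yw [yb [cx cy _ _ [x0 x1 y0 y1]]]]]] := coord_corners.
exists (fun e => v 0 0 * jump sw yw e + (- v 0 1) * jump sw xw e).
  by apply: cycle_lin; apply: cycle_jump; eassumption.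
by rewrite cls_lin; apply: Z2P; rewrite !mxE ?x0 ?x1 ?y0 ?y1; ring.
Qed.

End Homology.

(** * Matchings and circulations *)

(** A minimal nonempty stable subset. *)
Lemma permuted_subset (T : finType) (f : T -> T) (A : {set T}) :
  A != finset.set0 -> (forall x, x \in A -> f x \in A) ->
  exists A' : {set T}, [/\ A' \subset A, A' != finset.set0, f @: A' = A' &
    {in A' &, injective f}].
Proof.
move=> A0 fA; pose P (B : {set T}) := [&& B \subset A, B != finset.set0 & f @: B \subset B].
have [|A' /minsetP [/and3P [sA nA cA] minA]] := @ex_minset _ P.
  exists A; rewrite /P fintype.subxx A0 /=; apply/fintype.subsetP => _ /imsetP [x xA ->]; exact: fA.
have fE : f @: A' = A'.
  apply: minA => //; apply/and3P; split; first exact: (fintype.subset_trans cA sA).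
    by have /set0Pn [x xA] := nA; apply/set0Pn; exists (f x); apply: imset_f.
  exact: imsetS.
by exists A'; split=> //; apply/imset_injP; rewrite fE.
Qed.

Section Matchings.
Variable G : bicolored_graph.
Local Notation E := (edge G).
Local Notation sw := (rotw G).
Local Notation sb := (rotb G).
Local Notation fp := (face_perm G).
Implicit Types (e : E) (g : E -> int) (D : {set E}).

Definition chi D e : int := (e \in D)%:R.

Lemma chi_ge0 D e : 0 <= chi D e. Proof. by rewrite /chi; case: (_ \in _). Qed.

Lemma bsum_chi D b : bsum (chi D) b = #|[set e in D | bend e == b]|%:R.
Proof.
rewrite /bsum /chi -sum1_card natr_sum.
rewrite big_mkcond [RHS]big_mkcond; apply: eq_bigr => e _ /=.
by rewrite inE; case: (e \in D); case: (_ == _).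
Qed.

Lemma wsum_chi D w : wsum (chi D) w = #|[set e in D | wend e == w]|%:R.
Proof.
rewrite /wsum /chi -sum1_card natr_sum.
rewrite big_mkcond [RHS]big_mkcond; apply: eq_bigr => e _ /=.
by rewrite inE; case: (e \in D); case: (_ == _).
Qed.

Lemma matchingP D : reflect ((forall b, bsum (chi D) b = 1) /\ (forall w, wsum (chi D) w = 1))
  (perfect_matching D).
Proof.
have nat1 n : ((n%:R : int) = 1) <-> (n == 1)%N.
  by split=> [h|/eqP -> //]; apply/eqP; lia.
apply: (iffP andP) => -[hb hw]; split.
- by move=> b; rewrite bsum_chi nat1; exact: (forallP hb b).
- by move=> w; rewrite wsum_chi nat1; exact: (forallP hw w).
- by apply/forallP => b; rewrite -nat1 -bsum_chi.
- by apply/forallP => w; rewrite -nat1 -wsum_chi.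
Qed.

Lemma matching_black D : perfect_matching D ->
  exists m : black G -> E, [/\ forall b, bend (m b) = b, forall b, m b \in D
    & forall e, e \in D -> e = m (bend e)].
Proof.
case/andP => /forallP hb _.
have /fin_all_exists [m hm] : forall b, exists e, [set x in D | bend x == b] = [set e]%SET.
  by move=> b; apply/cards1P; exact: hb.
have mP b : (m b \in D) && (bend (m b) == b).
  by have /finset.setP /(_ (m b)) := hm b; rewrite !inE eqxx.
exists m; split=> [b|b|e eD].
- by have /andP [_ /eqP] := mP b.
- by have /andP [] := mP b.
- by have /finset.setP /(_ e) := hm (bend e); rewrite !inE eD eqxx => /esym/eqP.
Qed.

Lemma matching_white D : perfect_matching D ->
  exists m : white G -> E, [/\ forall w, wend (m w) = w, forall w, m w \in D
    & forall e, e \in D -> e = m (wend e)].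
Proof.
case/andP => _ /forallP hb.
have /fin_all_exists [m hm] : forall b, exists e, [set x in D | wend x == b] = [set e]%SET.
  by move=> b; apply/cards1P; exact: hb.
have mP b : (m b \in D) && (wend (m b) == b).
  by have /finset.setP /(_ (m b)) := hm b; rewrite !inE eqxx.
exists m; split=> [b|b|e eD].
- by have /andP [_ /eqP] := mP b.
- by have /andP [] := mP b.
- by have /finset.setP /(_ e) := hm (wend e); rewrite !inE eD eqxx => /esym/eqP.
Qed.

Lemma matching_diff D D' : perfect_matching D -> perfect_matching D' ->
  cycle_chain (fun e => chi D' e - chi D e).
Proof.
move=> /matchingP [hb hw] /matchingP [hb' hw']; split=> [b|w].
  by rewrite /bsum sumrB -!/(bsum _ _) hb hb' subrr.
by rewrite /wsum sumrB -!/(wsum _ _) hw hw' subrr.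
Qed.

(** Exchanging edges along one of the closed orbits of the flow gives another
    matching, which uses no new edge without flow. *)
Lemma circulation_step D g : perfect_matching D -> cycle_chain g ->
  (forall e, e \notin D -> 0 <= g e) -> (exists2 e, e \notin D & g e != 0) ->
  exists D', [/\ perfect_matching D', D' != D &
    forall e, e \notin D -> e \in D' -> 0 < g e].
Proof.
move=> pD [gb gw] g0 [e0 e0D ge0].
have [mb [mbE mbD mbU]] := matching_black pD.
have [mw [mwE mwD mwU]] := matching_white pD.
have outP d : d \in D -> g d < 0 -> exists e, [&& bend e == bend d, e \notin D & 0 < g e].
  move=> dD gd; apply/existsP; apply/contraT => /existsPn h.
  have := gb (bend d); rewrite /bsum (bigD1 d) //=.
  set S := (X in g d + X) => s0; have : S <= 0.
    apply: sumr_le0 => i /andP [/eqP bi id]; rewrite leNgt; apply/negP => gi.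
    have iD : i \notin D by apply: contra id => iD; rewrite (mbU i iD) (mbU d dD) bi.
    by have := h i; rewrite bi eqxx iD gi.
  by lia.
have inP e : e \notin D -> 0 < g e -> g (mw (wend e)) < 0.
  move=> eD ge; have := gw (wend e); rewrite /wsum (bigD1 (mw (wend e))) ?mwE //= => s0.
  rewrite (bigD1 e) ?eqxx /= in s0; last first.
    by apply: contra eD => /eqP ->; apply: mwD.
  move: s0; set S := (X in g e + X); have : 0 <= S.
    apply: sumr_ge0 => i /andP [/andP [/eqP wi im] _]; apply: g0.
    by apply: contra im => iD; rewrite (mwU i iD) wi.
  by lia.
pose o d := odflt d [pick e | [&& bend e == bend d, e \notin D & 0 < g e]].
have oP d : d \in D -> g d < 0 -> [&& bend (o d) == bend d, o d \notin D & 0 < g (o d)].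
  move=> dD gd; rewrite /o; case: pickP => [//|h] /=.
  by have [e he] := outP d dD gd; have := h e; rewrite he.
(* From an edge of [D] carrying negative flow, follow an edge [o d] carrying
   positive flow from its black end to the edge of [D] at its white end. *)
pose s d := mw (wend (o d)).
pose A := [set d in D | g d < 0].
have sA d : d \in A -> s d \in A.
  rewrite !inE => /andP [dD gd]; have /and3P [_ oD og] := oP d dD gd.
  by rewrite mwD inP.
have [|A' [A'A A'0 sE sI]] := @permuted_subset _ s A _ sA.
  apply/set0Pn; exists (mw (wend e0)); rewrite inE mwD inP //.
  by rewrite lt_neqAle eq_sym ge0 g0.
have {}oP d : d \in A' -> [/\ d \in D, bend (o d) = bend d, o d \notin D & 0 < g (o d)].
  move=> dA; have := fintype.subsetP A'A d dA; rewrite inE => /andP [dD gd].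
  by have /and3P [/eqP] := oP d dD gd.
have oI : {in A' &, injective o}.
  move=> d d' dA dA' oo; have [dD bd _ _] := oP d dA; have [dD' bd' _ _] := oP d' dA'.
  by rewrite (mbU d dD) (mbU d' dD') -bd -bd' oo.
(* On a set permuted by [s], exchange the edges [d] of [D] for the [o d]. *)
pose D' := (D :\: A') :|: o @: A'.
have chiD' e : chi D' e = chi D e - chi A' e + chi (o @: A') e.
  rewrite /chi !inE; case: (boolP (e \in A')) => eA'.
    have [eD _ _ _] := oP e eA'; rewrite eD.
    by case: (e \in o @: A').
  case: (boolP (e \in o @: A')) => [/imsetP [d dA ->]|]; last by case: (e \in D).
  by have [_ _ /negPf -> _] := oP d dA.
have sumA (P : pred E) (B : {set E}) : \sum_(e | P e) chi B e = \sum_(e in B) (P e)%:R.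
  rewrite /chi big_mkcond [RHS]big_mkcond; apply: eq_bigr => e _.
  by case: (P e); case: (e \in B).
exists D'; split.
- apply/matchingP; have [hb hw] := matchingP _ pD; split=> [b|w].
    rewrite /bsum; under eq_bigr do rewrite chiD'.
    rewrite big_split sumrB /= -/(bsum _ _) hb !sumA big_imset //=.
    rewrite [X in _ + X](eq_bigr (fun d => (bend d == b)%:R)) ?subrK // => d dA.
    by have [_ -> _ _] := oP d dA.
  rewrite /wsum; under eq_bigr do rewrite chiD'.
  rewrite big_split sumrB /= -/(wsum _ _) hw !sumA [X in _ + X]big_imset //=.
  rewrite -{1}sE big_imset //=.
  by rewrite (eq_bigr (fun d => (wend (o d) == w)%:R)) ?subrK // => d dA; rewrite mwE.
- have /set0Pn [d dA] := A'0; have [dD _ oD _] := oP d dA.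
  by apply: contra oD => /eqP <-; rewrite !inE imset_f ?orbT.
- move=> e eD; rewrite !inE (negPf eD) andbF /= => /imsetP [d dA ->].
  by have [] := oP d dA.
Qed.

(** On [D] the cycle is determined by the conservation law at the black
    nodes. *)
Lemma cycle_zero D g : perfect_matching D -> cycle_chain g ->
  (forall e, e \notin D -> g e = 0) -> forall e, g e = 0.
Proof.
move=> pD [gb gw] g0 e; have [mb [mbE mbD mbU]] := matching_black pD.
have [eD|] := boolP (e \in D); last exact: g0.
have := gb (bend e); rewrite /bsum (bigD1 e) //= big1 ?addr0 // => i /andP [/eqP bi ie].
by apply: g0; apply: contra ie => iD; rewrite (mbU i iD) (mbU e eD) bi.
Qed.

(** Subtract differences given by [circulation_step]; the total flow off [D]
    decreases. *)
Lemma circulation_decomposition D g : perfect_matching D -> cycle_chain g ->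
  (forall e, e \notin D -> 0 <= g e) ->
  exists s : seq {set E}, all (fun D' => perfect_matching D' && (D' != D)) s /\
    forall e, g e = \sum_(D' <- s) (chi D' e - chi D e).
Proof.
move=> pD; have [n] := ubnP (absz (\sum_(e | e \notin D) g e)); elim: n g => // n IH g ltn cg g0.
have [/existsP [e0 /andP [e0D ge0]]|/existsPn h] := boolP [exists e, (e \notin D) && (g e != 0)]; last first.
  exists [::]; split=> // e; rewrite big_nil; apply: (cycle_zero pD cg) => {}e eD.
  by have := h e; rewrite eD negbK => /eqP.
have [D' [pD' nD' posD']] := circulation_step pD cg g0 (ex_intro2 _ _ e0 e0D ge0).
pose g' e := g e - (chi D' e - chi D e).
have cg' : cycle_chain g'.
  have := cycle_lin 1 (-1) cg (matching_diff pD pD').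
  by case=> hb hw; split=> [b|w]; [rewrite -[RHS](hb b)|rewrite -[RHS](hw w)];
    apply: eq_bigr => e _; rewrite mul1r mulN1r.
have g'0 e : e \notin D -> 0 <= g' e.
  move=> eD; rewrite /g' /chi (negPf eD) subr0; case: (boolP (e \in D')) => eD'.
    by have := posD' e eD eD'; lia.
  by rewrite subr0 g0.
have [|s [sP sE]] := IH g' _ cg' g'0; last first.
- exists (D' :: s); rewrite /= pD' nD' sP; split=> // e.
  by rewrite big_cons -sE /g' addrC subrK.
suff : 0 <= \sum_(e | e \notin D) g' e < \sum_(e | e \notin D) g e by move: ltn; lia.
rewrite sumr_ge0 //=.
have [e eD' eD] : exists2 e, e \in D' & e \notin D.
  apply/exists_inP; apply: contraNT nD'; rewrite negb_exists_in => /forall_inP sub.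
  rewrite finset.eqEsubset; have sD : D' \subset D.
    by apply/fintype.subsetP => e eD'; have := sub e eD'; rewrite negbK.
  rewrite sD /=; apply/fintype.subsetP => e eD.
  have [mb [mbE mbD mbU]] := matching_black pD; have [mb' [mbE' mbD' mbU']] := matching_black pD'.
  have := mbU _ (fintype.subsetP sD _ (mbD' (bend e))).
  by rewrite mbE' -(mbU e eD) => <-.
rewrite [X in _ < X](bigD1 e) //= (bigD1 e) //= ltr_leD //.
  by rewrite /g' /chi eD' (negPf eD); lia.
apply: ler_sum => i /andP [iD _]; rewrite /g' {2}/chi (negPf iD) subr0.
by have := chi_ge0 D' i; lia.
Qed.

(** Combinatorial form of being a multiplicity-free corner. *)
Definition rigid D : Prop := perfect_matching D /\
  forall g, cycle_chain g -> (forall e, e \notin D -> 0 <= g e) -> cls g = 0 ->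
    forall e, g e = 0.

End Matchings.

(** * Faces along a rigid matching *)

Section RigidFaces.
Variable G : bicolored_graph.
Local Notation E := (edge G).
Local Notation sw := (rotw G).
Local Notation sb := (rotb G).
Local Notation fp := (face_perm G).
Implicit Types (e : E) (g : E -> int) (D : {set E}).

Hypothesis torus : torus_graph G.
Let closed := torus_closed torus.
Let euler := torus_euler torus.
Hypothesis nouni : no_univalent_node G.

Lemma rotw_neq e : sw e != e.
Proof.
apply/eqP => see; have := nouni.2 (wend e).
suff -> : [set x | wend x == wend e] = [set e]%SET by rewrite cards1.
apply/finset.setP => x; rewrite !inE -rotwP; apply/porbitP/eqP => [[i ->]|->].
  by rewrite permX; elim: i => //= i ->.
by exists 0%N; rewrite expg0 perm1.
Qed.

Lemma rotb_neq e : sb e != e.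
Proof.
apply/eqP => see; have := nouni.1 (bend e).
suff -> : [set x | bend x == bend e] = [set e]%SET by rewrite cards1.
apply/finset.setP => x; rewrite !inE -rotbP; apply/porbitP/eqP => [[i ->]|->].
  by rewrite permX; elim: i => //= i ->.
by exists 0%N; rewrite expg0 perm1.
Qed.

Lemma compat_face (t : E -> int) : (forall e, t (fp e) = t e) ->
  compat sw sb (fun e => t (sw e)) t.
Proof. by move=> ht e; rewrite permKV -(ht (sw e)) ribbon_face_sw. Qed.

Lemma matching_wend D e e' : perfect_matching D -> e != e' -> wend e = wend e' ->
  chi D e + chi D e' <= 1.
Proof.
move=> pD ne we; have [m [_ _ mU]] := matching_white pD; rewrite /chi.
case: (boolP (e \in D)) => // eD; case: (boolP (e' \in D)) => // eD'.
by case/eqP: ne; rewrite (mU e eD) (mU e' eD') we.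
Qed.

Lemma matching_bend D e e' : perfect_matching D -> e != e' -> bend e = bend e' ->
  chi D e + chi D e' <= 1.
Proof.
move=> pD ne we; have [m [_ _ mU]] := matching_black pD; rewrite /chi.
case: (boolP (e \in D)) => // eD; case: (boolP (e' \in D)) => // eD'.
by case/eqP: ne; rewrite (mU e eD) (mU e' eD') we.
Qed.

Let uncovered D x : int := 1 - chi D x - chi D ((sw^-1)%g x).

Lemma sum_eq0_ge0 (T : finType) (A : {set T}) (F : T -> int) :
  (forall x, x \in A -> 0 <= F x) -> \sum_(x in A) F x = 0 ->
  forall x, x \in A -> F x = 0.
Proof.
move=> F0 /eqP; rewrite psumr_eq0 // => /allP h x xA; apply/eqP.
by have := h x (mem_index_enum x); rewrite xA.
Qed.

(** If every white corner of the face were covered, the edges of its boundary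
    would be alternately in and off [D], and this boundary, which has class
    zero, would be up to sign nonnegative off [D]. *)
Lemma rigid_face_ge1 D e : rigid D -> 1 <= \sum_(x in porbit fp e) uncovered D x.
Proof.
case=> pD rD; set f := porbit fp e.
have d0 x : 0 <= uncovered D x.
  have : chi D x + chi D ((sw^-1)%g x) <= 1.
    apply: matching_wend => //; last by rewrite wend_rotwV.
    by apply/eqP => h; have := rotw_neq ((sw^-1)%g x); rewrite permKV {1}h eqxx.
  by rewrite /uncovered; lia.
have s0 : 0 <= \sum_(x in f) uncovered D x by apply: sumr_ge0.
have [h|] := eqVneq (\sum_(x in f) uncovered D x) 0; last by lia.
exfalso.
have dw := sum_eq0_ge0 (fun x _ => d0 x) h.
pose df x : int := 1 - chi D ((sw^-1)%g x) - chi D (fp x).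
have df0 x : 0 <= df x.
  have : chi D ((sw^-1)%g x) + chi D (fp x) <= 1.
    apply: matching_bend => //; last by rewrite permM bend_rotbV.
    apply/eqP; rewrite permM => h1.
    by have := rotb_neq (((sb^-1)%g ((sw^-1)%g x))); rewrite permKV {1}h1 eqxx.
  by rewrite /df; lia.
have hf : \sum_(x in f) df x = 0.
  transitivity (\sum_(x in f) uncovered D x - \sum_(x in f) (chi D (fp x) - chi D x)).
    rewrite -sumrB; apply: eq_bigr => x _; rewrite /df /uncovered; ring.
  by rewrite h sum_porbit_next subr0.
have db := sum_eq0_ge0 (fun x _ => df0 x) hf.
have cst x : x \in f -> chi D x = chi D e.
  rewrite /f => /porbitP [i ->]; rewrite permX; elim: i => //= i <-.
  have xf : iter i fp e \in f by rewrite -permX mem_porbit.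
  by have := dw _ xf; have := db _ xf; rewrite /dw /df /uncovered; lia.
(* The boundary [g] of the face: up to sign it is nonnegative off [D]. *)
pose t x : int := (x \in f)%:R.
have ht x : t (fp x) = t x by rewrite /t mem_porbitS.
have cg := cycle_jump (compat_face ht).
pose g x := t (sw x) - t x.
have clsg : cls g = 0.
  rewrite /cls; under eq_bigr do rewrite scalerBl.
  rewrite sumrB -(sum_permV sw (fun e => t (sw e) *: disp e)) -sumrB.
  transitivity (- \sum_(x in f) (disp x - disp ((sw^-1)%g x))); last first.
    by rewrite -sum_face_boundary closed oppr0.
  rewrite -sumrN [RHS]big_mkcond /=.
  apply: eq_bigr => x _; rewrite permKV -scalerBr /t -/f.
  by case: (x \in f); rewrite ?scale1r ?scale0r ?opprB.
have gE x : jump sw (fun e => t (sw e)) x = g x by rewrite /jump permKV.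
have {}cg : cycle_chain g.
  by case: cg => hb hw; split=> [b|w]; [rewrite -[RHS](hb b)|rewrite -[RHS](hw w)];
    apply: eq_bigr => x _; rewrite gE.
have ef : e \in f by exact: porbit_id.
have inD x : x \in f -> (x \in D) = (e \in D).
  by move=> /cst; rewrite /chi; case: (x \in D); case: (e \in D).
have inD' x : x \in f -> ((sw^-1)%g x \in D) = (e \notin D).
  move=> xf; have := dw x xf; rewrite /uncovered (cst x xf) /chi.
  by case: ((sw^-1)%g x \in D); case: (e \in D).
case: (boolP (e \in D)) => eD.
  have g0 x : x \notin D -> 0 <= g x.
    move=> xD; rewrite /g /t; have [xf|_] := boolP (x \in f); last by case: (_ \in _).
    by move: xD; rewrite inD // eD.
  have := rD g cg g0 clsg ((sw^-1)%g e); rewrite /g /t permKV ef.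
  have : (sw^-1)%g e \notin f.
    by apply/negP => /inD; rewrite inD' // eD.
  by move=> /negPf ->.
have g0 x : x \notin D -> 0 <= - g x.
  move=> xD; rewrite /g /t; have [xf|_] := boolP (sw x \in f); last by case: (_ \in _).
  by move: xD; rewrite -{1}(permK sw x) inD' // eD.
have cNg : cycle_chain (fun x => - g x).
  by case: cg => hb hw; split=> [b|w]; [rewrite -[RHS]oppr0 -(hb b)|rewrite -[RHS]oppr0 -(hw w)];
    rewrite -sumrN.
have clsN : cls (fun x => - g x) = 0.
  by rewrite -[RHS]oppr0 -clsg /cls -sumrN; apply: eq_bigr => x _; rewrite scaleNr.
have := rD _ cNg g0 clsN e; rewrite /g /t ef.
have -> : (sw e \in f) = false by apply: contraNF eD => /inD'; rewrite permK; case: (e \in D).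
by [].
Qed.

Lemma sum_porbits (T : finType) (s : {perm T}) (F : T -> int) :
  \sum_(f in porbits s) \sum_(x in f) F x = \sum_x F x.
Proof.
rewrite [RHS](partition_big (porbit s) (mem (porbits s))) /= => [|x _]; last exact: imset_f.
apply: eq_bigr => f /imsetP [y _ ->]; apply: eq_bigl => x.
by rewrite eq_porbit_mem porbit_sym.
Qed.

Lemma sum_chi_black D : perfect_matching D -> \sum_e chi D e = #|black G|%:R.
Proof.
move/matchingP => [hb _]; rewrite (partition_big (@bend G) predT) //=.
by under eq_bigr do rewrite -/(bsum _ _) hb; rewrite sumr_const.
Qed.

Lemma sum_chi_white D : perfect_matching D -> \sum_e chi D e = #|white G|%:R.
Proof.
move/matchingP => [_ hb]; rewrite (partition_big (@wend G) predT) //=.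
by under eq_bigr do rewrite -/(wsum _ _) hb; rewrite sumr_const.
Qed.

(** By Euler's formula the uncovered white corners are as many as the faces,
    and each face has one at least. *)
Lemma rigid_face D e : rigid D -> \sum_(x in porbit fp e) uncovered D x = 1.
Proof.
move=> rD; have pD := rD.1; apply/eqP; rewrite -subr_eq0; apply/eqP.
apply: (@sum_eq0_ge0 _ (porbits fp) (fun f => \sum_(x in f) uncovered D x - 1)).
- by move=> _ /imsetP [x _ ->]; rewrite subr_ge0 rigid_face_ge1.
- rewrite sumrB sum_porbits sumr_const /uncovered !sumrB (sum_permV sw (chi D)).
  rewrite {1}(sum_chi_black pD) (sum_chi_white pD) sumr_const.
  by rewrite -[#|xpredT|]/#|E| -euler; lia.
- exact: imset_f.
Qed.

Lemma rigid_face_diff D D' e : rigid D -> rigid D' ->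
  \sum_(x in porbit fp e) (chi D x - chi D' x
      + (chi D ((sw^-1)%g x) - chi D' ((sw^-1)%g x))) = 0.
Proof.
move=> rD rD'; rewrite -[RHS](subrr 1) -{1}(rigid_face e rD') -(rigid_face e rD) -sumrB.
by apply: eq_bigr => x _; rewrite /uncovered; ring.
Qed.

End RigidFaces.

(** * Homologous corner functions *)

Section ClassFunctions.
Variable G : bicolored_graph.
Local Notation E := (edge G).
Local Notation sw := (rotw G).
Local Notation sb := (rotb G).
Local Notation fp := (face_perm G).
Implicit Types (e : E) (g s : E -> int).

Lemma orbit_const (T : Type) (p : {perm E}) (f : E -> T) x y :
  (forall e, f (p e) = f e) -> y \in porbit p x -> f y = f x.
Proof. by move=> hf /porbitP [i ->]; rewrite permX; elim: i => //= i IH; rewrite hf. Qed.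

Lemma white_const (T : Type) (f : E -> T) e e' :
  (forall e, f (sw e) = f e) -> wend e = wend e' -> f e = f e'.
Proof. by move=> hf we; apply: (orbit_const hf); rewrite rotwP we. Qed.

Lemma black_const (T : Type) (f : E -> T) e e' :
  (forall e, f (sb e) = f e) -> bend e = bend e' -> f e = f e'.
Proof. by move=> hf we; apply: (orbit_const hf); rewrite rotbP we. Qed.

Lemma sum_white_const g (f : E -> int) : (forall e, f (sw e) = f e) ->
  \sum_e g e * f e = \sum_w wsum g w * (if [pick e | wend e == w] is Some e then f e else 0).
Proof.
move=> hf; rewrite (partition_big (@wend G) predT) //=; apply: eq_bigr => w _.
rewrite /wsum mulr_suml; apply: eq_bigr => e /eqP ew.
case: pickP => [e' /eqP ew'|/(_ e)]; last by rewrite ew eqxx.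
by rewrite (white_const hf (etrans ew (esym ew'))).
Qed.

Lemma sum_black_const g (f : E -> int) : (forall e, f (sb e) = f e) ->
  \sum_e g e * f e = \sum_b bsum g b * (if [pick e | bend e == b] is Some e then f e else 0).
Proof.
move=> hf; rewrite (partition_big (@bend G) predT) //=; apply: eq_bigr => w _.
rewrite /bsum mulr_suml; apply: eq_bigr => e /eqP ew.
case: pickP => [e' /eqP ew'|/(_ e)]; last by rewrite ew eqxx.
by rewrite (black_const hf (etrans ew (esym ew'))).
Qed.

Lemma cycle_white_const g (f : E -> int) : cycle_chain g -> (forall e, f (sw e) = f e) ->
  \sum_e g e * f e = 0.
Proof. by move=> [_ gw] hf; rewrite sum_white_const // big1 // => w _; rewrite gw mul0r. Qed.

Lemma cycle_black_const g (f : E -> int) : cycle_chain g -> (forall e, f (sb e) = f e) ->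
  \sum_e g e * f e = 0.
Proof. by move=> [gb _] hf; rewrite sum_black_const // big1 // => w _; rewrite gb mul0r. Qed.

Hypothesis torus : torus_graph G.

(** The difference of the cycles of jumps bounds a function [t] of the faces,
    up to a factor; what remains of the corner functions after subtracting [t]
    has no jump, so it is a function [u], [v] of the nodes. *)
Lemma homologous_corners rw rb qw qb : compat sw sb rw rb -> compat sw sb qw qb ->
  cls (jump sw rw) = cls (jump sw qw) ->
  exists (m : int) (t u v : E -> int), [/\ 0 < m, forall e, t (fp e) = t e,
    forall e, u (sw e) = u e, forall e, v (sb e) = v e &
    forall e, m * (rw e - qw e) = t (sw e) + u e /\ m * (rb e - qb e) = t e + v e].
Proof.
move=> cr cq hc.
have cg : cycle_chain (fun e => 1 * jump sw rw e + (-1) * jump sw qw e).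
  by apply: cycle_lin; apply: cycle_jump; eassumption.
have [|m [t [m0 ht mt]]] := boundary_of_cls0 torus cg.
  by rewrite cls_lin hc scale1r scaleN1r subrr.
wlog m_gt0 : m t m0 ht mt / 0 < m.
  move=> H; have [|mle] := ltP 0 m; first exact: H m0 ht mt.
  apply: (H (- m) (fun e => - t e)); rewrite ?oppr_eq0 //; last by lia.
    by move=> e; rewrite ht.
  by move=> e; have := mt e; lia.
exists m, t, (fun e => m * (rw e - qw e) - t (sw e)), (fun e => m * (rb e - qb e) - t e).
split=> // [e|e|e]; last by split; ring.
  have := mt (sw e); rewrite /jump permK => h.
  apply/eqP; rewrite -subr_eq0; apply/eqP; rewrite -[RHS](subrr (t (sw (sw e)) - t (sw e))) -{1}h; ring.
have := mt (sb e); have := cr (sb e); have := cq (sb e); rewrite /jump permK => h1 h2.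
rewrite mul1r mulN1r h1 h2 => h.
have ht1 : t (sw (sb e)) = t e by rewrite -{2}(permK sb e) -(ribbon_face_sw sw sb) ht.
move: h; rewrite ht1 => h.
by apply/eqP; rewrite -subr_eq0; apply/eqP; rewrite -[RHS](subrr (t e - t (sb e))) -{2}h; ring.
Qed.

(** The cochains differ, up to a factor, by a coboundary: the functions of the
    faces do not contribute. *)
Lemma homologous_coch rw rb qw qb : compat sw sb rw rb -> compat sw sb qw qb ->
  cls (jump sw rw) = cls (jump sw qw) ->
  exists (m : int) (u v : E -> int), [/\ 0 < m,
    forall e, u (sw e) = u e, forall e, v (sb e) = v e &
    forall e, m * (coch sb rw rb e - coch sb qw qb e) = u e - v e].
Proof.
move=> cr cq hc; have [m [t [u [v [m0 ht hu hv h]]]]] := homologous_corners cr cq hc.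
exists m, u, v; split=> // e; rewrite /coch.
have [h1 _] := h e; have [_ h2] := h ((sb^-1)%g e).
have hv' : v ((sb^-1)%g e) = v e by rewrite -[in RHS](permKV sb e) hv.
have ht' : t ((sb^-1)%g e) = t (sw e) by rewrite -(ribbon_face_sw sw) ht.
rewrite ht' hv' in h2.
by have -> : m * (rw e - rb ((sb^-1)%g e) - (qw e - qb ((sb^-1)%g e))) =
  m * (rw e - qw e) - m * (rb ((sb^-1)%g e) - qb ((sb^-1)%g e)) by [ring]; rewrite h1 h2; ring.
Qed.

(** Contrary to the intersection pairing, the values at the four corners of an
    edge are added without signs. *)
Definition corner_sum s rw rb : int :=
  \sum_e s e * (rw e + rw ((sw^-1)%g e) + rb e + rb ((sb^-1)%g e)).

(** By [homologous_corners] it is enough to see that functions of the nodes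
    and functions of the faces contribute nothing. The first holds as [s] is a
    cycle, the second by the condition on faces, which [rigid_face_diff] gives
    for the difference of two rigid matchings. *)
Lemma corner_sum_cls s rw rb qw qb : cycle_chain s ->
  (forall e, \sum_(x in porbit fp e) (s x + s ((sw^-1)%g x)) = 0) ->
  compat sw sb rw rb -> compat sw sb qw qb ->
  cls (jump sw rw) = cls (jump sw qw) -> corner_sum s rw rb = corner_sum s qw qb.
Proof.
move=> cs fs cr cq hc; have [m [t [u [v [m0 ht hu hv h]]]]] := homologous_corners cr cq hc.
have hu' e : u ((sw^-1)%g e) = u e by rewrite -[in RHS](permKV sw e) hu.
have hv' e : v ((sb^-1)%g e) = v e by rewrite -[in RHS](permKV sb e) hv.
have ht' e : t ((sb^-1)%g e) = t (sw e) by rewrite -(ribbon_face_sw sw) ht.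
apply/eqP; rewrite -subr_eq0; apply/eqP; apply: (mulfI (lt0r_neq0 m0)).
rewrite mulr0 /corner_sum -sumrB mulr_sumr.
under eq_bigr => e _.
  have -> : m * (s e * (rw e + rw ((sw^-1)%g e) + rb e + rb ((sb^-1)%g e)) -
       s e * (qw e + qw ((sw^-1)%g e) + qb e + qb ((sb^-1)%g e))) =
     s e * (m * (rw e - qw e) + m * (rw ((sw^-1)%g e) - qw ((sw^-1)%g e)) +
       m * (rb e - qb e) + m * (rb ((sb^-1)%g e) - qb ((sb^-1)%g e))) by ring.
  rewrite (h e).1 (h e).2 (h _).1 (h _).2 hu' hv' ht' permKV.
  have -> : s e * (t (sw e) + u e + (t e + u e) + (t e + v e) + (t (sw e) + v e)) =
     2 * (s e * u e) + 2 * (s e * v e) + 2 * (s e * t (sw e)) + 2 * (s e * t e) by ring.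
  over.
rewrite !big_split /= -!mulr_sumr cycle_white_const // cycle_black_const //.
rewrite !mulr0 !add0r -mulrDr -(sum_permV sw (fun e => s e * t (sw e))).
under eq_bigr do rewrite permKV.
rewrite -big_split /= -(sum_porbits fp) big1 ?mulr0 // => _ /imsetP [x _ ->].
rewrite (eq_bigr (fun y => (s y + s ((sw^-1)%g y)) * t x)) => [|y yx].
  by rewrite -mulr_suml fs mul0r.
by rewrite (orbit_const ht yx); ring.
Qed.

(** A coboundary pairs to zero with all cycles, and the pairing is
    nondegenerate. *)
Lemma exact_cls0 rw rb (u v : E -> int) : compat sw sb rw rb ->
  (forall e, u (sw e) = u e) -> (forall e, v (sb e) = v e) ->
  (forall e, coch sb rw rb e = u e - v e) -> cls (jump sw rw) = 0.
Proof.
move=> c hu hv h.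
have zero g : cycle_chain g -> pairing (cls (jump sw rw)) (cls g) = 0.
  move=> cg; rewrite -(intersection torus c cg).
  under eq_bigr do rewrite h mulrBl ![_ * g _]mulrC.
  by rewrite sumrB cycle_white_const // cycle_black_const // subrr.
have [g1 c1 e1] := cycle_of_cls torus (delta_mx 0 0).
have [g2 c2 e2] := cycle_of_cls torus (delta_mx 0 1).
have := zero g1 c1; have := zero g2 c2; rewrite e1 e2 /pairing !mxE /= => h1 h2.
by apply: Z2P; rewrite mxE; lia.
Qed.

End ClassFunctions.

(** * Chains carried by directed paths *)

Section PathChain.
Variable G : bicolored_graph.
Local Notation E := (edge G).
Implicit Types (e : E) (g : E -> int).
Variables (fw bw : pred E).
Local Notation N := (black G + white G)%type.

Definition step (n n' : N) : bool :=
  match n, n' with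
  | inl b, inr w => [exists e, [&& fw e, bend e == b & wend e == w]]
  | inr w, inl b => [exists e, [&& bw e, bend e == b & wend e == w]]
  | _, _ => false
  end.

Definition node_boundary g (n : N) : int :=
  match n with inl b => - bsum g b | inr w => wsum g w end.

Lemma bsum_delta e b : bsum (fun x => (x == e)%:R) b = (b == bend e)%:R.
Proof.
rewrite /bsum; have [->|nb] := eqVneq b (bend e).
  by rewrite (bigD1 e) //= eqxx big1 ?addr0 // => i /andP [_ /negPf ->].
by apply: big1 => i /eqP bi; case: eqVneq => // h; move: nb; rewrite -bi h eqxx.
Qed.

Lemma wsum_delta e w : wsum (fun x => (x == e)%:R) w = (w == wend e)%:R.
Proof.
rewrite /wsum; have [->|nb] := eqVneq w (wend e).
  by rewrite (bigD1 e) //= eqxx big1 ?addr0 // => i /andP [_ /negPf ->].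
by apply: big1 => i /eqP bi; case: eqVneq => // h; move: nb; rewrite -bi h eqxx.
Qed.

Lemma path_chain n n' : connect step n n' -> exists g : E -> int,
  [/\ forall k, node_boundary g k = (k == n')%:R - (k == n)%:R,
      forall e, 0 < g e -> fw e & forall e, g e < 0 -> bw e].
Proof.
move/connectP => [p + ->]; elim: p n => [|k p IH] n /=.
  move=> _; exists (fun=> 0); split=> // k; rewrite subrr.
  by case: k => x /=; rewrite /bsum /wsum big1 // oppr0.
move=> /andP [nk /IH [g [gN gf gb]]].
suff [g1 [g1N g1f g1b]] : exists g1 : E -> int,
    [/\ forall j, node_boundary g1 j = (j == k)%:R - (j == n)%:R,
      forall e, 0 < g1 e -> fw e & forall e, g1 e < 0 -> bw e].
  exists (fun e => g1 e + g e); split=> [j|e h|e h].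
  - have -> : node_boundary (fun e => g1 e + g e) j = node_boundary g1 j + node_boundary g j.
      by case: j => x /=; rewrite /bsum /wsum big_split ?opprD.
    by rewrite gN g1N; ring.
  - by have [/g1f //|h1] := ltP 0 (g1 e); apply: gf; lia.
  - by have [/g1b //|h1] := ltP (g1 e) 0; apply: gb; lia.
case: n k nk {g gN gf gb IH} => [b|w] [b'|w'] //= /existsP [e /and3P [fe /eqP be /eqP we]].
  exists (fun x => (x == e)%:R); split=> [[c|c]|x|x] /=.
  - by rewrite bsum_delta be sub0r; congr (- _%:R).
  - by rewrite wsum_delta we subr0.
  - by case: eqP => [->|_].
  - by case: eqP => [->|_].
exists (fun x => - (x == e)%:R); split=> [[c|c]|x|x] /=.
- by rewrite /bsum sumrN opprK -/(bsum _ _) bsum_delta be subr0.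
- by rewrite /wsum sumrN -/(wsum _ _) wsum_delta we sub0r.
- by case: eqP => [->|_].
- by case: eqP => [->|_].
Qed.

End PathChain.

(** * Sectors around a node *)

Section Sector.
Variables (T : finType) (s : {perm T}).
Implicit Types a x : T.

(** The elements met from [a] on, before [a'], when turning around a node. *)
Definition sector a a' x : bool := (findex s a x < findex s a a')%N.

Lemma findex_perm a x : s x != a -> x \in porbit s a ->
  findex s a (s x) = (findex s a x).+1.
Proof.
move=> sxa xa; have ax : fconnect s a x by rewrite -porbit_fconnect.
have lt := findex_max ax; have it := iter_findex ax.
have [h|h] := ltnP (findex s a x).+1 (fingraph.order s a).
  by rewrite -{1}it -iterS findex_iter.
have e : (findex s a x).+1 = fingraph.order s a by apply/eqP; rewrite eqn_leq lt h.
case/eqP: sxa; rewrite -{1}it -iterS e.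
by rewrite iter_order //; exact: perm_inj.
Qed.

Lemma findex_permV a : findex s a ((s^-1)%g a) = (fingraph.order s a).-1.
Proof.
have h : (s^-1)%g a = iter (fingraph.order s a).-1 s a.
  apply: (@perm_inj _ s); rewrite permKV -iterS prednK ?order_gt0 //.
  by rewrite iter_order //; exact: perm_inj.
by rewrite h findex_iter // prednK ?order_gt0.
Qed.

Lemma sector_jump a a' x : a' \in porbit s a ->
  (sector a a' x)%:R - (sector a a' ((s^-1)%g x))%:R = (x == a)%:R - (x == a')%:R :> int.
Proof.
move=> a'a; have lt' : (findex s a a' < fingraph.order s a)%N.
  by apply: findex_max; rewrite -porbit_fconnect.
have [->|xa] := eqVneq x a.
  rewrite /sector findex0 findex_permV.
  have -> : ((fingraph.order s a).-1 < findex s a a')%N = false.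
    by rewrite ltnNge -ltnS prednK ?order_gt0 // lt'.
  rewrite subr0; have [->|na] := eqVneq a a'; first by rewrite findex0.
  by rewrite lt0n findex_eq0 na.
have [xo|xo] := boolP (x \in porbit s a); last first.
  have nx y : y \notin porbit s a -> sector a a' y = false.
    move=> yo; apply/negbTE; rewrite /sector -leqNgt /findex [X in (_ <= X)%N](memNindex _) ?size_orbit.
      exact: ltnW.
    by rewrite -fconnect_orbit -porbit_fconnect.
  rewrite !nx //; last by rewrite -{1}(permKV s x) mem_porbitS in xo.
  by have [h|//] := eqVneq x a'; rewrite h a'a in xo.
have := @findex_perm a ((s^-1)%g x); rewrite permKV => /(_ xa).
have xo' : (s^-1)%g x \in porbit s a by rewrite -(mem_porbitS s) permKV.
move=> /(_ xo') ix; have -> : (x == a') = (findex s a x == findex s a a').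
  apply/eqP/eqP => [->//|h].
  rewrite porbit_fconnect in xo; rewrite porbit_fconnect in a'a.
  by rewrite -(iter_findex xo) h iter_findex.
rewrite /sector ix; set k := findex _ _ _; set K := findex _ _ _.
by case: (ltngtP k.+1 K).
Qed.

End Sector.

(** * Directions and extremal matchings *)

Lemma dot_gt0 (a : Z2) : a != 0 -> 0 < pairing a (rot90 a).
Proof.
move=> a0; rewrite /pairing !mxE /=.
have [h|h] : a 0 0 != 0 \/ a 0 1 != 0.
  apply/orP; apply: contraR a0; rewrite negb_or !negbK => /andP [/eqP h0 /eqP h1].
  by apply/eqP; apply: Z2P; rewrite mxE.
  have : 0 < a 0 0 * a 0 0 by rewrite -expr2 exprn_even_gt0.
  by nia.
have : 0 < a 0 1 * a 0 1 by rewrite -expr2 exprn_even_gt0.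
by nia.
Qed.

(** Decomposition of [x] on the orthogonal basis [a], [rot90 a]. *)
Lemma pairing_decomp (u x a : Z2) : pairing u x * pairing a (rot90 a) =
  pairing x (rot90 a) * pairing u a + pairing a x * pairing u (rot90 a).
Proof. by rewrite /pairing !mxE /=; ring. Qed.

(** A class whose pairing with some other one is 1 is primitive. *)
Lemma class_multiple (a b x : Z2) : pairing a b = 0 -> pairing a x = 1 ->
  b = pairing b x *: a.
Proof.
rewrite /pairing => h1 h2; apply: Z2P; rewrite !mxE.
  have -> : (b 0 0 * x 0 1 - b 0 1 * x 0 0) * a 0 0 = b 0 0 * (a 0 0 * x 0 1 - a 0 1 * x 0 0)
     - x 0 0 * (a 0 0 * b 0 1 - a 0 1 * b 0 0) by ring.
  by rewrite h1 h2 mulr0 subr0 mulr1.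
have -> : (b 0 0 * x 0 1 - b 0 1 * x 0 0) * a 0 1 = b 0 1 * (a 0 0 * x 0 1 - a 0 1 * x 0 0)
   - x 0 1 * (a 0 0 * b 0 1 - a 0 1 * b 0 0) by ring.
by rewrite h1 h2 mulr0 subr0 mulr1.
Qed.

Section Directions.
Variable G : bicolored_graph.
Local Notation E := (edge G).
Implicit Types (e : E) (g : E -> int) (D : {set E}).

Lemma cycleN g : cycle_chain g -> cycle_chain (fun e => - g e).
Proof.
case=> hb hw; split=> [b|w].
  by rewrite /bsum sumrN -/(bsum _ _) hb oppr0.
by rewrite /wsum sumrN -/(wsum _ _) hw oppr0.
Qed.

Lemma clsN g : cls (fun e => - g e) = - cls g.
Proof. by rewrite /cls -sumrN; apply: eq_bigr => e _; rewrite scaleNr. Qed.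

(** The class of [D], as a point of the plane of the polygon, evaluated on the
    linear form with outer normal [u]: no rotation is needed, as the pairing
    identifies [H_1] with [H^1]. *)
Definition height (u : Z2) D : int := pairing u (cls (chi D)).

Definition strict_top u D : Prop := perfect_matching D /\
  forall D', perfect_matching D' -> D' != D -> height u D' < height u D.

Definition weak_top v D : Prop := perfect_matching D /\
  forall D', perfect_matching D' -> height v D' <= height v D.

Definition circulation D g : Prop :=
  cycle_chain g /\ forall e, e \notin D -> 0 <= g e.

Lemma cls_sum (s : seq {set E}) D g :
  (forall e, g e = \sum_(D' <- s) (chi D' e - chi D e)) ->
  cls g = \sum_(D' <- s) (cls (chi D') - cls (chi D)).
Proof.
move=> h; rewrite /cls; under eq_bigr do rewrite h scaler_suml.
rewrite exchange_big /=; apply: eq_bigr => D' _.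
by rewrite -sumrB; apply: eq_bigr => e _; rewrite scalerBl.
Qed.

(** Such a cycle is a nonempty sum of differences [D' - D], all of negative
    height. *)
Lemma strict_circulation u D g : strict_top u D -> circulation D g ->
  (exists e, g e != 0) -> pairing u (cls g) < 0.
Proof.
move=> [pD sD] [cg g0] [e ge]; have [s [/allP sP sE]] := circulation_decomposition pD cg g0.
rewrite (cls_sum sE) pairing_sumr.
have lt D' : D' \in s -> pairing u (cls (chi D') - cls (chi D)) < 0.
  by move=> /sP /andP [pD' nD']; rewrite pairingDr pairingNr subr_lt0; apply: sD.
case: s sP sE lt => [|D' s] _ sE lt; first by rewrite sE big_nil eqxx in ge.
rewrite big_cons ltr_wnDr //; last by rewrite lt ?mem_head.
by rewrite big_seq sumr_le0 // => D'' D''s; rewrite ltW // lt // in_cons D''s orbT.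
Qed.

Lemma weak_circulation v D g : weak_top v D -> circulation D g -> pairing v (cls g) <= 0.
Proof.
move=> [pD sD] [cg g0]; have [s [/allP sP sE]] := circulation_decomposition pD cg g0.
rewrite (cls_sum sE) pairing_sumr big_seq sumr_le0 // => D' /sP /andP [pD' _].
by rewrite pairingDr pairingNr subr_le0; apply: sD.
Qed.

Lemma strict_rigid u D : strict_top u D -> rigid D.
Proof.
move=> sD; split=> [|g cg g0 cg0 e]; first by case: sD.
apply/eqP/negPn/negP => ge; have := strict_circulation sD (conj cg g0) (ex_intro _ e ge).
by rewrite cg0 pairing0r ltxx.
Qed.

(** The vector [a] is a positive rational multiple of [v]. *)
Definition same_dir (v a : Z2) : Prop := pairing v a = 0 /\ 0 < pairing a (rot90 v).

End Directions.

(** * The loops between the two ends of a supporting face *)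

(** For use in [no_same_side]: [x] and [y] are the values of a function at the
    ends of an edge, [a], [b], [a'], [b'] tell whether these ends touch a
    first or a second loop, of levels [k] and [k - 2 m]. An edge that does not
    touch the first loop varies by [m] at most, and by nothing unless it
    touches the second one, so it does not cross the level [k]. *)
Lemma threshold_cut (m k x y : int) (a b a' b' : bool) : 0 < m ->
  (a -> x = k) -> (b -> y = k) -> (a' -> x = k - 2 * m) -> (b' -> y = k - 2 * m) ->
  m * ((a%:R - b%:R) - (a'%:R - b'%:R)) = x - y ->
  a%:R - b%:R = (k <= x)%R%:R - (k <= y)%R%:R :> int.
Proof.
move=> m0; case: a; case: b; case: a'; case: b' => /= h1 h2 h3 h4 h5;
  by case: (leP k x) => ?; case: (leP k y) => ?; lia.
Qed.

Section Loops.
Variable G : bicolored_graph.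
Local Notation E := (edge G).
Local Notation sw := (rotw G).
Local Notation sb := (rotb G).
Local Notation fp := (face_perm G).
Implicit Types (e : E) (g : E -> int) (D : {set E}) (O : {set black G}).

Hypothesis torus : torus_graph G.

Variables (D1 D2 : {set E}) (v u1 u2 : Z2).
Hypotheses (v0 : v != 0) (top1 : strict_top u1 D1) (top2 : strict_top u2 D2).
Hypotheses (wtop1 : weak_top v D1) (wtop2 : weak_top v D2).
Hypothesis first12 : height (rot90 v) D1 <= height (rot90 v) D2.
Let pD1 := top1.1.
Let pD2 := top2.1.

Variables (b1 b2 : black G -> E) (w1 w2 : white G -> E).
Hypothesis b1P : [/\ forall b, bend (b1 b) = b, forall b, b1 b \in D1
    & forall e, e \in D1 -> e = b1 (bend e)].
Hypothesis b2P : [/\ forall b, bend (b2 b) = b, forall b, b2 b \in D2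
    & forall e, e \in D2 -> e = b2 (bend e)].
Hypothesis w1P : [/\ forall w, wend (w1 w) = w, forall w, w1 w \in D1
    & forall e, e \in D1 -> e = w1 (wend e)].
Hypothesis w2P : [/\ forall w, wend (w2 w) = w, forall w, w2 w \in D2
    & forall e, e \in D2 -> e = w2 (wend e)].

Let bb1 b : bend (b1 b) = b. Proof. by case: b1P. Qed.
Let bb2 b : bend (b2 b) = b. Proof. by case: b2P. Qed.
Let ww1 w : wend (w1 w) = w. Proof. by case: w1P. Qed.
Let ww2 w : wend (w2 w) = w. Proof. by case: w2P. Qed.
Let b1D b : b1 b \in D1. Proof. by case: b1P. Qed.
Let b2D b : b2 b \in D2. Proof. by case: b2P. Qed.
Let w1D w : w1 w \in D1. Proof. by case: w1P. Qed.
Let w2D w : w2 w \in D2. Proof. by case: w2P. Qed.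
Let D1b e : (e \in D1) = (e == b1 (bend e)).
Proof. by apply/idP/eqP => [|->]; [case: b1P => _ _; apply|exact: b1D]. Qed.
Let D2b e : (e \in D2) = (e == b2 (bend e)).
Proof. by apply/idP/eqP => [|->]; [case: b2P => _ _; apply|exact: b2D]. Qed.
Let D1w e : (e \in D1) = (e == w1 (wend e)).
Proof. by apply/idP/eqP => [|->]; [case: w1P => _ _; apply|exact: w1D]. Qed.
Let D2w e : (e \in D2) = (e == w2 (wend e)).
Proof. by apply/idP/eqP => [|->]; [case: w2P => _ _; apply|exact: w2D]. Qed.

(** From [b] along [D1] to a white node, then back along [D2]: the orbits are
    the loops of [D1 - D2] and the isolated nodes where [D1] and [D2]
    agree. *)
Definition next_black b := bend (w2 (wend (b1 b))).

Lemma next_black_inj : injective next_black.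
Proof.
move=> b b'; rewrite /next_black => h.
have h2 : w2 (wend (b1 b)) = w2 (wend (b1 b')).
  have := w2D (wend (b1 b)); have := w2D (wend (b1 b')).
  by rewrite !D2b h => /eqP e1 /eqP e2; exact: etrans e2 (esym e1).
have h3 : wend (b1 b) = wend (b1 b') by rewrite -(ww2 (wend (b1 b))) h2 ww2.
have := b1D b; have := b1D b'; rewrite !D1w h3 => /eqP h4 /eqP h5.
by rewrite -(bb1 b) h5 -h4 bb1.
Qed.

Definition tau : {perm black G} := perm next_black_inj.

(** Nodes where the two matchings agree, hence not on a loop. *)
Definition free_b b := b1 b == b2 b.
Definition free_w w := w1 w == w2 w.

Definition loop O : Prop := exists2 b, ~~ free_b b & O = porbit tau b.
(** The white nodes of the loop with black nodes [O]. *)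
Definition wO O w : bool := bend (w1 w) \in O.

Lemma tauE b : tau b = bend (w2 (wend (b1 b))). Proof. by rewrite permE. Qed.

Lemma loop_tau O b : loop O -> (tau b \in O) = (b \in O).
Proof. by case=> b' _ ->; rewrite mem_porbitS. Qed.

Lemma tau_w w : tau (bend (w1 w)) = bend (w2 w).
Proof.
rewrite tauE; congr (bend (w2 _)).
by have := w1D w; rewrite D1b => /eqP <-; rewrite ww1.
Qed.

Lemma free_w_b w : free_w w -> free_b (bend (w1 w)) /\ tau (bend (w1 w)) = bend (w1 w).
Proof.
move/eqP => h; split; last by rewrite tau_w h.
have := w1D w; have := w2D w; rewrite D1b D2b -h => /eqP h1 /eqP h2.
by rewrite /free_b -h1 -h2.
Qed.

Lemma free_b_w b : free_b b -> free_w (wend (b1 b)) /\ tau b = b.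
Proof.
move/eqP => h; have h1 : w1 (wend (b1 b)) = b1 b.
  by have := b1D b; rewrite D1w => /eqP <-.
have h2 : w2 (wend (b1 b)) = b1 b.
  by have := b2D b; rewrite D2w -h => /eqP <-.
by split; [rewrite /free_w h1 h2|rewrite tauE h2 bb1].
Qed.

Lemma loop_nonfree O b : loop O -> b \in O -> ~~ free_b b.
Proof.
case=> b' nb ->; rewrite porbit_sym => bo; apply: contra nb => fb.
suff -> : b' = b by [].
have [_ tb] := free_b_w fb; move/porbitP: bo => [i ->]; rewrite permX.
by elim: i => //= i ->.
Qed.

Lemma wO2 O w : loop O -> wO O w = (bend (w2 w) \in O).
Proof. by move=> lO; rewrite /wO -tau_w loop_tau. Qed.

Lemma wO_D e O : loop O -> (e \in D1) || (e \in D2) -> wO O (wend e) = (bend e \in O).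
Proof.
move=> lO /orP [].
  by rewrite D1w /wO => /eqP <-.
by rewrite D2w wO2 // => /eqP <-.
Qed.

Lemma wO_nonfree O w : loop O -> wO O w -> ~~ free_w w.
Proof.
move=> lO; apply: contraL => fw; apply: contraL (free_w_b fw).1.
exact: loop_nonfree.
Qed.

(** Corners on the right of the loops, which run along the edges of [D1] from
    black to white and along those of [D2] from white to black. *)
Definition rw e := sector sw (w1 (wend e)) (w2 (wend e)) e.
Definition rb e := sector sb (b2 (bend e)) (b1 (bend e)) e.

Lemma rw_jump e : (rw e)%:R - (rw ((sw^-1)%g e))%:R = chi D1 e - chi D2 e.
Proof.
rewrite /rw wend_rotwV sector_jump ?rotwP ?ww1 ?ww2 //.
by rewrite /chi D1w D2w.
Qed.

Lemma rb_jump e : (rb ((sb^-1)%g e))%:R - (rb e)%:R = chi D1 e - chi D2 e.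
Proof.
apply: oppr_inj; rewrite opprB /rb bend_rotbV sector_jump ?rotbP ?bb1 ?bb2 //.
by rewrite /chi D1b D2b opprB.
Qed.

(** The corner function of a loop: the indicator of its right side for [s =
    true], minus that of its left side for [s = false]. The two differ by a
    function of the nodes; each makes visible the crossings on one side
    only. *)
Definition cw (s : bool) O e : int := ((rw e)%:R - (~~ s)%:R) * (wO O (wend e))%:R.
Definition cb (s : bool) O e : int := ((rb e)%:R - (~~ s)%:R) * (bend e \in O)%:R.
Definition loop_chain O e : int := (chi D1 e - chi D2 e) * (bend e \in O)%:R.
Definition sg (s : bool) : int := if s then 1 else -1.
Definition side_b s O e : bool := (rb e == s) && (bend e \in O).
Definition side_w s O e : bool := (rw e == s) && wO O (wend e).
(** Counts 1 when the edge, followed from black to white, enters the loop on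
    the side [s], and -1 when it leaves it on that side. *)
Definition crossing s O e : int :=
  if (e \in D1) || (e \in D2) then 0 else (side_w s O e)%:R - (side_b s O e)%:R.

Lemma loop_chainE O e : loop O -> (chi D1 e - chi D2 e) * (wO O (wend e))%:R = loop_chain O e.
Proof.
move=> lO; rewrite /loop_chain; have [h|] := boolP ((e \in D1) || (e \in D2)).
  by rewrite wO_D.
by rewrite negb_or /chi => /andP [/negPf -> /negPf ->]; rewrite !mul0r.
Qed.

Lemma cw_jump s O e : loop O -> jump sw (cw s O) e = loop_chain O e.
Proof.
move=> lO; rewrite /jump /cw wend_rotwV -loop_chainE // -rw_jump; ring.
Qed.

Lemma side_compat s O : loop O -> compat sw sb (cw s O) (cb s O).
Proof.
move=> lO e; rewrite -/(jump sw (cw s O) e) cw_jump // /cb bend_rotbV /loop_chain -rb_jump.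
ring.
Qed.

(** So the dual cocycle of a loop counts crossings on either side. *)
Lemma side_coch s O e : loop O -> coch sb (cw s O) (cb s O) e = sg s * crossing s O e.
Proof.
move=> lO; rewrite /coch /cw /cb bend_rotbV /crossing.
have := rw_jump e; have := rb_jump e; rewrite /chi.
have [eD|] := boolP ((e \in D1) || (e \in D2)).
  rewrite wO_D // mulr0; have [eO|_] := boolP (bend e \in O); last by rewrite !mulr0.
  have nf := loop_nonfree lO eO.
  have : ~~ ((e \in D1) && (e \in D2)).
    apply: contra nf => /andP []; rewrite D1b D2b => /eqP h1 /eqP h2.
    by rewrite /free_b -h1 -h2.
  move: eD; case: (e \in D1); case: (e \in D2) => //= _ _;
  by case: (rw e); case: (rw _); case: (rb e); case: (rb _) => //; case: s.
rewrite negb_or => /andP [/negPf -> /negPf ->]; rewrite subrr => /eqP; rewrite subr_eq0 => /eqP -> _.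
rewrite /side_b /side_w; case: (rw e); case: (rb e); case: s;
  by case: (wO O (wend e)); case: (bend e \in O).
Qed.

Lemma loop_cycle O : loop O -> cycle_chain (loop_chain O).
Proof.
move=> lO; case: (cycle_jump (side_compat true lO)) => hb hw.
by split=> x; [rewrite -[RHS](hb x)|rewrite -[RHS](hw x)]; apply: eq_bigr => e _; rewrite cw_jump.
Qed.

Lemma cls_cw s O : loop O -> cls (jump sw (cw s O)) = cls (loop_chain O).
Proof. by move=> lO; apply: eq_bigr => e _; rewrite cw_jump. Qed.

Lemma loop_intersection s O g : loop O -> cycle_chain g ->
  sg s * \sum_e crossing s O e * g e = pairing (cls (loop_chain O)) (cls g).
Proof.
move=> lO cg; rewrite -(cls_cw s lO) -(intersection torus (side_compat s lO) cg) mulr_sumr.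
by apply: eq_bigr => e _; rewrite side_coch // mulrA.
Qed.

(** Such a cycle can be followed along [D2] forward and along [D1] backward.
    As both matchings are on the supporting face of normal [v], its class is
    along [v]; strictness gives the signs, compared with those of [D1 - D2]
    itself. *)
Lemma two_sided_class g : circulation D2 g -> circulation D1 (fun e => - g e) ->
  (exists e, g e != 0) ->
  [/\ same_dir v (cls g), pairing u2 (cls g) < 0 & 0 < pairing u1 (cls g)].
Proof.
move=> c2 c1 ge.
have ge' : exists e, - g e != 0 by case: ge => e ge; exists e; rewrite oppr_eq0.
have h2 := strict_circulation top2 c2 ge; have := strict_circulation top1 c1 ge'.
rewrite clsN pairingNr oppr_lt0 => h1.
have hv : pairing v (cls g) = 0.
  have := weak_circulation wtop2 c2; have := weak_circulation wtop1 c1.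
  by rewrite clsN pairingNr; lia.
split=> //; split=> //.
pose d e := chi D1 e - chi D2 e.
have cd : circulation D2 d.
  split; first exact: matching_diff.
  by move=> e eD; rewrite /d {2}/chi (negPf eD) subr0 chi_ge0.
have clsd : cls d = cls (chi D1) - cls (chi D2).
  by rewrite /cls -sumrB; apply: eq_bigr => e _; rewrite scalerBl.
have de : exists e, d e != 0.
  apply/existsP; apply: contraT => /existsPn hd; case: ge => e /negP []; apply/eqP.
  apply: (cycle_zero pD2 c2.1) => {}e eD.
  have := c2.2 e eD; have := hd e; rewrite negbK /d {2}/chi (negPf eD) subr0 /chi.
  have := c1.2 e; case: (e \in D1) => //= + _ gle => /(_ isT); lia.
have hd2 := strict_circulation top2 cd de.
have hdv : pairing v (cls d) = 0.
  have := wtop1.2 D2 pD2; have := wtop2.2 D1 pD1; rewrite /height clsd pairingDr pairingNr; lia.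
have hdr : 0 <= pairing (cls d) (rot90 v).
  by rewrite clsd pairingC pairingDr pairingNr opprB subr_ge0.
have vv := dot_gt0 v0.
have := pairing_decomp u2 (cls g) v; have := pairing_decomp u2 (cls d) v.
rewrite hv hdv !mul0r !addr0; move: h2 hd2 hdr vv.
set A := pairing u2 (cls g); set B := pairing u2 (cls d); set V := pairing v (rot90 v).
set C := pairing (cls d) (rot90 v); set a := pairing (cls g) (rot90 v); set x := pairing u2 v.
move=> h2 hd2 hdr vv e1 e2.
have x0 : x < 0 by rewrite ltNge; apply/negP => x0; have : 0 <= C * x by [exact: mulr_ge0]; nia.
by rewrite ltNge; apply/negP => a0; have : 0 <= a * x by [rewrite -mulrNN mulr_ge0 // oppr_ge0 // ltW]; nia.
Qed.

Lemma loop_circulation2 O : loop O -> circulation D2 (loop_chain O).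
Proof.
move=> lO; split; first exact: loop_cycle.
move=> e eD; rewrite /loop_chain {2}/chi (negPf eD) subr0.
by rewrite mulr_ge0 ?chi_ge0.
Qed.

Lemma loop_circulation1 O : loop O -> circulation D1 (fun e => - loop_chain O e).
Proof.
move=> lO; split; first exact/cycleN/loop_cycle.
move=> e eD; rewrite /loop_chain {1}/chi (negPf eD) sub0r mulNr opprK.
by rewrite mulr_ge0 ?chi_ge0.
Qed.

Lemma loop_chain_neq0 O : loop O -> exists e, loop_chain O e != 0.
Proof.
case=> b nf ->; exists (b1 b); rewrite /loop_chain bb1 porbit_id mulr1 /chi b1D D2b bb1.
by rewrite -[b1 b == _]/(free_b b) (negPf nf).
Qed.

Lemma loop_class O : loop O -> [/\ same_dir v (cls (loop_chain O)),
  pairing u2 (cls (loop_chain O)) < 0 & 0 < pairing u1 (cls (loop_chain O))].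
Proof.
move=> lO; apply: two_sided_class; [exact: loop_circulation2|exact: loop_circulation1|].
exact: loop_chain_neq0.
Qed.

Lemma sg2 s : sg s * sg s = 1. Proof. by case: s. Qed.

(** A cocycle that is a coboundary has class zero, but the class of a loop is
    not zero. *)
Lemma loop_not_exact s O (f h : E -> int) : loop O ->
  (forall e, f (sw e) = f e) -> (forall e, h (sb e) = h e) ->
  ~ (forall e, crossing s O e = f e - h e).
Proof.
move=> lO hf hh ex; have [_ + _] := loop_class lO; rewrite -(cls_cw s lO).
rewrite (exact_cls0 torus (side_compat s lO) (u := fun e => sg s * f e) (v := fun e => sg s * h e)).
- by rewrite pairing0r ltxx.
- by move=> e; rewrite hf.
- by move=> e; rewrite hh.
- by move=> e; rewrite side_coch // ex mulrBr.
Qed.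

Lemma crossing_D s O e : (e \in D1) || (e \in D2) -> crossing s O e = 0.
Proof. by rewrite /crossing => ->. Qed.

(** A curve that crosses the loop exactly once is found by leaving it on the
    right and returning without crossing. If there were none, the indicator of
    the nodes joined to the loop without crossing would make the crossing
    cocycle a coboundary. *)
Lemma loop_primitive O : loop O -> exists2 g : E -> int, cycle_chain g &
  pairing (cls (loop_chain O)) (cls g) = 1.
Proof.
move=> lO; have [b0 nf OE] := lO; pose c := crossing true O.
pose P : pred E := fun e => c e == 0; pose R := step P P.
have symR : connect_sym R.
  by apply: sym_connect_sym => -[b|w] [b'|w'] //=.
pose S n := connect R (inl b0) n.
have stepE e : P e -> S (inl (bend e)) = S (inr (wend e)).
  move=> Pe; apply: same_connect_r => //; apply: connect1.
  by apply/existsP; exists e; rewrite Pe !eqxx.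
have PD e : (e \in D1) || (e \in D2) -> P e by move=> eD; rewrite /P /c crossing_D.
have SO b : b \in O -> S (inl b).
  rewrite OE => /porbitP [i ->]; rewrite permX.
  elim: i => /= [|i IH]; first exact: connect0.
  set c0 := iter i tau b0 in IH *.
  have h1 := stepE (b1 c0); rewrite bb1 in h1.
  have h2 := stepE (w2 (wend (b1 c0))); rewrite ww2 in h2.
  by rewrite tauE h2 ?PD ?w2D ?orbT // -h1 ?PD ?b1D.
have SwO w : wO O w -> S (inr w).
  move=> wO1; have := stepE (w1 w); rewrite ww1 => <-; first exact: SO.
  by rewrite PD ?w1D.
have [/existsP [e /and3P [ce Sb Sw]]|/existsPn no] := boolP [exists e, [&& c e != 0,
    S (inl (bend e)) & S (inr (wend e))]].
  have [|g [gN gf gb]] := @path_chain G P P (inr (wend e)) (inl (bend e)).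
    rewrite -/R; apply: connect_trans Sb.
    by rewrite symR.
  pose h x := (x == e)%:R + g x : int.
  have hN n : node_boundary h n = 0.
    have -> : node_boundary h n = node_boundary (fun x => (x == e)%:R) n + node_boundary g n.
      by case: n => x /=; rewrite /h /bsum /wsum big_split ?opprD.
    rewrite gN; case: n => x /=.
      by rewrite bsum_delta; case: eqVneq => [->|ne]; case: eqP => // [[/eqP]];
        rewrite ?eqxx ?(negPf ne).
    by rewrite wsum_delta; case: eqVneq => [->|ne]; case: eqP => // [[/eqP]];
        rewrite ?eqxx ?(negPf ne).
  have ch : cycle_chain h.
    split=> x; last exact: (hN (inr x)).
    by have /eqP := hN (inl x); rewrite /= oppr_eq0 => /eqP.
  have := loop_intersection true lO ch; rewrite mul1r.
  have -> : \sum_e0 crossing true O e0 * h e0 = c e.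
    rewrite (bigD1 e) //= big1 => [|x xe].
      rewrite /h eqxx addr0 mulrDr mulr1.
      have [->|ge] := eqVneq (g e) 0; first by rewrite mulr0 addr0.
      have : P e by case: (ltgtP (g e) 0) ge => // [/gb|/gf].
      by move: ce; rewrite /P => /negPf ->.
    rewrite /h (negPf xe) add0r; have [->|gx] := eqVneq (g x) 0; first by rewrite mulr0.
    have : P x by case: (ltgtP (g x) 0) gx => // [/gb|/gf].
    by rewrite /P /c => /eqP ->; rewrite mul0r.
  have : c e = 1 \/ c e = -1.
    move: ce; rewrite /c /crossing; case: ifP => // _.
    by case: (side_w _ _ _); case: (side_b _ _ _); [|left|right|].
  case=> -> h1; first by exists h.
  exists (fun e => - h e); first exact: cycleN.
  by rewrite clsN pairingNr -h1.
exfalso; apply: (@loop_not_exact true O (fun e => (S (inr (wend e)))%:R)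
   (fun e => (S (inl (bend e)))%:R) lO).
- by move=> e; rewrite wend_rotw.
- by move=> e; rewrite bend_rotb.
move=> e; have [ce|ce] := eqVneq (c e) 0.
  by rewrite -/(c e) ce stepE ?subrr // /P ce eqxx.
have := no e; rewrite ce /=.
move: ce; rewrite -/(c e) /c /crossing; case: ifP => // _.
case hw: (side_w _ _ _); case hb: (side_b _ _ _) => // _.
  have /andP [_ /SwO ->] := hw; rewrite andbT => /negPf ->; by rewrite subr0.
by have /andP [_ /SO ->] := hb => /= /negPf ->.
Qed.

Lemma same_dir_parallel (a b : Z2) : same_dir v a -> same_dir v b -> pairing a b = 0.
Proof.
move=> [ha _] [hb _]; have vv := dot_gt0 v0.
have := pairing_decomp a b v; rewrite hb mul0r addr0 [pairing a v]pairingC ha oppr0 mulr0.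
by nia.
Qed.

(** Parallel primitive classes with the same orientation. *)
Lemma loop_same_class O O' : loop O -> loop O' -> cls (loop_chain O) = cls (loop_chain O').
Proof.
move=> lO lO'; have [d _ p] := loop_class lO; have [d' _ p'] := loop_class lO'.
have [g _ gO] := loop_primitive lO; have [g' _ gO'] := loop_primitive lO'.
have e1 := class_multiple (same_dir_parallel d d') gO.
have e2 := class_multiple (same_dir_parallel d' d) gO'.
move: e1 e2; set k := pairing _ _; set k' := pairing _ _ => e1 e2.
move: p p'; rewrite e2 pairingZr; set q := pairing _ _ => p p'.
have : q = k * k' * q by rewrite {1}/q e1 e2 !pairingZr -/q mulrA.
have k'0 : 0 < k' by nia.
have [k2 _|k2] := eqVneq k' 1; first by rewrite k2 scale1r.
have k1 : 1 < k' by lia.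
have [k0|k0] := leP k 0; first by nia.
have : 1 < k * k' by nia.
nia.
Qed.

(** A directed path of the flow of [D2] between two loops, meeting no loop in
    between: it leaves the black node [x] on the side [sx] and enters the
    white node [y] on the side [sy]. Along it [D1] and [D2] agree, so it is
    directed for [D1] as well. *)
Definition excursion x sx y sy g : Prop :=
  [/\ ~~ free_b x /\ ~~ free_w y,
      (forall b, bsum g b = (b == x)%:R) /\ (forall w, wsum g w = (w == y)%:R),
      forall e, ~~ ((e \in D1) && (e \in D2)) -> 0 <= g e,
      forall e, (e \in D1) != (e \in D2) -> g e = 0 &
      forall s O, loop O -> \sum_e crossing s O e * g e =
        ((sy == s) && wO O y)%:R - ((sx == s) && (x \in O))%:R].

Lemma bsumD g g' b : bsum (fun e => g e + g' e) b = bsum g b + bsum g' b.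
Proof. exact: big_split. Qed.
Lemma wsumD g g' w : wsum (fun e => g e + g' e) w = wsum g w + wsum g' w.
Proof. exact: big_split. Qed.

Lemma loop_disjoint O O' b : loop O -> loop O' -> b \in O -> b \in O' -> O = O'.
Proof.
by case=> c _ -> [c' _ ->]; rewrite -!eq_porbit_mem => /eqP <- /eqP.
Qed.

(** The part of a loop from [y] forward to [x] is directed for [D2]; the
    opposite of what remains of the loop is directed for [D1]. *)
Lemma loop_segment O x y : loop O -> x \in O -> wO O y -> exists a : E -> int,
  [/\ (forall b, bsum a b = - (b == x)%:R) /\ (forall w, wsum a w = - (w == y)%:R),
     forall e, ((e \in D1) != (e \in D2)) && (bend e \in O) = false -> a e = 0,
     forall e, e \notin D2 -> 0 <= a e &
     forall e, e \notin D1 -> 0 <= a e - loop_chain O e].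
Proof.
move=> lO xO yO; pose y1 := bend (w2 y).
have y1O : y1 \in O by rewrite -wO2.
have inO b : (b \in O) = (b \in porbit tau y1).
  by case: lO y1O => c _ -> y1O; rewrite -!eq_porbit_mem in y1O *; rewrite (eqP y1O).
pose idx b := findex tau y1 b; pose K := idx x.
pose a e : int := ((e \in D1) && (idx (bend e) < K)%N && (bend e \in O))%:R
   - ((e \in D2) && (idx (bend e) <= K)%N && (bend e \in O))%:R.
have nD12 e : bend e \in O -> ~~ ((e \in D1) && (e \in D2)).
  move=> /(loop_nonfree lO); apply: contra => /andP []; rewrite D1b D2b => /eqP h1 /eqP h2.
  by rewrite /free_b -h1 -h2.
exists a; split.
- split=> [b|w].
    rewrite /bsum /a sumrB (bigD1 (b1 b)) ?bb1 //= big1 ?addr0; last first.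
      by move=> i /andP [/eqP bi]; rewrite D1b bi => /negPf ->.
    rewrite (bigD1 (b2 b)) ?bb2 //= big1 ?addr0; last first.
      by move=> i /andP [/eqP bi]; rewrite D2b bi => /negPf ->.
    rewrite b1D b2D /= ?bb1 ?bb2; case: (boolP (b \in O)) => bO; last first.
      by rewrite !andbF; case: eqVneq bO => // ->; rewrite xO.
    rewrite !andbT; have -> : (b == x) = (idx b == K).
      apply/eqP/eqP => [->//|h]; rewrite !inO !porbit_fconnect in bO xO.
      by rewrite -(iter_findex bO) -/(idx b) h iter_findex.
    by case: ltngtP.
  rewrite /wsum /a sumrB (bigD1 (w1 w)) ?ww1 //= big1 ?addr0; last first.
    by move=> i /andP [/eqP bi]; rewrite D1w bi => /negPf ->.
  rewrite (bigD1 (w2 w)) ?ww2 //= big1 ?addr0; last first.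
    by move=> i /andP [/eqP bi]; rewrite D2w bi => /negPf ->.
  rewrite w1D w2D /= -/(wO O w) -wO2 //; case: (boolP (wO O w)) => wOw; last first.
    by rewrite !andbF; have -> : (w == y) = false by [apply: contraNF wOw => /eqP ->].
  rewrite !andbT -tau_w; set b := bend (w1 w).
  have bO : b \in porbit tau y1 by rewrite -inO.
  have xo : fconnect tau y1 x by rewrite -porbit_fconnect -inO.
  have -> : (w == y) = (tau b == y1).
    apply/eqP/eqP => [wy|h]; first by rewrite /b wy tau_w.
    rewrite /b tau_w /y1 in h; rewrite -(ww2 w) -(ww2 y); congr (wend _).
    have := w2D w; have := w2D y; rewrite !D2b h => /eqP e1 /eqP e2; exact: etrans e2 (esym e1).
  have [h|h] := eqVneq (tau b) y1.
    have -> : b = (tau^-1)%g y1 by rewrite -h permK.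
    rewrite /idx findex_permV permKV findex0 /=.
    have -> : ((fingraph.order tau y1).-1 < K)%N = false.
      by rewrite ltnNge -ltnS prednK ?order_gt0 // findex_max.
    by [].
  by rewrite /idx (findex_perm h bO) subrr oppr0.
- by move=> e; rewrite /a; case: (boolP (bend e \in O)) => [/nD12|_];
    [case: (e \in D1); case: (e \in D2) => //=; rewrite ?subrr|rewrite !andbF].
- by move=> e eD; rewrite /a (negPf eD) subr0.
- move=> e eD; rewrite /a /loop_chain /chi (negPf eD) /= !sub0r mulNr opprK.
  by case: (e \in D2); case: (idx _ <= K)%N; case: (bend e \in O).
Qed.

Lemma crossing_segment s O O' a : loop O ->
  (forall e, ((e \in D1) != (e \in D2)) && (bend e \in O) = false -> a e = 0) ->
  \sum_e crossing s O' e * a e = 0.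
Proof.
move=> lO a0; apply: big1 => e _.
have [h|h] := boolP (((e \in D1) != (e \in D2)) && (bend e \in O)).
  by rewrite crossing_D ?mul0r //; move: h; case: (e \in D1); case: (e \in D2).
by rewrite a0 ?mulr0 //; exact: negbTE.
Qed.

Lemma excursion_start x sx y sy g : excursion x sx y sy g ->
  exists e, [/\ g e != 0, (e \in D1) = (e \in D2) & bend e = x].
Proof.
case=> _ [gb _] _ gD _.
have /existsP [e /andP [/eqP be ge]] : [exists e, (bend e == x) && (g e != 0)].
  apply: contraT => /existsPn h; have := gb x; rewrite eqxx /bsum big1 // => e /eqP be.
  by have := h e; rewrite be eqxx negbK => /eqP.
exists e; split=> //; apply/eqP; apply: contraNT ge => ne.
by rewrite gD.
Qed.

(** Closed up along the loop, the excursion would not cross it on the opposite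
    side, so its class would be a multiple of the class of the loop; but the
    multiplicity would have to lie strictly between 0 and 1. *)
Lemma no_same_loop O x y s g : loop O -> x \in O -> wO O y -> ~ excursion x s y s g.
Proof.
move=> lO xO yO ex; have [e0 [ge0 e0D _]] := excursion_start ex.
case: ex => _ [gb gw] g0 gD gX.
have [a [[ab aw] aS a2 a1]] := loop_segment lO xO yO.
have [_ hu2 hu1] := loop_class lO.
pose h e := g e + a e.
have ch : cycle_chain h by split=> [b|w]; rewrite ?bsumD ?wsumD ?gb ?gw ?ab ?aw subrr.
have c2 : circulation D2 h.
  by split=> // e eD; rewrite addr_ge0 ?a2 // g0 // (negPf eD) andbF.
have c1 : circulation D1 (fun e => 1 * h e + (-1) * loop_chain O e).
  split; first exact/cycle_lin/loop_cycle.
  move=> e eD; rewrite mul1r mulN1r -addrA addr_ge0 ?a1 // g0 //.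
  by rewrite (negPf eD).
have a0 : a e0 = 0 by rewrite aS // e0D eqxx.
have p2 := strict_circulation top2 c2; have p1 := strict_circulation top1 c1.
have par : pairing (cls (loop_chain O)) (cls h) = 0.
  rewrite -(loop_intersection (~~ s) lO ch).
  under eq_bigr do rewrite mulrDr.
  by rewrite big_split /= (crossing_segment _ _ lO aS) gX //; case: (s); rewrite mulr0.
have [g1 _ g1O] := loop_primitive lO.
(* The class of [h] is [k] times that of the loop. As [h] is directed for [D2],
   [k] is positive; as [h] minus the loop is directed for [D1], [k < 1]. *)
have := class_multiple par g1O; set k := pairing _ _ => hk.
have /p2 : exists e, h e != 0 by exists e0; rewrite /h a0 addr0.
have /p1 : exists e, 1 * h e + (-1) * loop_chain O e != 0.
  by exists e0; rewrite /h a0 addr0 /loop_chain /chi e0D subrr mul0r mulr0 addr0 mul1r.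
rewrite cls_lin hk !scale1r pairingDr scaleN1r pairingNr !pairingZr.
move: hu2 hu1; set q2 := pairing u2 _; set q1 := pairing u1 _ => hu2 hu1 k1 k2.
have kp : 0 < k by nia.
by nia.
Qed.

(** Two loops are homologous, so their crossing cocycles differ, up to a
    factor [m], by the coboundary of a function on the nodes. An excursion
    from one to the other that leaves and enters on the same side makes the
    values of this function on the two loops differ by [2 m]; cutting it at
    the level of one loop then exhibits the cocycle of this loop as a
    coboundary. *)
Lemma no_same_side O O' x y s g : loop O -> loop O' -> x \in O -> wO O' y ->
  ~ excursion x s y s g.
Proof.
move=> lO lO' xO yO'; have [xO'|xO'] := boolP (x \in O').
  exact: no_same_loop lO' xO' yO'.
case=> _ [gb gw] g0 gD gX.
have yO : wO O y = false.
  by apply: contraNF xO' => yO; rewrite -(loop_disjoint lO lO' yO yO').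
have := homologous_coch torus (side_compat s lO) (side_compat s lO').
rewrite !cls_cw // => /(_ (loop_same_class lO lO')) [m [u [v' [m0 hu hv hm]]]].
pose U e : int := sg s * u e; pose V e : int := sg s * v' e.
have hU e : U (sw e) = U e by rewrite /U hu.
have hV e : V (sb e) = V e by rewrite /V hv.
have hUV e : m * (crossing s O e - crossing s O' e) = U e - V e.
  rewrite /U /V -[RHS]mulrBr -hm !side_coch // -mulrBr [RHS]mulrCA.
  by rewrite [sg s * (sg s * _)]mulrA sg2 mul1r.
pose h b : int := V (b1 b); have Vh e : V e = h (bend e).
  by apply: black_const; rewrite ?bb1.
have UD e : (e \in D1) || (e \in D2) -> U e = V e.
  move=> eD; have := hUV e; rewrite !crossing_D // subrr mulr0 => /esym/eqP.
  by rewrite subr_eq0 => /eqP.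
have Uw w : U (w1 w) = h (bend (w1 w)) by rewrite UD ?w1D // Vh.
have Uw2 w : U (w1 w) = h (bend (w2 w)).
  by rewrite -Vh -UD ?w2D ?orbT //; apply: white_const; rewrite ?ww1 ?ww2.
have htau b : h (tau b) = h b.
  rewrite tauE -Uw2 Uw; congr h.
  by have := b1D b; rewrite D1w => /eqP <-; rewrite bb1.
have hconst O'' b b' : loop O'' -> b \in O'' -> b' \in O'' -> h b = h b'.
  move=> [c _ ->] bO b'O; have E d : d \in porbit tau c -> h d = h c.
    by move=> /porbitP [i ->]; rewrite permX; elim: i => //= i IH; rewrite htau.
  by rewrite !E.
have Ue e : U e = U (w1 (wend e)) by apply: white_const; rewrite ?ww1.
have hxy : h (bend (w1 y)) - h x = - (2 * m).
  have s1 : \sum_e g e * U e = h (bend (w1 y)).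
    rewrite sum_white_const // (bigD1 y) //= big1 ?addr0 => [|w /negPf nw]; last first.
      by rewrite gw nw mul0r.
    rewrite gw eqxx mul1r; case: pickP => [e /eqP ey|/(_ (w1 y))]; last by rewrite ww1 eqxx.
    by rewrite Ue ey Uw.
  have s2 : \sum_e g e * V e = h x.
    rewrite sum_black_const // (bigD1 x) //= big1 ?addr0 => [|w /negPf nw]; last first.
      by rewrite gb nw mul0r.
    rewrite gb eqxx mul1r; case: pickP => [e /eqP ey|/(_ (b1 x))]; last by rewrite bb1 eqxx.
    by rewrite Vh ey.
  rewrite -s1 -s2 -sumrB; under eq_bigr do rewrite -mulrBr -hUV mulrCA mulrBr ![g _ * _]mulrC.
  rewrite -mulr_sumr sumrB !gX // eqxx yO yO' xO (negPf xO') /=.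
  by ring.
(* The function of the nodes is [h x] on [O] and [h x - 2 m] on [O']. *)
have H := @loop_not_exact s O (fun e => (h x <= U e)%R%:R) (fun e => (h x <= V e)%R%:R) lO.
apply: H; first by move=> e; rewrite hU.
  by move=> e; rewrite hV.
move=> e; have [eD|eD] := boolP ((e \in D1) || (e \in D2)).
  by rewrite crossing_D // UD // subrr.
have := hUV e; rewrite /crossing (negPf eD).
have hy : h (bend (w1 y)) = h x - 2 * m by rewrite -(subrK (h x) (h _)) hxy addrC.
apply: threshold_cut => //.
- by case/andP => _ we; rewrite Ue Uw; apply: (hconst O).
- by case/andP => _ be; rewrite Vh; apply: (hconst O).
- by case/andP => _ we; rewrite Ue Uw -hy; apply: (hconst O').
- by case/andP => _ be; rewrite Vh -hy; apply: (hconst O').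
Qed.

(** The moves of a path of the flow of [D2] through free nodes. *)
Definition free_forward : pred E :=
  fun e => [&& e \notin D2, free_b (bend e) & free_w (wend e)].
Definition free_backward : pred E := fun e => (e \in D2) && free_b (bend e).
Local Notation free_step := (step free_forward free_backward).

Lemma free_D e : free_b (bend e) -> (e \in D1) = (e \in D2).
Proof. by rewrite D1b D2b => /eqP ->. Qed.

Lemma side_w_free s O e : loop O -> free_w (wend e) -> side_w s O e = false.
Proof.
move=> lO fw; apply/negbTE; rewrite negb_and orbC.
by apply/orP; left; apply: contraL fw; exact: wO_nonfree.
Qed.

Lemma side_b_free s O e : loop O -> free_b (bend e) -> side_b s O e = false.
Proof.
move=> lO fw; apply/negbTE; rewrite negb_and orbC.
by apply/orP; left; apply: contraL fw; exact: loop_nonfree.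
Qed.

Lemma excursion_edge e : e \notin D1 -> e \notin D2 -> ~~ free_b (bend e) ->
  ~~ free_w (wend e) ->
  excursion (bend e) (rb e) (wend e) (rw e) (fun x => (x == e)%:R).
Proof.
move=> e1 e2 fb fw; split; first by split.
- by split=> x; [exact: bsum_delta|exact: wsum_delta].
- by move=> x _; case: (x == e).
- move=> x nx; have -> : (x == e) = false; last by [].
  by apply: contraNF nx => /eqP ->; rewrite (negPf e1) (negPf e2).
- move=> s O lO; rewrite (bigD1 e) //= big1 ?addr0 => [|x /negPf ->]; last by rewrite mulr0.
  by rewrite eqxx mulr1 /crossing (negPf e1) (negPf e2).
Qed.

Lemma excursion_path o e : o \notin D1 -> o \notin D2 -> ~~ free_b (bend o) ->
  free_w (wend o) -> e \notin D1 -> e \notin D2 -> ~~ free_w (wend e) ->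
  free_b (bend e) -> connect free_step (inr (wend o)) (inl (bend e)) ->
  exists g, excursion (bend o) (rb o) (wend e) (rw e) g.
Proof.
move=> o1 o2 ob ow e1 e2 ew eb /path_chain [m [mN mf mb]].
exists (fun x => (x == o)%:R + (m x + (x == e)%:R)); split; first by split.
- split=> [b|w].
    rewrite bsumD bsumD !bsum_delta; have := mN (inl b) => /= h.
    have -> : bsum m b = - (b == bend e)%:R by apply: oppr_inj; rewrite h opprK subr0.
    by rewrite addNr addr0.
  rewrite wsumD wsumD !wsum_delta; have := mN (inr w) => /= h.
  have -> : wsum m w = - (w == wend o)%:R by rewrite h sub0r.
  by rewrite addNKr.
- move=> x nx; rewrite addr_ge0 ?ler0n // addr_ge0 ?ler0n //.
  rewrite leNgt; apply/negP => /mb /andP [xD xb]; move: nx.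
  by rewrite free_D // xD.
- move=> x nx; have -> : (x == o) = false.
    by apply: contraNF nx => /eqP ->; rewrite (negPf o1) (negPf o2).
  have -> : (x == e) = false.
    by apply: contraNF nx => /eqP ->; rewrite (negPf e1) (negPf e2).
  rewrite add0r addr0; apply: contraTeq nx => mx; rewrite negbK free_D //.
  by case: (ltgtP (m x) 0) mx => // [/mb /andP []|/mf /and3P []].
- move=> s O lO; under eq_bigr do rewrite !mulrDr.
  rewrite !big_split /= [X in _ + (X + _)]big1 ?add0r => [|x _]; last first.
    have [->|mx] := eqVneq (m x) 0; first by rewrite mulr0.
    rewrite /crossing; case: ifP => [|_]; first by rewrite mul0r.
    case: (ltgtP (m x) 0) mx => // [/mb /andP [xD xb]|/mf /and3P [xD xb xw]] _.
      rewrite side_b_free // side_w_free ?subrr ?mul0r //.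
      have [+ _] := free_b_w xb; congr (is_true (free_w _)).
      by congr (wend _); apply/esym/eqP; rewrite -D1b free_D.
    by rewrite side_b_free // side_w_free // subrr mul0r.
  rewrite (bigD1 o) //= big1 ?addr0 => [|x /negPf ->]; last by rewrite mulr0.
  rewrite (bigD1 e) //= big1 ?addr0 => [|x /negPf ->]; last by rewrite mulr0.
  rewrite !eqxx !mulr1 /crossing (negPf o1) (negPf o2) (negPf e1) (negPf e2) /=.
  by rewrite (side_w_free _ lO ow) (side_b_free _ lO eb) sub0r subr0 addrC.
Qed.

Lemma surj_closed (T : finType) (f : T -> T) (P : {set T}) : injective f ->
  (forall x, x \in P -> f x \in P) -> forall y, y \in P -> exists2 x, x \in P & f x = y.
Proof.
move=> fI fP y yP; have fE : f @: P = P.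
  apply/eqP; rewrite eqEcard card_imset // leqnn andbT.
  by apply/fintype.subsetP => _ /imsetP [x xP ->]; exact: fP.
by move: yP; rewrite -{1}fE => /imsetP [x xP ->]; exists x.
Qed.

Lemma free_w_b2 w : free_w w -> free_b (bend (w2 w)).
Proof. by move=> fw; have [h1 h2] := free_w_b fw; rewrite -tau_w h2. Qed.

Lemma step_D2 w : free_w w -> free_step (inr w) (inl (bend (w2 w))).
Proof.
move=> fw; apply/existsP; exists (w2 w).
by rewrite /free_backward w2D free_w_b2 // ww2 !eqxx.
Qed.

(** Among the free nodes from which such an edge can be reached, a count shows
    that one is the end of an edge of [D] coming from a loop, which starts the
    excursion. *)
Lemma excursion_into D e : perfect_matching D -> e \in D -> e \notin D1 -> e \notin D2 ->
  ~~ free_w (wend e) -> exists o g,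
  [/\ o \notin D1, o \notin D2 & excursion (bend o) (rb o) (wend e) (rw e) g].
Proof.
move=> pD eD e1 e2 ew; have [eb|eb] := boolP (free_b (bend e)); last first.
  by exists e, (fun x => (x == e)%:R); split=> //; exact: excursion_edge.
have [mb [mbE mbD mbU]] := matching_black pD; have [mw [mwE mwD mwU]] := matching_white pD.
(* The free blacks from which [bend e] is reached, going forward along any edge
   and backward along [D2]. If [D] matched their partners in [D2] with them, it
   would do so bijectively, and [e] would end at a free white. The edge [o] of
   [D] that enters these partners from outside starts on a loop. *)
pose P := [set b | free_b b && connect free_step (inl b) (inl (bend e))].
pose f b := bend (mw (wend (b2 b))).
have fI : injective f.
  move=> b b' h; have h2 : mw (wend (b2 b)) = mw (wend (b2 b')).
    by rewrite (mbU _ (mwD _)) -/(f b) h -(mbU _ (mwD _)).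
  have h3 : wend (b2 b) = wend (b2 b') by rewrite -(mwE (wend (b2 b))) h2 mwE.
  have := b2D b; have := b2D b'; rewrite !D2w h3 => /eqP h4 /eqP h5.
  by rewrite -(bb2 b) h5 -h4 bb2.
have eP : bend e \in P by rewrite inE eb connect0.
have [/forall_inP fP|] := boolP [forall b in P, f b \in P].
  have [b bP fb] := surj_closed fI fP eP.
  have ee : mw (wend (b2 b)) = e by rewrite (mbU _ (mwD _)) -/(f b) fb -(mbU _ eD).
  case/negP: ew; rewrite -ee mwE; move: bP; rewrite inE => /andP [bf _].
  by have [+ _] := free_b_w bf; rewrite (eqP bf).
rewrite negb_forall_in => /exists_inP [b bP fbP].
move: bP; rewrite inE => /andP [bf bc]; pose o := mw (wend (b2 b)).
have ow : free_w (wend o) by rewrite mwE; have [+ _] := free_b_w bf; rewrite (eqP bf).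
have oc : connect free_step (inr (wend o)) (inl (bend e)).
  apply: connect_trans bc; apply: connect1.
  have -> : b = bend (w2 (wend o)); last exact: step_D2.
  by rewrite mwE; have := b2D b; rewrite D2w => /eqP <-; rewrite bb2.
have o2 : o \notin D2.
  apply: contra fbP => oD; rewrite /f -/o inE.
  have -> : bend o = b; last by rewrite bf.
  by have := oD; rewrite D2w mwE => /eqP ->; have := b2D b; rewrite D2w => /eqP <-.
have ob : ~~ free_b (bend o).
  apply: contra fbP => ob; rewrite /f -/o inE ob /=; apply: connect_trans oc.
  apply: connect1; apply/existsP; exists o; rewrite !eqxx !andbT.
  by apply/and3P; split.
have o1 : o \notin D1.
  apply: contra ob => oD; have := free_w_b ow; have := oD; rewrite D1w => /eqP <-.
  by case.
by have [g hg] := excursion_path o1 o2 ob ow e1 e2 ew eb oc; exists o, g.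
Qed.

(** Mirror image of [excursion_into]. *)
Lemma excursion_from D e : perfect_matching D -> e \in D -> e \notin D1 -> e \notin D2 ->
  ~~ free_b (bend e) -> exists o g,
  [/\ o \notin D1, o \notin D2 & excursion (bend e) (rb e) (wend o) (rw o) g].
Proof.
move=> pD eD e1 e2 eb; have [ew|ew] := boolP (free_w (wend e)); last first.
  by exists e, (fun x => (x == e)%:R); split=> //; exact: excursion_edge.
have [mb [mbE mbD mbU]] := matching_black pD; have [mw [mwE mwD mwU]] := matching_white pD.
(* The free blacks reached from [wend e]; dually, some edge of [D] leaves them
   for a loop. *)
pose P := [set b | free_b b && connect free_step (inr (wend e)) (inl b)].
pose f b := bend (w2 (wend (mb b))).
have fI : injective f.
  move=> b b' h; have h2 : w2 (wend (mb b)) = w2 (wend (mb b')).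
    by have := w2D (wend (mb b)); have := w2D (wend (mb b'));
      rewrite !D2b -/(f b) h => /eqP h4 /eqP h5; exact: etrans h5 (esym h4).
  have h3 : wend (mb b) = wend (mb b') by rewrite -(ww2 (wend (mb b))) h2 ww2.
  by rewrite -(mbE b) (mwU _ (mbD b)) h3 -(mwU _ (mbD b')).
have eP : bend (w2 (wend e)) \in P.
  by rewrite inE free_w_b2 //; apply: connect1; exact: step_D2.
have [/forall_inP fP|] := boolP [forall b in P, f b \in P].
  have [b bP fb] := surj_closed fI fP eP.
  have ww : wend (mb b) = wend e.
    rewrite -(ww2 (wend (mb b))) -(ww2 (wend e)); congr wend.
    by have := w2D (wend (mb b)); have := w2D (wend e);
      rewrite !D2b -/(f b) fb => /eqP h4 /eqP h5; exact: etrans h5 (esym h4).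
  have ee : mb b = e by rewrite (mwU _ (mbD b)) ww -(mwU _ eD).
  by case/negP: eb; rewrite -ee mbE; move: bP; rewrite inE => /andP [].
rewrite negb_forall_in => /exists_inP [b bP fbP].
move: bP; rewrite inE => /andP [bf bc]; pose o := mb b.
have ob : free_b (bend o) by rewrite mbE.
have o2 : o \notin D2.
  apply: contra fbP => oD; rewrite /f -/o inE.
  have -> : bend (w2 (wend o)) = b; last by rewrite bf.
  by have := oD; rewrite D2w => /eqP <-; rewrite mbE.
have oc : ~~ free_w (wend o).
  apply: contra fbP => ow; rewrite /f -/o inE free_w_b2 //=.
  apply: connect_trans bc _; apply: (@connect_trans _ _ (inr (wend o))); last first.
    exact/connect1/step_D2.
  apply: connect1; apply/existsP; exists o; rewrite mbE !eqxx !andbT.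
  by apply/and3P; split.
have o1 : o \notin D1 by rewrite free_D.
have [|g hg] := @excursion_path e o e1 e2 eb ew o1 o2 oc ob; first by rewrite mbE.
by exists o, g.
Qed.

Lemma sum_reindex (I : finType) (A : {set I}) (p : I -> I) (F : I -> int) :
  p @: A = A -> {in A &, injective p} -> \sum_(i in A) F (p i) = \sum_(i in A) F i.
Proof. by move=> pA pI; rewrite -[in RHS]pA big_imset. Qed.

(** Completed by segments of loops, a closed chain of excursions from left to
    right would be a cycle directed for [D2] that crosses a loop positively,
    while [weak_circulation] imposes the other sign. *)
Lemma no_closed_chain (I : finType) (A : {set I}) (x : I -> black G) (y : I -> white G)
    (g : I -> E -> int) (p q : I -> I) : A != finset.set0 ->
  p @: A = A -> {in A &, injective p} -> q @: A = A -> {in A &, injective q} ->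
  (forall i, i \in A -> excursion (x i) false (y i) true (g i)) ->
  (forall i, i \in A -> exists O, [/\ loop O, x (q i) \in O & wO O (y (p i))]) -> False.
Proof.
move=> A0 pA pI qA qI ex lo.
have /fin_all_exists [a aP] : forall i, exists a : E -> int, i \in A ->
    [/\ (forall b, bsum a b = - (b == x (q i))%:R) /\ (forall w, wsum a w = - (w == y (p i))%:R),
       forall e, e \notin D2 -> 0 <= a e &
       forall s O, \sum_e crossing s O e * a e = 0].
  move=> i; have [iA|_] := boolP (i \in A); last by exists (fun=> 0).
  have [O [lO xO yO]] := lo i iA; have [a [h1 h2 h3 h4]] := loop_segment lO xO yO.
  by exists a => _; split=> // s O'; exact: crossing_segment h2.
pose h e := \sum_(i in A) (g i e + a i e).
have sumh (P : pred E) : \sum_(e | P e) h e =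
    \sum_(i in A) \sum_(e | P e) g i e + \sum_(i in A) \sum_(e | P e) a i e.
  by rewrite exchange_big -big_split; apply: eq_bigr => i _; exact: big_split.
have ch : cycle_chain h.
  split=> [b|w].
    rewrite /bsum sumh (eq_bigr (fun i => (b == x i)%:R : int)); last first.
      by move=> i /ex [_ [+ _] _ _ _]; apply.
    rewrite [X in _ + X](eq_bigr (fun i => - (b == x (q i))%:R : int)); last first.
      by move=> i /aP [[+ _] _ _]; apply.
    by rewrite sumrN (sum_reindex (fun i => (b == x i)%:R) qA qI) subrr.
  rewrite /wsum sumh (eq_bigr (fun i => (w == y i)%:R : int)); last first.
    by move=> i /ex [_ [_ +] _ _ _]; apply.
  rewrite [X in _ + X](eq_bigr (fun i => - (w == y (p i))%:R : int)); last first.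
    by move=> i /aP [[_ +] _ _]; apply.
  by rewrite sumrN (sum_reindex (fun i => (w == y i)%:R) pA pI) subrr.
have c2 : circulation D2 h.
  split=> // e eD; apply: sumr_ge0 => i iA; rewrite addr_ge0 //.
    by have [_ _ g0 _ _] := ex i iA; rewrite g0 // (negPf eD) andbF.
  by have [_ a0 _] := aP i iA; exact: a0.
have [i0 i0A] := set0Pn _ A0; move: (i0A); rewrite -{1}pA => /imsetP [i1 i1A i01].
have [O [lO _ yO]] := lo i1 i1A; rewrite -i01 in yO.
have := loop_intersection true lO ch; rewrite mul1r.
have -> : \sum_e crossing true O e * h e = \sum_(i in A) (wO O (y i))%:R.
  under eq_bigr do rewrite mulr_sumr; rewrite exchange_big; apply: eq_bigr => i iA.
  under eq_bigr do rewrite mulrDr; rewrite big_split /=.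
  have [_ _ _ _ gX] := ex i iA; have [_ _ aX] := aP i iA.
  by rewrite gX // aX addr0 subr0.
rewrite (bigD1 i0) //= yO; set S := \sum_(_ in _ | _) _.
have S0 : 0 <= S by apply: sumr_ge0 => i _; case: (wO _ _).
have hv := weak_circulation wtop2 c2; have [[d1 d2] _ _] := loop_class lO.
have := pairing_decomp (cls h) (cls (loop_chain O)) v; rewrite d1 mul0r addr0.
rewrite [pairing (cls h) (cls _)]pairingC [pairing (cls h) v]pairingC => + hS.
rewrite -hS; have vv := dot_gt0 v0; move: d2 vv hv S0.
set a1 := pairing _ (rot90 v); set a2 := pairing v (rot90 v); set a3 := pairing v (cls h).
by clear; move=> *; nia.
Qed.

(** Edges that obstruct the maximal right turn of a loop at a white node. *)
Definition right_bad e := [&& e \notin D1, e \notin D2, ~~ free_w (wend e) & rw e].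
(** Edges that obstruct the maximal left turn of a loop at a black node. *)
Definition left_bad e := [&& e \notin D1, e \notin D2, ~~ free_b (bend e) & ~~ rb e].

Definition right_count D O : int :=
  \sum_e chi D e * ((e \notin D1) && (e \notin D2) && side_w true O e)%:R.
Definition left_count D O : int :=
  \sum_e chi D e * ((e \notin D1) && (e \notin D2) && side_b false O e)%:R.

(** The four corner values of an edge add up to twice the difference of the
    two indicators, up to a function of its black end, which a cycle does not
    see. *)
Lemma side_balance_sum D O : rigid D -> loop O ->
  corner_sum (fun e => chi D e - chi D1 e) (cw true O) (cb true O) =
  2 * (right_count D O - left_count D O).
Proof.
move=> [pD _] lO; have cs := matching_diff pD1 pD.
pose R e : int := ((e \notin D1) && (e \notin D2) && side_w true O e)%:R.
pose L e : int := ((e \notin D1) && (e \notin D2) && side_b false O e)%:R.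
have four e : cw true O e + cw true O ((sw^-1)%g e) + cb true O e + cb true O ((sb^-1)%g e) =
    2 * (R e - L e + (bend e \in O)%:R).
  rewrite /cw /cb wend_rotwV bend_rotbV /R /L /side_w /side_b.
  have := rw_jump e; have := rb_jump e; rewrite /chi.
  have [eD|] := boolP ((e \in D1) || (e \in D2)).
    have -> : (e \notin D1) && (e \notin D2) = false by rewrite -negb_or eD.
    rewrite wO_D //; have [eO|_] := boolP (bend e \in O); last by rewrite !mulr0.
    have nf := loop_nonfree lO eO.
    have : ~~ ((e \in D1) && (e \in D2)).
      apply: contra nf => /andP []; rewrite D1b D2b => /eqP h1 /eqP h2.
      by rewrite /free_b -h1 -h2.
    move: eD; case: (e \in D1); case: (e \in D2) => //= _ _;
    by case: (rw e); case: (rw _); case: (rb e); case: (rb _).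
  rewrite negb_or => /andP [/negPf -> /negPf ->]; rewrite subrr => /eqP; rewrite subr_eq0 => /eqP -> /eqP.
  rewrite subr_eq0 => /eqP <-; case: (rw e); case: (rb e);
    by case: (wO O (wend e)); case: (bend e \in O).
rewrite /corner_sum; under eq_bigr => e _ do rewrite four mulrCA.
rewrite -mulr_sumr.
have -> : \sum_e (chi D e - chi D1 e) * (R e - L e + (bend e \in O)%:R) =
   \sum_e (chi D e - chi D1 e) * (R e - L e) +
   \sum_e (chi D e - chi D1 e) * (bend e \in O)%:R.
  by rewrite -big_split; apply: eq_bigr => e _; rewrite mulrDr.
rewrite (@cycle_black_const _ (fun e => chi D e - chi D1 e) (fun e => (bend e \in O)%:R) cs);
  last by move=> e; rewrite bend_rotb.
rewrite addr0 /right_count /left_count -sumrB; congr (_ * _); apply: eq_bigr => e _.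
rewrite -mulrBr -/(R e) -/(L e) /chi; case: (boolP (e \in D1)) => eD1; last by rewrite subr0.
by rewrite /R /L eD1 /= subrr !mulr0.
Qed.

Hypothesis nouni : no_univalent_node G.
Hypothesis covered : forall e, exists2 D, rigid D & e \in D.

Lemma side_balance D O O' : rigid D -> loop O -> loop O' ->
  right_count D O - left_count D O = right_count D O' - left_count D O'.
Proof.
move=> rD lO lO'; have r1 := strict_rigid top1.
have := @corner_sum_cls _ torus (fun e => chi D e - chi D1 e) (cw true O) (cb true O)
  (cw true O') (cb true O') (matching_diff pD1 rD.1).
rewrite !side_balance_sum // !cls_cw // => H.
suff : 2 * (right_count D O - left_count D O) = 2 * (right_count D O' - left_count D O') by clear; lia.
apply: H; [|exact: side_compat|exact: side_compat|exact: loop_same_class].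
by move=> e; exact: (rigid_face_diff torus nouni e rD r1).
Qed.

Lemma nonfree_w_b w : ~~ free_w w -> ~~ free_b (bend (w1 w)).
Proof.
apply: contra => fb; have [+ _] := free_b_w fb.
by have := w1D w; rewrite D1b => /eqP <-; rewrite ww1.
Qed.

Lemma loop_black b : ~~ free_b b -> loop (porbit tau b).
Proof. by move=> nb; exists b. Qed.

Lemma loop_white w : ~~ free_w w -> exists2 O, loop O & wO O w.
Proof.
by move=> nw; exists (porbit tau (bend (w1 w))); [exact/loop_black/nonfree_w_b|exact: porbit_id].
Qed.

(** An excursion that ends in a bad edge on the right starts on the left, as
    it cannot start on the same side. *)
Lemma right_bad_from e : right_bad e -> exists (o : E) (g : E -> int),
  left_bad o /\ excursion (bend o) false (wend e) true g.
Proof.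
case/and4P=> e1 e2 ew er; have [D [pD _] eD] := covered e.
have [o [g [o1 o2 ex]]] := excursion_into pD eD e1 e2 ew; rewrite er in ex.
have [[ob _] _ _ _ _] := ex; have [O lO wOe] := loop_white ew.
case hr : (rb o) in ex; last by exists o, g; rewrite /left_bad o1 o2 ob hr.
by case: (no_same_side (loop_black ob) lO (porbit_id _ _) wOe ex).
Qed.

Lemma left_bad_to e : left_bad e -> exists (o : E) (g : E -> int),
  right_bad o /\ excursion (bend e) false (wend o) true g.
Proof.
case/and4P=> e1 e2 eb /negPf er; have [D [pD _] eD] := covered e.
have [o [g [o1 o2 ex]]] := excursion_from pD eD e1 e2 eb; rewrite er in ex.
have [[_ ow] _ _ _ _] := ex; have [O lO wOo] := loop_white ow.
case hr : (rw o) in ex; first by exists o, g; rewrite /right_bad o1 o2 ow hr.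
by case: (no_same_side (loop_black eb) lO (porbit_id _ _) wOo ex).
Qed.

Definition on_right O := [exists e, right_bad e && wO O (wend e)].
Definition on_left O := [exists e, left_bad e && (bend e \in O)].

(** Otherwise every loop with a bad edge on the left has one on the right,
    where an excursion from the left of some loop ends: these excursions could
    be chained, and eventually closed up. *)
Lemma loop_left_only e : right_bad e -> exists2 O, loop O & on_left O && ~~ on_right O.
Proof.
move=> re; have [/existsP [o /andP [lo nr]]|/existsPn H] :=
  boolP [exists o, left_bad o && ~~ on_right (porbit tau (bend o))].
  exists (porbit tau (bend o)); first by apply: loop_black; case/and4P: lo.
  by rewrite nr andbT; apply/existsP; exists o; rewrite lo porbit_id.
exfalso.
have /fin_all_exists [t tP] : forall e, exists t : E * (E * (E -> int)), right_bad e ->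
   [/\ left_bad t.2.1, excursion (bend t.2.1) false (wend e) true t.2.2,
      right_bad t.1 & wO (porbit tau (bend t.2.1)) (wend t.1)].
  move=> i; have [ri|_] := boolP (right_bad i); last by exists (i, (i, fun=> 0)).
  have [o [g [lo ex]]] := right_bad_from ri; have := H o; rewrite lo /= negbK.
  by move=> /existsP [j /andP [rj jO]]; exists (j, (o, g)).
have [||A' [A'A A'0 fE fI]] := @permuted_subset _ (fun e => (t e).1) [set e | right_bad e].
- by apply/set0Pn; exists e; rewrite inE.
- by move=> i; rewrite !inE => /tP [].
have inA i : i \in A' -> right_bad i by move=> /(fintype.subsetP A'A); rewrite inE.
apply: (@no_closed_chain _ A' (fun i => bend (t i).2.1) (fun i => wend i) (fun i => (t i).2.2)
   (fun i => (t i).1) id A'0 fE fI) => //.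
- by apply/finset.setP => i; rewrite imset_id.
- by move=> i /inA /tP [].
- move=> i /inA /tP [lo _ _ h]; exists (porbit tau (bend (t i).2.1)); split=> //.
    by apply: loop_black; case/and4P: lo.
  exact: porbit_id.
Qed.

Lemma loop_right_only e : left_bad e -> exists2 O, loop O & on_right O && ~~ on_left O.
Proof.
move=> le; have [/existsP [o /andP [ro nr]]|/existsPn H] :=
  boolP [exists o, right_bad o && ~~ on_left (porbit tau (bend (w1 (wend o))))].
  have ow : ~~ free_w (wend o) by case/and4P: ro.
  exists (porbit tau (bend (w1 (wend o)))); first exact/loop_black/nonfree_w_b.
  by rewrite nr andbT; apply/existsP; exists o; rewrite ro /wO porbit_id.
exfalso.
have /fin_all_exists [t tP] : forall e, exists t : E * (E * (E -> int)), left_bad e ->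
   [/\ right_bad t.2.1, excursion (bend e) false (wend t.2.1) true t.2.2,
      left_bad t.1 & bend t.1 \in porbit tau (bend (w1 (wend t.2.1)))].
  move=> i; have [ri|_] := boolP (left_bad i); last by exists (i, (i, fun=> 0)).
  have [o [g [lo ex]]] := left_bad_to ri; have := H o; rewrite lo /= negbK.
  by move=> /existsP [j /andP [rj jO]]; exists (j, (o, g)).
have [||A' [A'A A'0 fE fI]] := @permuted_subset _ (fun e => (t e).1) [set e | left_bad e].
- by apply/set0Pn; exists e; rewrite inE.
- by move=> i; rewrite !inE => /tP [].
have inA i : i \in A' -> left_bad i by move=> /(fintype.subsetP A'A); rewrite inE.
apply: (@no_closed_chain _ A' (fun i => bend i) (fun i => wend (t i).2.1) (fun i => (t i).2.2)
   id (fun i => (t i).1) A'0 _ _ fE fI) => //.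
- by apply/finset.setP => i; rewrite imset_id.
- by move=> i /inA /tP [].
- move=> i /inA /tP [ro _ _ h]; exists (porbit tau (bend (w1 (wend (t i).2.1)))); split=> //.
    by apply/loop_black/nonfree_w_b; case/and4P: ro.
  exact: porbit_id.
Qed.

Lemma right_count_eq0 D O : loop O -> ~~ on_right O -> right_count D O = 0.
Proof.
move=> lO /existsPn h; apply: big1 => e _; apply/eqP; rewrite mulf_eq0; apply/orP; right.
have := h e; rewrite /right_bad /side_w eqb_id.
case: (e \notin D1); case: (e \notin D2); case: (rw e); rewrite ?andbF //=.
case: (boolP (wO O (wend e))) => // wOe.
by rewrite (negPf (wO_nonfree lO wOe)).
Qed.

Lemma left_count_eq0 D O : loop O -> ~~ on_left O -> left_count D O = 0.
Proof.
move=> lO /existsPn h; apply: big1 => e _; apply/eqP; rewrite mulf_eq0; apply/orP; right.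
have := h e; rewrite /left_bad /side_b eqbF_neg.
case: (e \notin D1); case: (e \notin D2); case: (rb e); rewrite ?andbF //=.
case: (boolP (bend e \in O)) => // wOe.
by rewrite (negPf (loop_nonfree lO wOe)).
Qed.

Lemma right_count_ge0 D O : 0 <= right_count D O.
Proof. by apply: sumr_ge0 => e _; rewrite mulr_ge0 ?chi_ge0. Qed.

(** A loop with bad edges on the left only and a loop with bad edges on the
    right only have different balances in a matching through one of these
    edges. *)
Lemma no_left_bad e : ~~ left_bad e.
Proof.
apply/negP => le; have [O' lO' /andP [_ nO']] := loop_right_only le.
have [o [_ [ro _]]] := left_bad_to le.
have [O lO /andP [/existsP [e' /andP [le' e'O]] nO]] := loop_left_only ro.
have [D rD eD] := covered e'.
have := side_balance rD lO lO'; rewrite (right_count_eq0 D lO nO) (left_count_eq0 D lO' nO') subr0 sub0r.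
have := right_count_ge0 D O'; set a := right_count _ _ => a0 h.
have : 0 < left_count D O.
  rewrite /left_count (bigD1 e') //= /chi eD.
  case/and4P: le' => -> -> _ /negPf re /=; rewrite /side_b re e'O /= mul1r.
  by apply: ltr_wpDr => //; apply: sumr_ge0 => i _; case: (i \in D); case: (_ && _).
by move: a0 h; clear; lia.
Qed.

Lemma no_right_bad e : ~~ right_bad e.
Proof.
apply/negP => /right_bad_from [o [_ [lo _]]]; have := no_left_bad o.
by rewrite lo.
Qed.

(** Without bad edges the loops turn maximally right at white nodes and
    maximally left at black nodes. *)
Lemma loops_are_zigzags e : e \in D1 -> e \notin D2 ->
  [/\ sw e \in D2, sw e \notin D1, zigzag_perm G e \in D1 & zigzag_perm G e \notin D2].
Proof.
move=> e1 e2; have nfw : ~~ free_w (wend e).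
  apply: contra e2 => /eqP h; move: e1; rewrite D1w h => /eqP ->; exact: w2D.
have swe1 : sw e \notin D1.
  apply: contra (rotw_neq nouni e); rewrite !D1w wend_rotw => /eqP ->.
  by move: e1; rewrite D1w => /eqP <-.
have re : rw e by have := rw_jump e; rewrite /chi e1 (negPf e2); case: (rw e); case: (rw _).
have swe2 : sw e \in D2.
  apply: contraT => swe2; have := no_right_bad (sw e).
  rewrite /right_bad swe1 swe2 wend_rotw nfw /=.
  have := rw_jump (sw e); rewrite permK re /chi (negPf swe1) (negPf swe2).
  by case: (rw (sw e)).
pose f := sw e; have fz : zigzag_perm G e = (sb^-1)%g f by rewrite permM.
have nfb : ~~ free_b (bend f).
  by apply: contra swe1 => /free_D; rewrite -/f swe2.
have z2 : zigzag_perm G e \notin D2.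
  rewrite fz; apply/negP; rewrite D2b bend_rotbV => /eqP h.
  have := rotb_neq nouni ((sb^-1)%g f); rewrite permKV h.
  by have := swe2; rewrite -/f D2b => /eqP <-; rewrite eqxx.
split=> //; apply: contraT => z1; have := no_left_bad (zigzag_perm G e).
rewrite /left_bad z1 z2 fz bend_rotbV nfb /=.
have := rb_jump f; rewrite /chi swe2 (negPf swe1).
by case: (rb f); case: (rb _).
Qed.

End Loops.

(** * Directions in the plane *)

Lemma plucker (a b c d : Z2) : pairing a c * pairing b d =
  pairing a b * pairing c d + pairing a d * pairing b c.
Proof. by rewrite /pairing; ring. Qed.

Lemma pairing_rot0 (a x : Z2) : a != 0 -> pairing a x = 0 -> pairing (rot90 a) x = 0 -> x = 0.
Proof.
move=> a0 h1 h2; have aa := dot_gt0 a0; rewrite pairingC in h2.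
have h3 : pairing x (rot90 a) = 0 by lia.
have z u : pairing u x = 0.
  have := pairing_decomp u x a; rewrite h1 h3 !mul0r addr0 => /eqP.
  by rewrite mulf_eq0 (gt_eqF aa) orbF => /eqP.
have := z (delta_mx 0 0); have := z (delta_mx 0 1); rewrite /pairing !mxE /= => h4 h5.
by apply: Z2P; rewrite mxE; lia.
Qed.

(** Boolean form of [same_dir]. *)
Definition dir (a s : Z2) : bool := (pairing a s == 0) && (0 < pairing s (rot90 a)).

Lemma dirP a s : reflect (same_dir a s) (dir a s).
Proof. by apply: (iffP andP) => -[/eqP ? ?]; split=> //; apply/eqP. Qed.

Lemma dir_pairing a s x : dir a s ->
  pairing s x * pairing a (rot90 a) = pairing s (rot90 a) * pairing a x.
Proof.
move=> /dirP [h _]; have := pairing_decomp s x a.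
by rewrite [pairing s a]pairingC h oppr0 mulr0 add0r => ->; rewrite mulrC.
Qed.

Lemma dir_neq0 a s : dir a s -> s != 0.
Proof.
move=> /dirP [_]; apply: contraTneq => ->; by rewrite pairing0l ltxx.
Qed.

Lemma dir_neq0l a s : dir a s -> a != 0.
Proof.
move=> /dirP [_]; apply: contraTneq => ->; by rewrite /pairing !mxE !mulr0 subrr ltxx.
Qed.

Definition between (a b s : Z2) : bool := (0 < pairing a s) && (0 < pairing s b).

Lemma dir_between a b s t : dir s t -> between a b s -> between a b t.
Proof.
move=> st /andP [h1 h2]; have := dir_pairing a st; have := dir_pairing b st.
have := dot_gt0 (dir_neq0l st); have /dirP [_] := st.
rewrite /between [pairing t a]pairingC [pairing s a]pairingC.
set x := pairing t _; set y := pairing s _; move=> *; apply/andP; split; nia.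
Qed.

Lemma between_split a b c s : between a b c ->  0 < pairing a b ->
  (dir a s || between a b s : nat) = ((dir a s || between a c s) + (dir c s || between c b s))%N.
Proof.
move=> abc ab; have /andP [ac cb] := abc.
have [as_|nas] := boolP (dir a s).
  have ds := dir_pairing b as_; have dc := dir_pairing c as_.
  have vv := dot_gt0 (dir_neq0l as_); have /dirP [_ d0] := as_.
  have sc : 0 < pairing s c by nia.
  have -> : dir c s = false.
    by apply/negbTE/negP => /dirP [h _]; move: sc; rewrite pairingC h oppr0 ltxx.
  have -> : between c b s = false.
    by apply/negbTE/negP => /andP [h _]; move: sc; rewrite pairingC; lia.
  by [].
have [cs|ncs] := boolP (dir c s).
  rewrite (dir_between cs abc) /=.
  have -> // : between a c s = false.
  by apply/negbTE/negP => /andP [_]; have /dirP [h _] := cs; rewrite pairingC h oppr0 ltxx.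
rewrite /=; have p1 := plucker a s c b; have p2 := plucker a c s b.
rewrite /between in abc *.
have [h|h] := boolP ((0 < pairing a s) && (0 < pairing s b)).
  have /andP [h1 h2] := h.
  have [h3|h3] := ltP 0 (pairing s c).
    by rewrite h1 /= [pairing c s]pairingC; have -> : (0 < - pairing s c) = false by lia.
  rewrite h1 /= h2 andbT [pairing c s]pairingC; have [//|h4] := ltP 0 (- pairing s c).
  have e0 : pairing s c = 0 by lia.
  case/negP: ncs; apply/andP; split; first by rewrite pairingC e0 oppr0.
  have c0 : c != 0 by apply: contraTneq ac => ->; rewrite pairing0r ltxx.
  have := pairing_decomp a s c; have := dot_gt0 c0; rewrite [pairing c s]pairingC e0 oppr0 mul0r addr0.
  by nia.
symmetry; apply/eqP; rewrite addn_eq0 !eqb0; apply/andP; split; apply: contra h => /andP [h1 h2].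
  by apply/andP; split=> //; have := plucker a s c b; nia.
by apply/andP; split=> //; have := plucker a c s b; nia.
Qed.

Lemma between_subl a b c s : between a b c -> 0 < pairing a b -> between a c s -> between a b s.
Proof.
move=> abc ab acs; have := between_split s abc ab; rewrite acs orbT.
have -> : dir a s = false.
  by apply/negbTE/negP => /dirP [h _]; move: acs; rewrite /between h ltxx.
by case: (between a b s).
Qed.

Lemma between_subr a b c s : between a b c -> 0 < pairing a b -> between c b s -> between a b s.
Proof.
move=> abc ab cbs; have := between_split s abc ab; rewrite cbs orbT.
have -> : dir a s = false; last by case: (between a b s) => //; rewrite addn1.
apply/negbTE/negP => das; have dc := dir_pairing c das.
have vv := dot_gt0 (dir_neq0l das); have /dirP [_ d0] := das.
have /andP [ac _] := abc; have /andP [+ _] := cbs; rewrite pairingC.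
move: dc vv d0 ac; set x := pairing s c; clear => *; nia.
Qed.

(** * The supporting faces of the polygon *)

Section Ends.
Variable G : bicolored_graph.
Local Notation E := (edge G).
Local Notation sw := (rotw G).
Local Notation sb := (rotb G).
Implicit Types (e : E) (g : E -> int) (D : {set E}) (v : Z2).

Hypothesis torus : torus_graph G.
Hypothesis nouni : no_univalent_node G.
Hypothesis covered : forall e, exists2 D : {set E}, rigid D & e \in D.

(** The clockwise and counterclockwise ends of the supporting face of the
    polygon with outer normal [v]. *)
Definition support_ends v D D' : Prop :=
  [/\ exists u, strict_top u D, exists u, strict_top u D', weak_top v D, weak_top v D' &
    forall D'', weak_top v D'' ->
      height (rot90 v) D <= height (rot90 v) D'' <= height (rot90 v) D'].

Lemma strict_cls u D D' : strict_top u D -> perfect_matching D' ->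
  cls (chi D') = cls (chi D) -> D' = D.
Proof.
move=> [_ sD] pD' h; apply/eqP; apply: contraT => /(sD D' pD').
by rewrite /height h ltxx.
Qed.

Lemma cls_eq_heights v D D' : v != 0 -> height v D = height v D' ->
  height (rot90 v) D = height (rot90 v) D' -> cls (chi D) = cls (chi D').
Proof.
move=> v0 h1 h2; apply/eqP; rewrite -subr_eq0; apply/eqP; apply: (pairing_rot0 v0).
  by rewrite pairingDr pairingNr; move: h1; rewrite /height => ->; rewrite subrr.
by rewrite pairingDr pairingNr; move: h2; rewrite /height => ->; rewrite subrr.
Qed.

Lemma weak_top_eq v D D' : weak_top v D -> weak_top v D' -> height v D = height v D'.
Proof. by move=> [p h] [p' h']; apply/le_anti; rewrite h // h'. Qed.

Definition zslope e : Z2 := slope (porbit (zigzag_perm G) e).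

Lemma zslope_zigzag e : zslope (zigzag_perm G e) = zslope e.
Proof. by rewrite /zslope porbitS. Qed.

(** By [loops_are_zigzags] the edges of [D] off [D'] are permuted by
    [zigzag_perm]; the slope of a zigzag path they contain is the class of the
    cycle along it, which is directed for both matchings, so that
    [two_sided_class] applies. *)
Lemma support_ends_zigzag v D D' e : v != 0 -> support_ends v D D' -> e \in D -> e \notin D' ->
  [/\ sw e \in D', sw e \notin D, zigzag_perm G e \in D, zigzag_perm G e \notin D' &
      dir v (zslope e)].
Proof.
move=> v0 [[u1 t1] [u2 t2] w1 w2 ends] eD eD'.
have [b1 hb1] := matching_black t1.1; have [b2 hb2] := matching_black t2.1.
have [m1 hm1] := matching_white t1.1; have [m2 hm2] := matching_white t2.1.
have first12 : height (rot90 v) D <= height (rot90 v) D'.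
  by have /andP [] := ends D' w2.
have zz := loops_are_zigzags torus v0 t1 t2 w1 w2 first12 hb1 hb2 hm1 hm2 nouni covered.
have [h1 h2 h3 h4] := zz e eD eD'; split=> //; apply/dirP.
pose z := porbit (zigzag_perm G) e.
have zP x : x \in z -> x \in D /\ x \notin D'.
  move=> /porbitP [i ->]; rewrite permX; elim: i => //= i [IH1 IH2].
  by have [] := zz _ IH1 IH2.
pose g x : int := (x \in z)%:R - ((sw^-1)%g x \in z)%:R.
have sumg (P : pred E) : (forall x, P (sw x) = P (zigzag_perm G x) \/ P (sw x) = P x) ->
    \sum_(x | P x) g x = \sum_(x in z) (P x)%:R - \sum_(x in z) (P (sw x))%:R.
  move=> _; rewrite sumrB; congr (_ - _).
    rewrite [LHS]big_mkcond [RHS]big_mkcond; apply: eq_bigr => x _.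
    by case: (P x); case: (x \in z).
  rewrite [LHS]big_mkcond [RHS]big_mkcond (reindex_inj (@perm_inj _ sw)) /=.
  by apply: eq_bigr => x _; rewrite permK; case: (P _); case: (x \in z).
have zzb x : bend (sw x) = bend (zigzag_perm G x) by rewrite permM bend_rotbV.
have cg : cycle_chain g.
  split=> [b|w].
    rewrite /bsum sumg => [|x]; last by left; rewrite zzb.
    under [X in _ - X]eq_bigr do rewrite zzb.
    apply: oppr_inj; rewrite opprB oppr0 -sumrB.
    exact: (sum_porbit_next (zigzag_perm G) (fun x => (bend x == b)%:R : int)).
  rewrite /wsum sumg => [|x]; last by right; rewrite wend_rotw.
  by under [X in _ - X]eq_bigr do rewrite wend_rotw; rewrite subrr.
have clsg : cls g = zslope e.
  rewrite /zslope /slope -/z /cls; under eq_bigr do rewrite scalerBl.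
  rewrite sumrB -(sum_perm sw (fun x => ((sw^-1)%g x \in z)%:R *: disp x)) -sumrB.
  rewrite [RHS]big_mkcond; apply: eq_bigr => x _; rewrite permK -scalerBr.
  by case: (x \in z); rewrite ?scale1r ?scale0r.
have swz x : (sw^-1)%g x \in z -> x \in D' /\ x \notin D.
  by move=> /zP [k1 k2]; have [] := zz _ k1 k2; rewrite permKV.
have c2 : circulation D' g.
  split=> // x xD; rewrite /g; have -> : ((sw^-1)%g x \in z) = false; last by rewrite subr0 ler0n.
  by apply: contraNF xD => /swz [].
have c1 : circulation D (fun x => - g x).
  split; first exact: cycleN.
  move=> x xD; rewrite /g; have -> : (x \in z) = false; last by rewrite sub0r opprK ler0n.
  by apply: contraNF xD => /zP [].
have ge : exists x, g x != 0.
  exists e; rewrite /g porbit_id; have -> : ((sw^-1)%g e \in z) = false; last by [].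
  by apply: contraNF eD' => /swz [].
by have [+ _ _] := two_sided_class v0 t1 t2 w1 w2 first12 c2 c1 ge; rewrite clsg.
Qed.

Lemma support_ends_diff v D D' e : v != 0 -> support_ends v D D' ->
  chi D e - chi D' e = ((e \in D) && (e \notin D'))%:R
     - (((sw^-1)%g e \in D) && ((sw^-1)%g e \notin D'))%:R.
Proof.
move=> v0 fe; have zz := support_ends_zigzag v0 fe.
case: fe => [[u1 t1] [u2 t2] _ _ _].
have [m1 [m1E m1D m1U]] := matching_white t1.1; have [m2 [m2E m2D m2U]] := matching_white t2.1.
rewrite /chi; case: (boolP (e \in D)) => eD; case: (boolP (e \in D')) => eD' /=.
- suff -> : ((sw^-1)%g e \in D) && ((sw^-1)%g e \notin D') = false by [].
  by apply/negP => /andP [h1 h2]; have [_] := zz _ h1 h2; rewrite permKV eD.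
- suff -> : ((sw^-1)%g e \in D) && ((sw^-1)%g e \notin D') = false by [].
  by apply/negP => /andP [h1 h2]; have [+ _] := zz _ h1 h2; rewrite permKV (negPf eD').
- pose f := m1 (wend e).
  have fD : f \in D by exact: m1D.
  have fD' : f \notin D'.
    apply/negP => h; have h1 := m2U _ h; rewrite m1E -(m2U _ eD') in h1.
    by move: eD; rewrite -h1 fD.
  have [h1 _ _ _ _] := zz f fD fD'.
  have -> : (sw^-1)%g e = f; last by rewrite fD fD'.
  apply: (@perm_inj _ sw); rewrite permKV (m2U _ h1) wend_rotw m1E; exact: m2U.
- suff -> : ((sw^-1)%g e \in D) && ((sw^-1)%g e \notin D') = false by [].
  by apply/negP => /andP [h1 h2]; have [+ _] := zz _ h1 h2; rewrite permKV (negPf eD').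
Qed.

Variables (F L : Z2 -> {set E}).
Hypothesis FL : forall v, v != 0 -> support_ends v (F v) (L v).

Lemma weak_top_dir v v' D : dir v v' -> weak_top v D -> weak_top v' D.
Proof.
move=> vv' [pD tD]; split=> // D' pD'; have := tD D' pD'.
have := dir_pairing (cls (chi D)) vv'; have := dir_pairing (cls (chi D')) vv'.
have := dot_gt0 (dir_neq0l vv'); have /dirP [_] := vv'; rewrite /height.
set a := pairing v' (rot90 v); set b := pairing v (rot90 v) => a0 b0 h1 h2 h3.
rewrite -(ler_pM2r b0) h1 h2 ler_pM2l //.
Qed.

Lemma dir_sym v v' : dir v v' -> dir v' v.
Proof.
move=> /dirP [h1 h2]; apply/dirP; split; first by rewrite pairingC h1 oppr0.
have -> // : pairing v (rot90 v') = pairing v' (rot90 v).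
by rewrite /pairing !mxE /=; ring.
Qed.

Lemma pairing_rot (a b : Z2) : pairing (rot90 a) (rot90 b) = pairing a b.
Proof. by rewrite /pairing !mxE /=; ring. Qed.

Lemma dir_rot v v' : dir v v' -> dir (rot90 v) (rot90 v').
Proof.
move=> /dirP [h1 h2]; apply/dirP; rewrite /same_dir !pairing_rot; exact: conj.
Qed.

Lemma ends_dir v v' : dir v v' -> F v = F v' /\ L v = L v'.
Proof.
move=> vv'; have v0 := dir_neq0l vv'; have v'0 := dir_neq0 vv'.
have [[u1 t1] [u2 t2] w1 w2 ends] := FL v0.
have [[u1' t1'] [u2' t2'] w1' w2' ends'] := FL v'0.
have E1 := dir_pairing _ (dir_rot vv'); have /dirP [_ r1] := dir_rot vv'.
have r2 := dot_gt0 (dir_neq0l (dir_rot vv')).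
have le D D' : (height (rot90 v) D <= height (rot90 v) D') =
   (height (rot90 v') D <= height (rot90 v') D').
  by rewrite /height -[RHS](ler_pM2r r2) !E1 ler_pM2l.
have w1v := weak_top_dir vv' w1; have w2v := weak_top_dir vv' w2.
have w1v' := weak_top_dir (dir_sym vv') w1'; have w2v' := weak_top_dir (dir_sym vv') w2'.
split; apply/esym.
  apply: (strict_cls t1 t1'.1); apply: (cls_eq_heights v0); first exact: weak_top_eq.
  apply/le_anti/andP; split; last by have /andP [] := ends _ w1v'.
  by rewrite le; have /andP [] := ends' _ w1v.
apply: (strict_cls t2 t2'.1); apply: (cls_eq_heights v0); first exact: weak_top_eq.
apply/le_anti/andP; split; first by have /andP [] := ends _ w2v'.
by rewrite le; have /andP [] := ends' _ w2v.
Qed.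

(** The zigzag path through [e] lies on the supporting face in the direction
    of its slope. *)
Definition on_boundary e : bool :=
  [&& zslope e != 0, e \in F (zslope e) & e \notin L (zslope e)].

Lemma on_boundaryE v e : v != 0 ->
  (e \in F v) && (e \notin L v) = on_boundary e && dir v (zslope e).
Proof.
move=> v0; apply/andP/andP => [[eF eL]|[/and3P [z0 eF eL] vz]].
  have [_ _ _ _ vz] := support_ends_zigzag v0 (FL v0) eF eL.
  have [hF hL] := ends_dir vz.
  by rewrite /on_boundary -hF -hL eF eL (dir_neq0 vz).
by have [-> ->] := ends_dir vz.
Qed.

Lemma ends_diff v e : v != 0 -> chi (F v) e - chi (L v) e =
  (on_boundary e && dir v (zslope e))%:R -
  (on_boundary ((sw^-1)%g e) && dir v (zslope ((sw^-1)%g e)))%:R.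
Proof. by move=> v0; rewrite (support_ends_diff e v0 (FL v0)) !on_boundaryE. Qed.

Lemma sup_ratio (T : finType) (P : pred T) (a b : T -> int) x0 : P x0 ->
  (forall x, P x -> 0 < a x) ->
  exists2 x, P x & forall y, P y -> b y * a x <= b x * a y.
Proof.
move=> Px0 a0; pose r x : rat := (b x)%:~R / (a x)%:~R.
case: (@Order.TotalTheory.arg_maxP _ _ T x0 P r Px0) => x Px h; exists x => // y Py.
have := h y Py; rewrite /r /= ler_pdivrMr ?ltr0z ?a0 //.
by rewrite mulrAC ler_pdivlMr ?ltr0z ?a0 // -!rmorphM /= ler_int.
Qed.

(** Rotate the normal from [v] towards [v'] until another matching becomes as
    high as the last end for [v]. Unless this end is the first end for [v'],
    it happens before [v'], and gives a supporting face with two distinct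
    ends. *)
Lemma gift_wrapping v v' : 0 < pairing v v' -> L v != F v' ->
  exists v'', between v v' v'' /\ F v'' != L v''.
Proof.
move=> vv' neq.
have v0 : v != 0 by apply: contraTneq vv' => ->; rewrite pairing0l ltxx.
have v'0 : v' != 0 by apply: contraTneq vv' => ->; rewrite pairing0r ltxx.
have [_ [u2 t2] _ w2 ends] := FL v0; have [[u1 t1] _ w1 _ ends'] := FL v'0.
set A := L v in neq t2 w2 ends; set B := F v' in neq t1 w1 ends'.
have V := dot_gt0 v0; have V' := dot_gt0 v'0.
pose a D := height v A - height v D; pose b D := height v' D - height v' A.
have a_ge0 D : perfect_matching D -> 0 <= a D by move=> pD; rewrite subr_ge0; exact: w2.2.
have aE D : a D = - pairing v (cls (chi D) - cls (chi A)).
  by rewrite pairingDr pairingNr opprB.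
have bE D : b D = pairing v' (cls (chi D) - cls (chi A)).
  by rewrite pairingDr pairingNr.
pose P D := perfect_matching D && (0 < b D).
have [/existsP [D1 PD1]|/existsPn nP] := boolP [exists D, P D]; last first.
  have wA : weak_top v' A.
    split=> [|D pD]; first exact: t2.1.
    by have := nP D; rewrite /P pD /= -leNgt subr_le0.
  case/eqP: neq; apply: (strict_cls t1 t2.1); apply/eqP; rewrite eq_sym -subr_eq0; apply/eqP.
  have hv' : pairing v' (cls (chi B) - cls (chi A)) = 0.
    by rewrite -bE /b (weak_top_eq w1 wA) subrr.
  apply: (pairing_rot0 v'0) => //.
  have hr : pairing (rot90 v') (cls (chi B) - cls (chi A)) <= 0.
    by rewrite pairingDr pairingNr subr_le0; have /andP [] := ends' A wA.
  have hv := a_ge0 B w1.1; rewrite aE in hv.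
  have := pairing_decomp v (cls (chi B) - cls (chi A)) v'; rewrite hv' mul0r addr0.
  move: hr hv; rewrite [pairing (_ - _) (rot90 v')]pairingC; set x := pairing (rot90 v') _.
  set y := pairing v _; set z := pairing v v' in vv' *.
  set V1 := pairing v' _ in V' *; move: vv' V'; clear => *; nia.
have a_gt0 D : P D -> 0 < a D.
  move=> /andP [pD bD]; rewrite lt_neqAle a_ge0 // andbT; apply/eqP => aD.
  have wD : weak_top v D.
    split=> // D' pD'; apply: le_trans (w2.2 D' pD') _.
    by rewrite -subr_le0 -/(a D) -aD.
  have hr : pairing (rot90 v) (cls (chi D) - cls (chi A)) <= 0.
    by rewrite pairingDr pairingNr subr_le0; have /andP [] := ends D wD.
  have := pairing_decomp v' (cls (chi D) - cls (chi A)) v.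
  have -> : pairing v (cls (chi D) - cls (chi A)) = 0 by rewrite -[LHS]opprK -aE -aD oppr0.
  rewrite mul0r addr0 -bE [pairing (_ - _) (rot90 v)]pairingC [pairing v' v]pairingC.
  move: hr bD; set x := pairing (rot90 v) _; set y := b D; set z := pairing v v' in vv' *.
  set V1 := pairing v _ in V *; move: vv' V; clear => *; nia.
have [D PD maxD] := sup_ratio b PD1 a_gt0; have /andP [pD bD] := PD; have aD := a_gt0 D PD.
(* [D] maximizes the ratio [b D / a D]: this [v''] is the direction in which [D]
   and [A] tie, and no matching is higher. *)
pose v'' := b D *: v + a D *: v'.
have hE D' : height v'' D' = b D * height v D' + a D * height v' D'.
  by rewrite /height /v'' pairingDl !pairingZl.
exists v''; have btw : between v v' v''.
  rewrite /between /v'' pairingDl pairingDr !pairingZl !pairingZr.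
  have -> : pairing v v = 0 by rewrite /pairing; ring.
  have -> : pairing v' v' = 0 by rewrite /pairing; ring.
  by rewrite !mulr0 addr0 add0r !mulr_gt0.
split=> //.
have v''0 : v'' != 0.
  by apply: contraTneq btw => ->; rewrite /between pairing0r ltxx.
have dE D' : height v'' D' - height v'' A = b D' * a D - b D * a D'.
  by rewrite !hE /a /b; ring.
have wA : weak_top v'' A.
  split=> [|D' pD']; first exact: t2.1.
  rewrite -subr_le0 dE subr_le0; have [PD'|nP] := boolP (P D'); first exact: maxD.
  have bD' : b D' <= 0 by rewrite leNgt; apply: contra nP => h; rewrite /P pD'.
  have := a_ge0 D' pD'; move: bD aD bD'; clear => *; nia.
have wD : weak_top v'' D.
  split=> // D' pD'; apply: le_trans (wA.2 D' pD') _.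
  by rewrite -subr_ge0 dE mulrC subrr.
apply/eqP => FLeq; have [_ _ _ _ ends''] := FL v''0; rewrite -FLeq in ends''.
have hr : height (rot90 v'') A = height (rot90 v'') D.
  have /andP [x1 x2] := ends'' A wA; have /andP [y1 y2] := ends'' D wD.
  by apply/le_anti; rewrite (le_trans x2 y1) (le_trans y2 x1).
have := cls_eq_heights v''0 (weak_top_eq wA wD) hr => h.
by move: bD; rewrite /b /height h subrr ltxx.
Qed.

Definition sector_ind v v' e : bool := dir v (zslope e) || between v v' (zslope e).

(** Induction on the number of zigzag paths with slopes strictly between [v]
    and [v']: either there is one and the sector splits, or by [gift_wrapping]
    the last end for [v] is the first end for [v']. *)
Lemma telescope v v' e : 0 < pairing v v' ->
  chi (F v) e - chi (F v') e = (on_boundary e && sector_ind v v' e)%:R -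
    (on_boundary ((sw^-1)%g e) && sector_ind v v' ((sw^-1)%g e))%:R.
Proof.
have [n] := ubnP #|[set x | between v v' (zslope x)]|; elim: n v v' => // n IH v v' ltn vv'.
have v0 : v != 0 by apply: contraTneq vv' => ->; rewrite pairing0l ltxx.
have [/existsP [x bx]|/existsPn no] := boolP [exists x, between v v' (zslope x)]; last first.
  have -> : F v' = L v.
    apply/esym/eqP; apply: contraT => /(gift_wrapping vv') [v'' [b'' ne]].
    have v''0 : v'' != 0.
      by apply: contraTneq b'' => ->; rewrite /between pairing0r ltxx.
    have [[u1 t1] [u2 t2] _ _ _] := FL v''0.
    have [y yF yL] : exists2 y, y \in F v'' & y \notin L v''.
      apply/exists_inP; apply: contraNT ne; rewrite negb_exists_in => /forall_inP sub.
      apply/eqP; apply: (strict_cls t2 t1.1); apply: eq_bigr => z _; congr (_ *: _).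
      have zero := cycle_zero t2.1 (matching_diff t2.1 t1.1); apply/eqP; rewrite -subr_eq0.
      apply/eqP/zero => {}z zL; rewrite /chi (negPf zL) subr0.
      by case: (boolP (z \in F v'')) => // /sub; rewrite zL.
    have [_ _ _ _ dy] := support_ends_zigzag v''0 (FL v''0) yF yL.
    by have := no y; rewrite (dir_between dy b'').
  by rewrite ends_diff // /sector_ind !(negPf (no _)) !orbF.
have leSn := ltn; rewrite ltnS in leSn.
set c := zslope x in bx; have /andP [vc cv'] := bx.
have xin : x \in [set x | between v v' (zslope x)] by rewrite inE.
have cc : pairing c c = 0 by rewrite /pairing; ring.
have lt1 : (#|[set x | between v c (zslope x)]| < n)%N.
  apply: leq_trans (leSn : (_ <= n)%N); apply: proper_card; apply/properP; split.
    by apply/fintype.subsetP => y; rewrite !inE; exact: between_subl.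
  by exists x => //; rewrite inE /between -/c cc ltxx andbF.
have lt2 : (#|[set x | between c v' (zslope x)]| < n)%N.
  apply: leq_trans (leSn : (_ <= n)%N); apply: proper_card; apply/properP; split.
    by apply/fintype.subsetP => y; rewrite !inE; exact: between_subr.
  by exists x => //; rewrite inE /between -/c cc ltxx.
have split_ind y b : (b && sector_ind v v' y)%:R =
    (b && sector_ind v c y)%:R + (b && sector_ind c v' y)%:R :> int.
  by case: b; rewrite /= ?addr0 // -natrD -(between_split (zslope y) bx vv').
rewrite !split_ind -(subrKA (chi (F c) e)) (IH v c lt1 vc) (IH c v' lt2 cv').
by rewrite addrACA opprD.
Qed.

Lemma closed_telescope (f0 f1 f2 f3 c1 c2 c3 c4 d1 d2 d3 d4 : int) :
  f0 - f1 = c1 - d1 -> f1 - f2 = c2 - d2 -> f2 - f3 = c3 - d3 -> f3 - f0 = c4 - d4 ->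
  d1 + d2 + d3 + d4 = c1 + c2 + c3 + c4.
Proof. by lia. Qed.

Definition ax0 : Z2 := delta_mx 0 0.
Definition ax1 : Z2 := delta_mx 0 1.

Lemma quadrants (s : Z2) : ((dir ax0 s || between ax0 ax1 s) + (dir ax1 s || between ax1 (- ax0) s) +
  (dir (- ax0) s || between (- ax0) (- ax1) s) + (dir (- ax1) s || between (- ax1) ax0 s))%N = (s != 0).
Proof.
have [->|s0] := eqVneq s 0.
  by rewrite /dir /between !pairing0r !pairing0l ltxx !andbF.
have {}s0 : ~ (s 0 0 = 0 /\ s 0 1 = 0).
  by case=> h0 h1; case/eqP: s0; apply: Z2P; rewrite mxE.
rewrite /dir /between /pairing /ax0 /ax1 !mxE /=.
rewrite !(mul0r, mulr0, mul1r, mulr1, subr0, sub0r, mulN1r, mulrN1, oppr0, opprK, mulrN, mulNr).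
move: s0; set x := s 0 0; set y := s 0 1 => s0.
by case: (ltgtP x 0) s0 => hx; case: (ltgtP y 0) => hy s0; rewrite ?oppr_eq0 ?oppr_gt0; lia.
Qed.

(** Telescoping over the four quadrants shows that [on_boundary] is invariant
    under [rotw]; it is invariant along zigzag paths too, hence constant as
    the graph is connected. *)
Lemma on_boundary_all : forall e, on_boundary e.
Proof.
have p1 : 0 < pairing ax0 ax1 by rewrite /pairing !mxE.
have p2 : 0 < pairing ax1 (- ax0) by rewrite /pairing !mxE.
have p3 : 0 < pairing (- ax0) (- ax1) by rewrite /pairing !mxE.
have p4 : 0 < pairing (- ax1) ax0 by rewrite /pairing !mxE.
have sum_sec e : (on_boundary e && sector_ind ax0 ax1 e)%:R
   + (on_boundary e && sector_ind ax1 (- ax0) e)%:R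
   + (on_boundary e && sector_ind (- ax0) (- ax1) e)%:R
   + (on_boundary e && sector_ind (- ax1) ax0 e)%:R = (on_boundary e)%:R :> int.
  have := quadrants (zslope e); rewrite -/(sector_ind _ _ _) -!/(sector_ind _ _ e).
  case: (boolP (on_boundary e)) => [/and3P [-> _ _]|_] /=; last by rewrite !addr0.
  by rewrite -!natrD => ->.
(* Over a full turn the left side of the telescoping sum vanishes. *)
have inv e : on_boundary ((sw^-1)%g e) = on_boundary e.
  have := sum_sec e; have := sum_sec ((sw^-1)%g e).
  have := telescope e p1; have := telescope e p2; have := telescope e p3; have := telescope e p4.
  set b := on_boundary e; set b' := on_boundary _ => h1 h2 h3 h4 h5 h6.
  suff : (b')%:R = b%:R :> int by case: b {h1 h2 h3 h4 h6}; case: (b').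
  by rewrite -h5 -h6; exact: closed_telescope h4 h3 h2 h1.
have invw e : on_boundary (sw e) = on_boundary e by rewrite -[in RHS](permK sw e) inv.
have zb e : on_boundary e -> on_boundary (zigzag_perm G e).
  move=> /and3P [z0 eF eL]; have [_ _ h1 h2 _] := support_ends_zigzag z0 (FL z0) eF eL.
  by rewrite /on_boundary zslope_zigzag z0 h1 h2.
have zb' e : on_boundary (zigzag_perm G e) = on_boundary e.
  apply/idP/idP; last exact: zb.
  have /porbitP [i ie] : e \in porbit (zigzag_perm G) (zigzag_perm G e).
    by rewrite porbitS porbit_id.
  by move=> h; rewrite ie permX; elim: i {ie} => //= i; exact: zb.
have invb e : on_boundary (sb e) = on_boundary e.
  by rewrite -(inv (sb e)) -(zb' ((sw^-1)%g (sb e))) permM permKV permK.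
have cst := conn_const torus invb invw.
have [e0 _|no] := pickP E; last first.
  by have := torus_area torus; rewrite big_pred0 // => e; have := no e.
move=> e; rewrite (cst e e0); apply: contraT => nb.
(* If no zigzag path bounded the polygon, it would be a point, and there would
   be only one perfect matching, which would contain every edge. *)
have FLe v : v != 0 -> F v = L v.
  move=> v0; have [[u1 t1] [u2 t2] _ _ _] := FL v0.
  apply: (strict_cls t2 t1.1); apply: eq_bigr => x _; congr (_ *: _); apply/eqP.
  by rewrite -subr_eq0 ends_diff // (cst x e0) (cst ((sw^-1)%g x) e0) (negPf nb).
have Fe v v' : 0 < pairing v v' -> F v = F v'.
  move=> vv'; have v0 : v != 0 by apply: contraTneq vv' => ->; rewrite pairing0l ltxx.
  rewrite (FLe v) //; apply/eqP; apply: contraT => /(gift_wrapping vv') [v'' [b'' ne]].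
  have v''0 : v'' != 0 by apply: contraTneq b'' => ->; rewrite /between pairing0r ltxx.
  by rewrite FLe ?eqxx in ne.
have a0 : ax0 != 0 by apply: contraTneq p1 => ->; rewrite pairing0l ltxx.
have [[u t] _ w0 _ _] := FL a0.
have top v : v \in [:: ax0; ax1; - ax0; - ax1] -> weak_top v (F ax0).
  have e1 := Fe _ _ p1; have e2 := Fe _ _ p2; have e3 := Fe _ _ p3.
  have nz v' v'' : 0 < pairing v' v'' -> v' != 0.
    by move=> h; apply: contraTneq h => ->; rewrite pairing0l ltxx.
  rewrite !inE => /or4P [] /eqP -> //.
  - by rewrite e1; have [] := FL (nz _ _ p2).
  - by rewrite e1 e2; have [] := FL (nz _ _ p3).
  - by rewrite e1 e2 e3; have [] := FL (nz _ _ p4).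
have only D : perfect_matching D -> D = F ax0.
  move=> pD; apply: (strict_cls t pD).
  have T v : v \in [:: ax0; ax1; - ax0; - ax1] -> height v D <= height v (F ax0).
    by move/top => [_]; apply.
  have := T ax0; have := T ax1; have := T (- ax0); have := T (- ax1).
  rewrite !inE !eqxx !orbT /= => /(_ isT) + /(_ isT) + /(_ isT) + /(_ isT).
  rewrite /height /pairing !mxE /= => h1 h2 h3 h4.
  by apply: Z2P; lia.
have inF x : x \in F ax0 by have [D [pD _] xD] := covered x; rewrite -(only D pD).
have [m [_ _ mU]] := matching_white t.1.
case/eqP: (rotw_neq nouni e0).
by rewrite (mU _ (inF (sw e0))) wend_rotw -(mU _ (inF e0)).
Qed.

End Ends.

(** * Existence of the ends *)

Section EndsExist.
Variable G : bicolored_graph.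
Implicit Types (D : {set edge G}) (v : Z2).

Hypothesis unique_top : forall u D, perfect_matching D ->
  (forall D', perfect_matching D' -> height u D' <= height u D /\
     (height u D' = height u D -> cls (chi D') = cls (chi D))) -> strict_top u D.

Variable D0 : {set edge G}.
Hypothesis pD0 : perfect_matching D0.

Lemma perturbation (N s x y : int) : 0 < N -> `|y| < N -> s * s = 1 ->
  N * x + s * y <= 0 -> [/\ x <= 0, x = 0 -> s * y <= 0 & N * x + s * y = 0 -> x = 0 /\ y = 0].
Proof.
move=> N0; rewrite ltr_norml => /andP [y1 y2] s2.
have [->|->] : s = 1 \/ s = -1 by nia.
  rewrite !mul1r => h; have x0 : x <= 0 by nia.
  split=> // [e|e]; first by move: h; rewrite e mulr0 add0r.
  have xz : x = 0 by nia.
  by move: e; rewrite xz mulr0 add0r.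
rewrite !mulN1r => h; have x0 : x <= 0 by nia.
split=> // [e|e]; first by move: h; rewrite e mulr0 add0r.
have xz : x = 0 by nia.
by move: e; rewrite xz mulr0 add0r => /eqP; rewrite oppr_eq0 => /eqP.
Qed.

Lemma support_end_exists v (s : int) : v != 0 -> s * s = 1 -> exists2 D : {set edge G},
  (exists u, strict_top u D) /\ weak_top v D &
  forall D', weak_top v D' -> s * height (rot90 v) D' <= s * height (rot90 v) D.
Proof.
(* Tilt [v] slightly towards [s *: rot90 v]: since [N] exceeds all differences
   of heights for [rot90 v], the matchings that are highest for [u] are highest
   for [v] and then extremal among those. *)
move=> v0 s2; pose K : int := \sum_(D : {set edge G}) `|height (rot90 v) D|.
pose N : int := 1 + 2 * K; pose u := N *: v + s *: rot90 v.
have K0 : 0 <= K by apply: sumr_ge0.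
have N0 : 0 < N by rewrite /N; lia.
have hK D : `|height (rot90 v) D| <= K.
  by rewrite /K (bigD1 D) //= lerDl; apply: sumr_ge0.
have hN D D' : `|height (rot90 v) D' - height (rot90 v) D| < N.
  apply: le_lt_trans (ler_normB _ _) _; have := hK D; have := hK D'.
  rewrite /N; set a := `|_|; set b := `|_|; lia.
have hu D D' : height u D' - height u D =
    N * (height v D' - height v D) + s * (height (rot90 v) D' - height (rot90 v) D).
  by rewrite /height /u !pairingDl !pairingZl; ring.
case: (@Order.TotalTheory.arg_maxP _ _ _ D0 (@perfect_matching G) (height u) pD0) => D pD maxD.
have pert D' : perfect_matching D' -> _ := fun pD' =>
  perturbation N0 (hN D D') s2 (etrans (congr1 (fun z => z <= 0) (esym (hu D D')))
     (etrans (subr_le0 _ _) (maxD D' pD'))).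
have wD : weak_top v D.
  by split=> // D' /pert [+ _ _]; rewrite subr_le0.
exists D.
  split=> //; exists u; apply: unique_top => // D' pD'; split; first exact: maxD.
  move=> e; have [_ _ h] := pert D' pD'.
  have /h [/eqP + /eqP] : N * (height v D' - height v D) +
      s * (height (rot90 v) D' - height (rot90 v) D) = 0 by rewrite -hu e subrr.
  by rewrite !subr_eq0 => /eqP h1 /eqP h2; apply: cls_eq_heights h2.
move=> D' wD'; have [_ + _] := pert D' wD'.1.
by rewrite (weak_top_eq wD' wD) subrr mulrBr subr_le0; apply.
Qed.

Lemma support_ends_exist : exists F L : Z2 -> {set edge G},
  forall v, v != 0 -> support_ends v (F v) (L v).
Proof.
have H v : exists p : {set edge G} * {set edge G}, v != 0 -> support_ends v p.1 p.2.
  have [->|v0] := eqVneq v 0; first by exists (D0, D0).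
  have [D [sD wD] mD] := @support_end_exists v (-1) v0 (erefl _).
  have [D' [sD' wD'] mD'] := @support_end_exists v 1 v0 (erefl _).
  exists (D, D') => _; split=> // D'' w''.
  by have := mD D'' w''; have := mD' D'' w''; rewrite !mul1r !mulN1r lerN2 => -> ->.
have [f fP] := choice H.
by exists (fun v => (f v).1), (fun v => (f v).2).
Qed.

End EndsExist.

(** * All zigzag paths bound the polygon *)

Section BoundaryClasses.
Variable G : bicolored_graph.
Local Notation E := (edge G).
Local Notation sw := (rotw G).
Local Notation sb := (rotb G).
Implicit Types (e : E) (D : {set E}) (v : Z2).

Hypothesis torus : torus_graph G.
Hypothesis nouni : no_univalent_node G.
Hypothesis covered : forall e, exists2 D : {set E}, rigid D & e \in D.
Variables (F L : Z2 -> {set E}).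
Hypothesis FL : forall v, v != 0 -> support_ends v (F v) (L v).

Let onb := on_boundary_all torus nouni covered FL.

Lemma zslope_neq0 e : zslope e != 0.
Proof. by have /and3P [] := onb e. Qed.

Lemma chi_to_cls D D' (P : pred E) :
  (forall e, chi D e - chi D' e = (P e)%:R - (P ((sw^-1)%g e))%:R) ->
  cls (chi D) - cls (chi D') = \sum_(e | P e) (disp e - disp (sw e)).
Proof.
move=> h; rewrite /cls -sumrB; under eq_bigr do rewrite -scalerBl h scalerBl.
rewrite sumrB -(sum_perm sw (fun x => (P ((sw^-1)%g x))%:R *: disp x)) -sumrB.
rewrite [RHS]big_mkcond; apply: eq_bigr => x _; rewrite permK -scalerBr.
by case: (P x); rewrite ?scale1r ?scale0r.
Qed.

Lemma cls_ends v : v != 0 -> cls (chi (F v)) - cls (chi (L v)) =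
  \sum_(e | dir v (zslope e)) (disp e - disp (sw e)).
Proof.
move=> v0; apply: chi_to_cls => e.
by rewrite (ends_diff torus nouni covered FL e v0) !onb.
Qed.

Lemma cls_telescope v v' : 0 < pairing v v' -> cls (chi (F v)) - cls (chi (F v')) =
  \sum_(e | sector_ind v v' e) (disp e - disp (sw e)).
Proof.
move=> vv'; apply: chi_to_cls => e.
by rewrite (telescope torus nouni covered FL e vv') !onb.
Qed.

(** The polygon is not flat. *)
Lemma slopes_not_parallel : exists e e', pairing (zslope e) (zslope e') != 0.
Proof.
have [/existsP [e /existsP [e' h]]|/existsPn no] :=
  boolP [exists e : E, [exists e' : E, pairing (zslope e) (zslope e') != 0]].
  by exists e, e'.
exfalso; have [e0 _|no0] := pickP E; last first.
  by have := torus_area torus; rewrite big_pred0 // => e; have := no0 e.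
set a := zslope e0; have a0 : a != 0 := zslope_neq0 e0.
have pa e : pairing a (zslope e) = 0.
  by have /existsPn /(_ e) := no e0; rewrite negbK => /eqP.
have V := dot_gt0 a0; have ra0 : rot90 a != 0.
  by apply: contraTneq V => ->; rewrite pairing0r ltxx.
have na0 : - a != 0 by rewrite oppr_eq0.
have h1 e : chi (F a) e - chi (F (rot90 a)) e = chi (F a) e - chi (L a) e.
  rewrite (telescope torus nouni covered FL e V) (ends_diff torus nouni covered FL e a0) !onb.
  by rewrite /sector_ind /between !pa ltxx !orbF.
have V' : 0 < pairing (rot90 a) (- a) by rewrite pairingNr pairingC opprK.
have h2 e : chi (F (rot90 a)) e - chi (F (- a)) e = 0.
  rewrite (telescope torus nouni covered FL e V') !onb.
  have z e' : sector_ind (rot90 a) (- a) e' = false.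
    rewrite /sector_ind /between pairingNr [pairing (zslope e') a]pairingC pa !oppr0 ltxx andbF orbF.
    apply/negbTE/negP => /dirP [h _]; case/eqP: (zslope_neq0 e').
    exact: (pairing_rot0 a0).
  by rewrite !z subrr.
(* If all zigzag paths were parallel to [a], the two matchings [F a] and [L a]
   would cover all edges, and there would be no more edges than nodes. *)
have cover e : 1 <= chi (F a) e + chi (L a) e.
  have [d|d] := boolP (dir a (zslope e)).
    have := on_boundaryE torus nouni covered FL e a0; rewrite onb d => /andP [eF _].
    by rewrite /chi eF; case: (_ \in _).
  have d' : dir (- a) (zslope e).
    apply/dirP; split; first by rewrite pairingNl pa oppr0.
    have -> : rot90 (- a) = - rot90 a by apply: Z2P; rewrite !mxE.
    rewrite pairingNr oppr_gt0 lt_neqAle; apply/andP; split; last first.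
      by rewrite leNgt; apply: contra d => h; rewrite /dir pa eqxx.
    apply/eqP => h; case/eqP: (zslope_neq0 e); apply: (pairing_rot0 a0) => //.
    by rewrite pairingC h oppr0.
  have := on_boundaryE torus nouni covered FL e na0; rewrite onb d' => /andP [eF _].
  have := h1 e; have := h2 e; rewrite /chi eF.
  case: (e \in F (rot90 a)) => //; case: (e \in L a) => //; by case: (e \in F a).
have [[u1 t1] [u2 t2] _ _ _] := FL a0.
have := torus_euler torus.
have : (#|E|%:R : int) <= #|black G|%:R + #|white G|%:R.
  rewrite -(sum_chi_black t1.1) -(sum_chi_white t2.1) -big_split /= -sum1_card natr_sum.
  exact: ler_sum.
have : (0 < #|porbits (face_perm G)|)%N.
  by apply/card_gt0P; exists (porbit (face_perm G) e0); exact: imset_f.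
by clear; lia.
Qed.

End BoundaryClasses.

(** * Comparison of arguments *)

Lemma upperP (v : Z2) : reflect (0 < v 0 1 \/ v 0 1 = 0 /\ 0 < v 0 0) (upper v).
Proof.
rewrite /upper; apply: (iffP orP) => -[h|h]; try by left.
  by right; case/andP: h => /eqP.
by right; case: h => -> ->; rewrite eqxx.
Qed.

Lemma lowerP (v : Z2) : v != 0 -> reflect (v 0 1 < 0 \/ v 0 1 = 0 /\ v 0 0 < 0) (~~ upper v).
Proof.
move=> v0; apply: (iffP negP) => [nu|h /upperP hu]; last by lia.
have [h|h|h] := ltgtP (v 0 1) 0; first by left.
  by case: nu; apply/upperP; left.
right; split=> //; have [//|h'|h'] := ltgtP (v 0 0) 0.
  by case: nu; apply/upperP; right.
by case/eqP: v0; apply: Z2P; rewrite mxE.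
Qed.

Lemma upper_trans (a b c : Z2) : upper a -> upper b -> upper c ->
  0 <= pairing a b -> 0 <= pairing b c -> 0 <= pairing a c.
Proof.
move=> /upperP ua /upperP ub /upperP uc; rewrite /pairing.
move: ua ub uc; set a0 := a 0 0; set a1 := a 0 1; set b0 := b 0 0; set b1 := b 0 1.
set c0 := c 0 0; set c1 := c 0 1 => ua ub uc h1 h2.
have id : b1 * (a0 * c1 - a1 * c0) = (a0 * b1 - a1 * b0) * c1 + (b0 * c1 - b1 * c0) * a1 by ring.
have c1_ge0 : 0 <= c1 by lia.
have a1_ge0 : 0 <= a1 by lia.
case: ub => [b1_gt0|[b1_0 b0_gt0]].
  rewrite -(pmulr_rge0 _ b1_gt0) id addr_ge0 // mulr_ge0 //.
have a1_0 : a1 = 0.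
  by move: h1; rewrite b1_0 mulr0 sub0r oppr_ge0 pmulr_lle0 // => h; apply/le_anti; rewrite h.
rewrite a1_0 mul0r subr0 mulr_ge0 //; lia.
Qed.

Lemma upperN (v : Z2) : v != 0 -> upper (- v) = ~~ upper v.
Proof.
move=> v0; apply/upperP/(lowerP v0).
  rewrite !mxE !oppr_gt0 => -[h|[/eqP]]; first by left.
  by rewrite oppr_eq0 => /eqP h h'; right.
rewrite !mxE !oppr_gt0 => -[h|[/eqP h h']]; first by left.
by right; split=> //; apply/eqP; rewrite oppr_eq0.
Qed.

Lemma arg_le_trans : {in [pred v : Z2 | v != 0] & &, transitive arg_le}.
Proof.
move=> b a c b0 a0 c0; rewrite !inE in b0 a0 c0; rewrite /arg_le.
have lw x y z : x != 0 -> y != 0 -> z != 0 -> ~~ upper x -> ~~ upper y -> ~~ upper z ->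
    0 <= pairing x y -> 0 <= pairing y z -> 0 <= pairing x z.
  move=> x0 y0 z0; rewrite -!upperN // => ux uy uz.
  by have := upper_trans ux uy uz; rewrite !pairingNl !pairingNr !opprK.
case ua: (upper a); case ub: (upper b); case uc: (upper c) => //=.
  by apply: upper_trans.
by apply: lw; rewrite ?ua ?ub ?uc.
Qed.

Lemma arg_le_antisym (v s : Z2) : v != 0 -> s != 0 -> arg_le v s -> arg_le s v -> dir v s.
Proof.
move=> v0 s0; rewrite /arg_le [upper s == _]eq_sym; case: eqP => [us|]; last first.
  by case: (upper v); case: (upper s).
rewrite [pairing s v]pairingC => h1 h2; have h : pairing v s = 0 by lia.
rewrite /dir h eqxx /=.
have : s 0 0 * v 0 1 = s 0 1 * v 0 0 by move: h; rewrite /pairing; lia.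
rewrite /pairing !mxE /=; have [uv|uv] := boolP (upper v).
  have us' : upper s by rewrite -us.
  by move/upperP: uv => uv; move/upperP: us' => us'; nia.
have us' : ~~ upper s by rewrite -us.
by move/(lowerP v0): uv => uv; move/(lowerP s0): us' => us'; nia.
Qed.

Lemma dir_arg_le (v s : Z2) : dir v s -> arg_le v s.
Proof.
move=> vs; have v0 := dir_neq0l vs; have s0 := dir_neq0 vs; have /dirP [h1 h2] := vs.
rewrite /arg_le h1 lexx; case: eqP => // us; move: h1 h2; rewrite /pairing !mxE /=.
case uv : (upper v) us => us //; last first.
  have us' : upper s by case: (upper s) us.
  by move/negbT/(lowerP v0): uv => uv; move/upperP: us' => us'; nia.
Qed.

Definition arg_lt (s v : Z2) := arg_le s v && ~~ arg_le v s.

(** The directions of argument smaller than that of [v] are the sector from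
    the first axis to [v]; it has to be cut into sectors smaller than half a
    turn, according to the position of [v]. *)
Lemma arg_lt_upper (v s : Z2) : s != 0 -> 0 < v 0 1 ->
  arg_lt s v = dir ax0 s || between ax0 v s.
Proof.
move=> s0 v1; have uv : upper v by apply/upperP; left.
rewrite /arg_lt /arg_le uv eqb_id [true == _]eq_sym eqb_id.
rewrite /dir /between /pairing /ax0 !mxE /=.
rewrite !(mul0r, mulr0, mul1r, mulr1, subr0, sub0r, mulN1r, mulrN1, oppr0, opprK, mulrN, mulNr).
have [us|us] := boolP (upper s) => /=.
  move/upperP: us; move: v1 {uv}; move: (s 0 0) (s 0 1) (v 0 0) (v 0 1) => x y p q v1.
  move=> us; apply/andP/orP => [[h1 h2]|].
    have [h|h] := ltP 0 y; first by right; apply/andP; split=> //; lia.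
    by left; apply/andP; split; [apply/eqP|]; lia.
  by case=> /andP [] => [/eqP h1 h2|h1 h2]; split; nia.
move/(lowerP s0): us; set x := s 0 0; set y := s 0 1 => us.
by symmetry; apply/negbTE; rewrite negb_or !negb_and -!leNgt; lia.
Qed.

Lemma arg_lt_ray (v s : Z2) : s != 0 -> dir ax0 v -> arg_lt s v = false.
Proof.
move=> s0 dv; apply/negbTE; rewrite negb_and negbK; apply/orP.
have [//|h] := boolP (arg_le v s); [by right|left].
move: dv h; rewrite /dir /arg_le /pairing /ax0 !mxE /=.
rewrite !(mul0r, mulr0, mul1r, mulr1, subr0, sub0r, mulN1r, mulrN1, oppr0, opprK, mulrN, mulNr).
move=> /andP [/eqP v1 v0]; have uv : upper v by apply/upperP; right.
rewrite uv; case: eqP => [us|us] //; rewrite -us.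
have /upperP us' : upper s by rewrite -us.
by rewrite v1 eqxx mul0r subr0 ; nia.
Qed.

Lemma arg_lt_lower (v s : Z2) : s != 0 -> v 0 1 < 0 -> (arg_lt s v : nat) =
  ((dir ax0 s || between ax0 ax1 s) + (dir ax1 s || between ax1 (- ax0) s) +
   (dir (- ax0) s || between (- ax0) v s))%N.
Proof.
move=> s0 v1; have v0 : v != 0 by apply: contraTneq v1 => ->; rewrite mxE.
have uv : upper v = false by apply/negbTE/(lowerP v0); left.
rewrite /arg_lt /arg_le uv eqbF_neg [false == _]eq_sym eqbF_neg.
rewrite /dir /between /pairing /ax0 /ax1 !mxE /=.
rewrite !(mul0r, mulr0, mul1r, mulr1, subr0, sub0r, mulN1r, mulrN1, oppr0, opprK, mulrN, mulNr).
have [us|us] := boolP (upper s) => /=.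
  move/upperP: us; move: v1 {uv}; move: (s 0 0) (s 0 1) (v 0 0) (v 0 1) => x y p q v1.
  by case: (ltgtP x 0) => hx; case: (ltgtP y 0) => hy us; rewrite ?oppr_eq0 ?oppr_gt0; lia.
move/(lowerP s0): us; set x := s 0 0; set y := s 0 1; set p := v 0 0; set q := v 0 1 in v1 *.
move=> us; have -> : 0 <= p * y - q * x = ~~ (0 < x * q - y * p) by rewrite -leNgt; apply/idP/idP; lia.
rewrite negbK; have [h|h] := ltP 0 (x * q - y * p).
  by case: (ltgtP x 0) us => hx; case: (ltgtP y 0) => hy us; rewrite ?oppr_eq0 ?oppr_gt0; nia.
by case: (ltgtP x 0) us => hx; case: (ltgtP y 0) => hy us; rewrite ?oppr_eq0 ?oppr_gt0; nia.
Qed.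

Lemma arg_lt_opposite (v s : Z2) : s != 0 -> dir (- ax0) v -> (arg_lt s v : nat) =
  ((dir ax0 s || between ax0 ax1 s) + (dir ax1 s || between ax1 (- ax0) s))%N.
Proof.
move=> s0 dv; have v0 := dir_neq0 dv.
move: dv; rewrite /dir /pairing /ax0 !mxE /=.
rewrite !(mul0r, mulr0, mul1r, mulr1, subr0, sub0r, mulN1r, mulrN1, oppr0, opprK, mulrN, mulNr).
move=> /andP [/eqP v1 vneg].
have {}v1 : v 0 1 = 0 by move: v1; lia.
have {}vneg : v 0 0 < 0 by move: vneg; lia.
have uv : upper v = false by apply/negbTE/(lowerP v0); right.
rewrite /arg_lt /arg_le uv eqbF_neg [false == _]eq_sym eqbF_neg.
rewrite /dir /between /pairing /ax0 /ax1 !mxE /=.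
rewrite !(mul0r, mulr0, mul1r, mulr1, subr0, sub0r, mulN1r, mulrN1, oppr0, opprK, mulrN, mulNr).
rewrite v1 !(mul0r, mulr0, subr0, sub0r).
have [us|us] := boolP (upper s) => /=.
  move/upperP: us; move: (s 0 0) (s 0 1) => x y.
  by case: (ltgtP x 0) => hx; case: (ltgtP y 0) => hy us; rewrite ?oppr_eq0 ?oppr_gt0; lia.
move/(lowerP s0): us; move: vneg; move: (s 0 0) (s 0 1) (v 0 0) => x y p p0.
by case: (ltgtP x 0) => hx; case: (ltgtP y 0) => hy us; rewrite ?oppr_eq0 ?oppr_gt0; nia.
Qed.

Section Cumulative.
Variable G : bicolored_graph.
Local Notation E := (edge G).
Implicit Types (e : E) (v : Z2).

Hypothesis torus : torus_graph G.
Hypothesis nouni : no_univalent_node G.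
Hypothesis covered : forall e, exists2 D : {set E}, rigid D & e \in D.
Variables (F L : Z2 -> {set E}).
Hypothesis FL : forall v, v != 0 -> support_ends v (F v) (L v).

(** The zigzag paths with slopes of argument smaller than that of [v] sweep
    the boundary of the polygon from its start [F ax0] to the side with normal
    [v]. *)
Lemma sum_smaller_slopes v : v != 0 ->
  \sum_(e | arg_lt (zslope e) v) (disp e - disp (rotw G e)) =
  cls (chi (F ax0)) - cls (chi (F v)).
Proof.
have z0 := zslope_neq0 torus nouni covered FL.
have tel := cls_telescope torus nouni covered FL.
have F_dir a : dir a v -> F a = F v.
  by move=> av; have [] := ends_dir FL av.
pose s (P : pred E) : Z2 := \sum_e (disp e - disp (rotw G e)) *+ P e.
have sE (P : pred E) : \sum_(e | P e) (disp e - disp (rotw G e)) = s P.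
  by rewrite big_mkcond; apply: eq_bigr => e _; rewrite mulrb.
have p1 : 0 < pairing ax0 ax1 by rewrite /pairing !mxE.
have p2 : 0 < pairing ax1 (- ax0) by rewrite /pairing !mxE.
move=> v0; rewrite sE; have [v1|v1|v1] := ltgtP (v 0 1) 0.
- have p3 : 0 < pairing (- ax0) v by rewrite /pairing !mxE /=; lia.
  rewrite -(subrKA (cls (chi (F (- ax0))))) -[_ - cls (chi (F (- ax0)))](subrKA (cls (chi (F ax1)))).
  rewrite !tel // !sE /s -!big_split; apply: eq_bigr => e _.
  by rewrite (arg_lt_lower (z0 e) v1) !mulrnDr.
- have p3 : 0 < pairing ax0 v by rewrite /pairing !mxE /=; lia.
  rewrite !tel // !sE /s; apply: eq_bigr => e _.
  by rewrite (arg_lt_upper (z0 e) v1).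
have v00 : v 0 0 != 0.
  by apply: contraNneq v0 => h; apply/eqP/Z2P; rewrite mxE.
have [h|h] := ltP 0 (v 0 0).
  have dv : dir ax0 v by rewrite /dir /pairing /ax0 !mxE /= v1; lia.
  by rewrite -(F_dir _ dv) subrr /s big1 // => e _; rewrite (arg_lt_ray (z0 e) dv).
have dv : dir (- ax0) v by rewrite /dir /pairing /ax0 !mxE /= v1; lia.
rewrite -(F_dir _ dv) -(subrKA (cls (chi (F ax1)))) !tel // !sE /s -big_split.
by apply: eq_bigr => e _; rewrite (arg_lt_opposite (z0 e) dv) mulrnDr.
Qed.

End Cumulative.

(** * Sums of slopes along a cyclically sorted sequence *)

Definition psum (T : seq Z2) i : Z2 := \sum_(v <- take i T) v.

Lemma psum0 (T : seq Z2) : psum T 0 = 0.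
Proof. by rewrite /psum take0 big_nil. Qed.

Lemma psum_size (T : seq Z2) : psum T (size T) = \sum_(v <- T) v.
Proof. by rewrite /psum take_size. Qed.

Lemma psumS (T : seq Z2) i : (i < size T)%N -> psum T i.+1 = psum T i + T`_i.
Proof.
by move=> h; rewrite /psum (take_nth 0 h) -cats1 big_cat big_seq1.
Qed.

Lemma sum_drop n (T : seq Z2) : \sum_(v <- T) v = 0 ->
  \sum_(v <- drop n T) v = - psum T n.
Proof.
by rewrite -{1}(cat_take_drop n T) big_cat /= addrC => /eqP; rewrite addr_eq0 => /eqP.
Qed.

(** Rotating a sequence of sum zero translates its partial sums. *)
Lemma psum_rot n (T : seq Z2) i : \sum_(v <- T) v = 0 -> (n <= size T)%N -> (i <= size T)%N ->
  exists2 j, (j <= size T)%N & psum T i = psum (rot n T) j + psum T n.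
Proof.
move=> T0 nk ik; have [in_|ni] := leqP i n.
  exists (size (drop n T) + i)%N; first by rewrite size_drop; lia.
  rewrite {2}/psum /rot take_cat ltnNge leq_addr /= addKn take_takel // big_cat /=.
  by rewrite sum_drop // addrAC addNr add0r.
exists (i - n)%N; first by lia.
rewrite {2}/psum /rot take_cat size_drop; have [h|h] := ltnP.
  by rewrite addrC /psum -big_cat /= -takeD subnKC // ltnW.
have -> : i = size T by lia.
by rewrite psum_size T0 subnn take0 cats0 sum_drop // addNr.
Qed.

Lemma psum_rotP n (T : seq Z2) (x : Z2) : \sum_(v <- T) v = 0 -> (n <= size T)%N ->
  (exists2 i, (i <= size T)%N & x = psum T i) <->
  exists2 j, (j <= size T)%N & x = psum (rot n T) j + psum T n.
Proof.
move=> T0 nk; split=> -[i ik ->].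
  by have [j jk ->] := psum_rot T0 nk ik; exists j.
have R0 : \sum_(v <- rot n T) v = 0 by rewrite (perm_big T) // perm_rot.
have [||j jk ->] := @psum_rot (size T - n)%N _ i R0; rewrite ?size_rot ?leq_subr //.
have -> : rot (size T - n) (rot n T) = T by rewrite -{1}(size_rot n) -/(rotr n _) rotK.
exists j; first by rewrite size_rot in jk.
rewrite -addrA -[RHS]addr0; congr (_ + _).
by rewrite {1}/psum /rot take_size_cat ?size_drop // sum_drop // addNr.
Qed.

Lemma scanl_psum (T : seq Z2) (x : Z2) : \sum_(v <- T) v = 0 -> (0 < size T)%N ->
  x \in scanl +%R 0 [seq rot90 v | v <- T] <-> exists2 i, (i <= size T)%N & x = rot90 (psum T i).
Proof.
move=> T0 k0.
have r0 : rot90 0 = 0 by apply: Z2P; rewrite !mxE ?oppr0.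
have rD : {morph rot90 : u v / u + v} by move=> u v; apply: Z2P; rewrite !mxE //= opprD.
have rs i : foldl +%R 0 (take i [seq rot90 v | v <- T]) = rot90 (psum T i).
  rewrite -map_take /psum; elim/last_ind: (take i T) => [|s v IH]; first by rewrite !big_nil r0.
  by rewrite map_rcons foldl_rcons IH big_rcons rD.
split=> [/(nthP 0) [i]|[i ik ->]].
  rewrite size_scanl size_map => ik <-; exists i.+1 => //.
  by rewrite nth_scanl ?size_map // rs.
have [i' i'k ->] : exists2 i', (i' < size T)%N & psum T i = psum T i'.+1.
  case: i ik => [|i] ik; last by exists i.
  by exists (size T).-1; rewrite prednK // psum0 psum_size.
by apply/(nthP 0); exists i'; rewrite ?size_scanl ?size_map // nth_scanl ?size_map // rs.
Qed.

(** Before its [i]-th term, a sorted sequence has all the terms of smaller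
    argument, and some of those of equal argument. *)
Lemma sorted_prefix (T : seq Z2) i : {in T, forall v, v != 0} -> sorted arg_le T ->
  (i < size T)%N ->
  psum T i = \sum_(s <- T | arg_lt s T`_i) s + \sum_(s <- take i T | dir T`_i s) s.
Proof.
move=> nz sT ik; set v := T`_i.
have arefl : {in [pred v : Z2 | v != 0], reflexive arg_le}.
  by move=> x _; rewrite /arg_le eqxx /pairing mulrC subrr.
have le := sorted_leq_nth_in arg_le_trans arefl 0 (introT allP nz) sT.
have v0 : v != 0 by apply: nz; exact: mem_nth.
have lo s : s \in take i T -> s != 0 /\ arg_le s v.
  move=> /(nthP 0) [j]; rewrite size_takel ?(ltnW ik) // => ji <-.
  rewrite nth_take //; have jk := ltn_trans ji ik; split; first exact/nz/mem_nth.
  by apply: le; rewrite ?inE // ltnW.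
have hi s : s \in drop i T -> arg_lt s v = false.
  move=> /(nthP 0) [j]; rewrite size_drop => ji <-.
  rewrite nth_drop /arg_lt (_ : arg_le v _) ?andbF //.
  by apply: le; rewrite ?inE ?leq_addr // -?topredE /=; move: ji ik; rewrite ltn_subRL.
have -> : \sum_(s <- T | arg_lt s v) s = \sum_(s <- take i T | arg_lt s v) s.
  rewrite -[in LHS](cat_take_drop i T) big_cat /= [X in _ + X]big1_seq ?addr0 // => s.
  by move=> /andP [+ /hi]; move=> ->.
rewrite /psum (bigID (arg_lt ^~ v)) /=; congr (_ + _).
rewrite [RHS]big_seq_cond [LHS]big_seq_cond.
apply: eq_bigl => s; case si: (s \in take i T) => //=.
have [s0 sv] := lo s si; rewrite /arg_lt sv /= negbK.
by apply/idP/idP => [h|]; [exact: arg_le_antisym|exact: dir_arg_le].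
Qed.

Lemma sign_change (f : nat -> int) a b : (a <= b)%N -> 0 <= f a -> f b < 0 ->
  exists j, [/\ (j < b)%N, 0 <= f j & f j.+1 < 0].
Proof.
move=> ab fa; elim: b ab => [|b IH] ab fb.
  by move: ab fa; rewrite leqn0 => /eqP ->; rewrite leNgt fb.
have [h|h] := ltP (f b) 0; last by exists b.
have ab' : (a <= b)%N.
  by move: ab; rewrite leq_eqVlt => /orP [/eqP e|//]; move: fa; rewrite e leNgt fb.
by have [j [jb h1 h2]] := IH ab' h; exists j; split=> //; exact: ltnW.
Qed.

(** A closed polygonal line that turns counterclockwise around the origin, and
    is not contained in a line through it, has the origin in its convex hull.
    Following the line from a vertex [z i], one passes at some point, between
    two successive vertices [z j] and [z j.+1], from the left to the right of
    the line through [z i] and the origin, and the ray opposite to [z i] meets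
    this segment. *)
Lemma origin_in_triangle (z : nat -> Z2) k : z k = z 0%N ->
  (forall i, (i < k)%N -> 0 <= pairing (z i) (z i.+1)) ->
  (exists i j, [/\ (i <= k)%N, (j <= k)%N & pairing (z i) (z j) != 0]) ->
  exists i j l (a b c : int), [/\ [/\ (i <= k)%N, (j <= k)%N & (l <= k)%N],
    [/\ 0 <= a, 0 <= b, 0 <= c & 0 < a + b + c] &
    a *: z i + b *: z j + c *: z l = 0].
Proof.
move=> zk ccw [i0 [j0 [i0k j0k]]]; wlog neg : i0 j0 i0k j0k / pairing (z i0) (z j0) < 0.
  move=> H nz; case: (ltgtP (pairing (z i0) (z j0)) 0) => h.
  - exact: (H i0 j0).
  - apply: (H j0 i0) => //; first by rewrite pairingC oppr_lt0.
    by rewrite pairingC oppr_eq0.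
  - by rewrite h eqxx in nz.
move=> _; pose f j := pairing (z i0) (z j).
have f0 : f i0 = 0 by rewrite /f /pairing mulrC subrr.
have [j [jk fj fj1]] : exists j, [/\ (j < k)%N, 0 <= f j & f j.+1 < 0].
  have [h|h] := leqP i0 j0.
    have [|j [jj h1 h2]] := @sign_change f _ _ h _ neg; first by rewrite f0.
    by exists j; split=> //; exact: leq_trans jj j0k.
  have [f0ge|f0lt] := leP 0 (f 0%N).
    have [j [jj h1 h2]] := @sign_change f _ _ (leq0n j0) f0ge neg.
    by exists j; split=> //; exact: leq_trans jj j0k.
  have fk : f k < 0 by rewrite /f zk.
  by have [|j [jj h1 h2]] := @sign_change f _ _ i0k _ fk; [rewrite f0|exists j].
exists i0, j, j.+1, (pairing (z j) (z j.+1)), (- f j.+1), (f j); split.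
- by split=> //; exact: ltnW.
- by have := ccw j jk; split=> //; lia.
by apply: Z2P; rewrite /f /pairing !mxE; ring.
Qed.

(** * The boundary points *)

Section SlopeSequence.
Variable G : bicolored_graph.
Local Notation E := (edge G).
Implicit Types (e : E) (v : Z2) (D : {set E}).

Lemma sum_slopes (P : pred Z2) : \sum_(z in zigzags G | P (slope z)) slope z =
  \sum_(e | P (zslope e)) (disp e - disp (rotw G e)).
Proof.
rewrite [RHS](partition_big (porbit (zigzag_perm G)) (mem (zigzags G))) /= => [|e _]; last exact: imset_f.
rewrite [LHS]big_mkcondr; apply: eq_bigr => z /imsetP [y _ ->].
have eqz x : (porbit (zigzag_perm G) x == porbit (zigzag_perm G) y) = (x \in porbit (zigzag_perm G) y).
  by rewrite eq_porbit_mem porbit_sym.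
have [Pz|nPz] := boolP (P _).
  apply: eq_bigl => x; rewrite -eqz andbC; case: eqP => // h.
  by rewrite /zslope h Pz.
rewrite big_pred0 // => x; rewrite andbC; case: eqP => // h.
by rewrite /zslope h (negPf nPz).
Qed.

Lemma sum_all_slopes : \sum_(z in zigzags G) slope z = 0.
Proof.
have := sum_slopes predT; rewrite /= sumrB -(sum_perm (rotw G) (@disp G)) subrr => h.
by rewrite -[RHS]h; apply: eq_bigl => z; rewrite andbT.
Qed.

Hypothesis torus : torus_graph G.
Hypothesis nouni : no_univalent_node G.
Hypothesis covered : forall e, exists2 D : {set E}, rigid D & e \in D.
Variables (F L : Z2 -> {set E}).
Hypothesis FL : forall v, v != 0 -> support_ends v (F v) (L v).
Variable T : seq Z2.
Hypothesis T_slopes : perm_eq T [seq slope z | z <- enum (zigzags G)].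
Hypothesis T_sorted : sorted arg_le T.

Lemma sum_T (P : pred Z2) : \sum_(s <- T | P s) s =
  \sum_(e | P (zslope e)) (disp e - disp (rotw G e)).
Proof.
by rewrite (perm_big _ T_slopes) /= big_map big_enum_cond -sum_slopes.
Qed.

Lemma mem_T v : (v \in T) = [exists e : E, v == zslope e].
Proof.
rewrite (perm_mem T_slopes); apply/mapP/existsP => [[z]|[e /eqP ->]].
  by rewrite mem_enum => /imsetP [e _ ->] ->; exists e.
by exists (porbit (zigzag_perm G) e); rewrite ?mem_enum //; exact: imset_f.
Qed.

Lemma T_neq0 : {in T, forall v, v != 0}.
Proof.
move=> v; rewrite mem_T => /existsP [e /eqP ->].
exact: (zslope_neq0 torus nouni covered FL).
Qed.

(** The vertices of the zigzag polygon, seen in the plane of homology classes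
    and placed so as to start at the class of [F ax0]. *)
Definition boundary_point i : Z2 := cls (chi (F ax0)) - psum T i.

Lemma boundary_pointS i : (i < size T)%N ->
  boundary_point i - boundary_point i.+1 = T`_i.
Proof. by move=> ik; rewrite /boundary_point psumS //; apply: Z2P; rewrite !mxE; ring. Qed.

(** The terms of argument smaller than that of [v] lead from [F ax0] to [F v]
    by [sum_smaller_slopes]; the remaining ones are part of those that lead
    from [F v] to [L v], all of them positive multiples of [v]. *)
Lemma boundary_point_on_edge i (v := T`_i) : (i < size T)%N ->
  pairing v (boundary_point i) = height v (F v) /\
  exists m N : int, [/\ 0 <= m <= N, 0 < N & N *: boundary_point i =
     m *: cls (chi (L v)) + (N - m) *: cls (chi (F v))].
Proof.
move=> ik; have vT : v \in T by exact: mem_nth.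
have v0 := T_neq0 vT; have V := dot_gt0 v0.
set x := \sum_(s <- take i T | dir v s) s.
have bp : boundary_point i = cls (chi (F v)) - x.
  rewrite /boundary_point (sorted_prefix T_neq0 T_sorted ik) -/v sum_T.
  rewrite (sum_smaller_slopes torus nouni covered FL v0) -/x; apply/eqP.
  by rewrite -subr_eq0; apply/eqP; apply: Z2P; rewrite !mxE; ring.
set d := cls (chi (F v)) - cls (chi (L v)).
have dE : d = \sum_(s <- T | dir v s) s.
  by rewrite sum_T /d (cls_ends torus nouni covered FL v0).
have px : pairing v x = 0.
  by rewrite pairing_sumr big1_seq // => s /andP [/dirP []].
have pd : pairing v d = 0.
  by rewrite dE pairing_sumr big1_seq // => s /andP [/dirP []].
pose m := pairing x (rot90 v); pose N := pairing d (rot90 v).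
have split_d : N = m + \sum_(s <- drop i T | dir v s) pairing s (rot90 v).
  rewrite /N /m dE -{1}(cat_take_drop i T) big_cat /= pairingDl; congr (_ + _).
  by rewrite pairing_suml.
have m0 : 0 <= m.
  by rewrite /m /x pairing_suml; apply: sumr_ge0 => s /dirP [_ /ltW].
have r0 : 0 < \sum_(s <- drop i T | dir v s) pairing s (rot90 v).
  rewrite (drop_nth 0 ik) big_cons -/v.
  have -> : dir v v by apply/dirP; split=> //; rewrite /pairing mulrC subrr.
  apply: ltr_pwDl => //; apply: sumr_ge0 => s /dirP [_ /ltW] //.
split.
  by rewrite bp pairingDr pairingNr px subr0.
exists m, N; split; [by rewrite m0 split_d lerDl ltW|by rewrite split_d ltr_wpDl|].
(* Both are multiples of [v], of lengths [m] and [N]. *)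
have key : N *: x = m *: d.
  apply/eqP; rewrite -subr_eq0; apply/eqP; apply: (pairing_rot0 v0).
    by rewrite pairingDr pairingNr !pairingZr px pd !mulr0 subrr.
  rewrite pairingDr pairingNr !pairingZr [pairing _ x]pairingC [pairing _ d]pairingC.
  by rewrite -/m -/N; ring.
rewrite bp scalerBr key /d; apply: Z2P; rewrite !mxE; ring.
Qed.

(** Seen from the class of [D], the step from a boundary point to the next
    turns counterclockwise, by an amount equal to the difference of heights of
    this point and [D] in the direction of the step. *)
Lemma boundary_encloses D : perfect_matching D ->
  exists i j l (a b c : int), [/\ [/\ (i <= size T)%N, (j <= size T)%N & (l <= size T)%N],
    [/\ 0 <= a, 0 <= b, 0 <= c & 0 < a + b + c] &
    (a + b + c) *: cls (chi D) = a *: boundary_point i + b *: boundary_point j +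
      c *: boundary_point l].
Proof.
move=> pD; pose z i := boundary_point i - cls (chi D).
have sumT : \sum_(v <- T) v = 0.
  by rewrite (perm_big _ T_slopes) /= big_map big_enum; exact: sum_all_slopes.
have zk : z (size T) = z 0%N by rewrite /z /boundary_point psum_size sumT psum0.
have zS i : (i < size T)%N -> z i - z i.+1 = T`_i.
  by move=> /boundary_pointS <-; rewrite /z opprB addrA subrK.
have ccw i : (i < size T)%N -> 0 <= pairing (z i) (z i.+1).
  move=> ik; have -> : pairing (z i) (z i.+1) = pairing (T`_i) (z i).
    by rewrite -zS // /pairing !mxE; ring.
  have [h _] := boundary_point_on_edge ik.
  have v0 : T`_i != 0 by apply: T_neq0; exact: mem_nth.
  have [_ _ [_ wF] _ _] := FL v0.
  by rewrite /z pairingDr pairingNr h subr_ge0; exact: wF.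
have nondeg : exists i j, [/\ (i <= size T)%N, (j <= size T)%N & pairing (z i) (z j) != 0].
  have [e [e' ee']] := slopes_not_parallel torus nouni covered FL.
  have /(nthP 0) [i ik iE] : zslope e \in T by rewrite mem_T; apply/existsP; exists e.
  have /(nthP 0) [j jk jE] : zslope e' \in T by rewrite mem_T; apply/existsP; exists e'.
  have [h|h] := eqVneq (pairing (z i) (z j)) 0; last by exists i, j; split=> //; exact: ltnW.
  have [h1|h1] := eqVneq (pairing (z i) (z j.+1)) 0; last by exists i, j.+1; split=> //; exact: ltnW.
  have [h2|h2] := eqVneq (pairing (z i.+1) (z j)) 0; last by exists i.+1, j; split=> //; exact: ltnW.
  have [h3|h3] := eqVneq (pairing (z i.+1) (z j.+1)) 0; last by exists i.+1, j.+1; split.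
  move: ee'; rewrite -iE -jE -!zS //; move: h h1 h2 h3; move: (z i) (z j) (z i.+1) (z j.+1).
  by move=> p q r s h h1 h2 h3; rewrite !pairingDl !pairingDr !pairingNl !pairingNr h h1 h2 h3.
have [i [j [l [a [b [c [ijl abc h]]]]]]] := origin_in_triangle zk ccw nondeg.
exists i, j, l, a, b, c; split=> //; apply/esym/eqP; rewrite -subr_eq0 -h; apply/eqP.
by apply: Z2P; rewrite !mxE; ring.
Qed.

End SlopeSequence.

(** * Convex hulls in the real plane *)

Section Convexity.
Local Open Scope classical_set_scope.
Variable R : realType.
Local Notation R2 := 'rV[R]_2.
Implicit Types (A B : set R2) (x y p : R2) (t : R).

Lemma convex_setP A : convex_set A <->
  forall x y t, 0 <= t <= 1 -> A x -> A y -> A (t *: x + (1 - t) *: y).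
Proof.
split=> [cA x y t /andP [t0 t1] Ax Ay|cA x y l /set_mem Ax /set_mem Ay].
  have := cA x y (Itv01 t0 t1) (mem_set Ax) (mem_set Ay).
  by move=> /set_mem.
apply/mem_set/cA => //; apply/andP; split; [exact: ge0|exact: le1].
Qed.

Lemma convex_hull_segment A x y t : 0 <= t <= 1 ->
  convex_hull A x -> convex_hull A y -> convex_hull A (t *: x + (1 - t) *: y).
Proof.
move=> t01 hx hy B [cB AB]; have /convex_setP := cB; apply=> //.
  exact: hx.
exact: hy.
Qed.

Lemma convex_hull_min A B :
  (forall x y t, 0 <= t <= 1 -> B x -> B y -> B (t *: x + (1 - t) *: y)) ->
  A `<=` B -> convex_hull A `<=` B.
Proof. by move=> cB; apply: smallest_sub; apply/convex_setP. Qed.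

Lemma convex_hull_gen A : A `<=` convex_hull A.
Proof. exact: sub_gen_smallest. Qed.

Lemma convex_hull_translate A p :
  convex_hull [set x + p | x in A] = translate p (convex_hull A).
Proof.
have comb x y t q : t *: (x + q) + (1 - t) *: (y + q) = t *: x + (1 - t) *: y + q.
  by apply/rowP => i; rewrite !mxE; ring.
apply/seteqP; split.
  apply: convex_hull_min => [_ _ t t01 [x hx <-] [y hy <-]|_ [x Ax <-]].
    by exists (t *: x + (1 - t) *: y); [exact: convex_hull_segment|rewrite comb].
  by exists x => //; exact: convex_hull_gen.
move=> _ [x hx <-]; move: x hx.
apply: (@convex_hull_min _ (fun x => convex_hull [set x + p | x in A] (x + p))).
  by move=> x y t t01 hx hy; rewrite -comb; exact: convex_hull_segment.
by move=> x Ax; apply: convex_hull_gen; exists x.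
Qed.

Lemma convex_hull_barycenter A x a b c (wa wb wc : R) :
  convex_hull A a -> convex_hull A b -> convex_hull A c ->
  0 <= wa -> 0 <= wb -> 0 <= wc -> 0 < wa + wb + wc ->
  (wa + wb + wc) *: x = wa *: a + wb *: b + wc *: c -> convex_hull A x.
Proof.
move=> ha hb hc a0 b0 c0 s0 e.
have s1 : wa + wb + wc != 0 by rewrite gt_eqF.
have {e}-> : x = (wa + wb + wc)^-1 *: (wa *: a + wb *: b + wc *: c).
  by rewrite -e scalerA mulVf // scale1r.
have [bc|bc] := eqVneq (wb + wc) 0.
  have [b0' c0'] : wb = 0 /\ wc = 0 by split; lra.
  rewrite b0' c0' !scale0r !addr0 scalerA mulVf ?scale1r //.
  by move: s1; rewrite b0' c0' !addr0.
have bc0 : 0 < wb + wc by rewrite lt_neqAle eq_sym bc addr_ge0.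
have -> : (wa + wb + wc)^-1 *: (wa *: a + wb *: b + wc *: c) =
  (wa / (wa + wb + wc)) *: a + (1 - wa / (wa + wb + wc)) *:
    ((wb / (wb + wc)) *: b + (1 - wb / (wb + wc)) *: c).
  by apply/rowP => i; rewrite !mxE; field; rewrite s1 bc.
apply: convex_hull_segment => //.
  by rewrite divr_ge0 1?(ltW s0) //= ler_pdivrMr // mul1r -addrA lerDl addr_ge0.
apply: convex_hull_segment => //.
by rewrite divr_ge0 1?(ltW bc0) //= ler_pdivrMr // mul1r lerDl.
Qed.

Lemma convex_hull_average A x (s : seq R2) : {in x :: s, forall y, convex_hull A y} ->
  convex_hull A ((size s).+1%:R^-1 *: (x + \sum_(y <- s) y)).
Proof.
elim: s x => [|y s IH] x hs.
  by rewrite big_nil addr0 invr1 scale1r; apply: hs; rewrite mem_head.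
rewrite big_cons; set n := (size s).+1.
have n0 : 0 < n%:R :> R by rewrite ltr0n.
have n1 : 0 < n.+1%:R :> R by rewrite ltr0n.
have -> : (size (y :: s)).+1%:R^-1 *: (x + (y + \sum_(z <- s) z)) =
  n.+1%:R^-1 *: x + (1 - n.+1%:R^-1) *: (n%:R^-1 *: (y + \sum_(z <- s) z)).
  rewrite -/n /= -/n; apply/rowP => i; rewrite !mxE; move: n0 n1; rewrite -[n.+1]addn1 natrD.
  by move=> n0 n1; field; rewrite !gt_eqF.
apply: convex_hull_segment; first by rewrite invr_ge0 (ltW n1) /= invf_le1 // ler1n.
  by apply: hs; rewrite mem_head.
by apply: IH => z zs; apply: hs; rewrite inE zs orbT.
Qed.

(** Single out one term of the average: the vertex is on the segment from this
    term to the average of the others. *)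
Lemma vertex_average A p x (s : seq R2) : vertex (convex_hull A) p ->
  {in x :: s, forall y, convex_hull A y} ->
  (x - p) + \sum_(y <- s) (y - p) = 0 -> x = p.
Proof.
move=> [hp vp]; case: s => [|y s] hs; first by rewrite big_nil addr0 => /eqP; rewrite subr_eq0 => /eqP.
set n := (size s).+1; have n0 : 0 < n%:R :> R by rewrite ltr0n.
have n1 : 0 < n.+1%:R :> R by rewrite ltr0n.
rewrite sumrB big_const_seq count_predT iter_addr_0 /= -/n => e.
have hy : convex_hull A (n%:R^-1 *: \sum_(z <- y :: s) z).
  by rewrite big_cons; apply: convex_hull_average => z zs; apply: hs; rewrite inE zs orbT.
apply: (vp _ _ n.+1%:R^-1 _ hy _ _).1; first by apply: hs; rewrite mem_head.
  by rewrite invr_gt0 n1 invf_lt1 // ltr1n.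
set S := \sum_(z <- y :: s) z in e *.
have -> : x = n.+1%:R *: p - S.
  apply/eqP; rewrite -subr_eq0 -e -scaler_nat; apply/eqP/rowP => i; rewrite !mxE.
  by rewrite -[n.+1]addn1 natrD; ring.
apply/rowP => i; rewrite !mxE; move: n0 n1; rewrite -[n.+1]addn1 natrD => n0 n1.
by field; rewrite !gt_eqF.
Qed.

Lemma segment_lt (a b c t : R) : 0 < t < 1 -> a <= c -> b <= c -> a < c \/ b < c ->
  t * a + (1 - t) * b < c.
Proof.
move=> /andP [t0 t1] ac bc h; have -> : c = t * c + (1 - t) * c by ring.
have s0 : 0 < 1 - t by rewrite subr_gt0.
case: h => h; first by apply: ltr_leD; [rewrite ltr_pM2l|rewrite ler_pM2l].
by apply: ler_ltD; [rewrite ler_pM2l|rewrite ltr_pM2l].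
Qed.

(** The set made of [p] and of the points where [l] is smaller is convex, so
    it contains the hull. *)
Lemma unique_maximum_vertex A p (u0 u1 : R) (l := fun x : R2 => u0 * x 0 0 + u1 * x 0 1) :
  A p -> (forall x, A x -> x = p \/ l x < l p) -> vertex (convex_hull A) p.
Proof.
move=> Ap mp; have lin x y t : l (t *: x + (1 - t) *: y) = t * l x + (1 - t) * l y.
  by rewrite /l !mxE; ring.
have mh : convex_hull A `<=` [set x | x = p \/ l x < l p].
  apply: convex_hull_min => // x y t /andP [t0 t1] hx hy /=.
  have pp : t *: p + (1 - t) *: p = p by rewrite -scalerDl addrC subrK scale1r.
  have [->|tn0] := eqVneq t 0; first by rewrite scale0r add0r subr0 scale1r.
  have [->|tn1] := eqVneq t 1; first by rewrite subrr scale0r addr0 scale1r.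
  have {t0 t1}t01 : 0 < t < 1 by rewrite !lt_neqAle tn1 [0 == t]eq_sym tn0 t0.
  rewrite lin; case: hx => [->|hx]; case: hy => [->|hy]; first by left.
  - by right; apply: segment_lt => //; [exact: ltW|right].
  - by right; apply: segment_lt => //; [exact: ltW|left].
  by right; apply: segment_lt; [|exact: ltW..|left].
split; first exact: convex_hull_gen.
move=> x y t /mh /= hx /mh /= hy t01 e.
have le : ~ (l x <= l p /\ l y <= l p /\ (l x < l p \/ l y < l p)).
  by case=> h1 [h2 h3]; have := segment_lt t01 h1 h2 h3; rewrite -lin -e ltxx.
move: le; case: hx => [->|hx]; case: hy => [->|hy] // -[].
- by split; [exact: lexx|split; [exact: ltW|right]].
- by split; [exact: ltW|split; [exact: lexx|left]].
by split; [exact: ltW|split; [exact: ltW|left]].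
Qed.

End Convexity.

(** * Corners of the characteristic polygon *)

Lemma dimer_torus_graph (G : bicolored_graph) (D0 : {set edge G}) :
  dimer_model G -> perfect_matching D0 -> torus_graph G.
Proof.
move=> [[con euler closed area] _] pD0.
have [m [mb _ _]] := matching_black pD0; have [m' [mw _ _]] := matching_white pD0.
have eb b : exists e, bend (e : edge G) = b by exists (m b).
have ew w : exists e, wend (e : edge G) = w by exists (m' w).
split=> //; rewrite -euler; congr (_ + _ + _)%N.
  rewrite -cardsT; apply: eq_card => b; rewrite inE; symmetry; apply/imsetP.
  by have [e <-] := eb b; exists e.
rewrite -cardsT; apply: eq_card => w; rewrite inE; symmetry; apply/imsetP.
by have [e <-] := ew w; exists e.
Qed.

Section Corners.
Local Open Scope classical_set_scope.
Variables (R : realType) (G : bicolored_graph) (D0 : {set edge G}).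
Local Notation E := (edge G).
Implicit Types (D : {set E}) (x y v : Z2).

(** The isomorphism from [H_1] to [H^1] given by the intersection pairing, in
    coordinates. *)
Definition dual_pt v : 'rV[R]_2 := real_pt R (- rot90 v).

Lemma dual_ptB x y : dual_pt (x - y) = dual_pt x - dual_pt y.
Proof. by apply/rowP => i; rewrite !mxE; case: (i == 0); rewrite -?rmorphB /=; congr intr; ring. Qed.

Lemma dual_ptD x y : dual_pt (x + y) = dual_pt x + dual_pt y.
Proof. by apply/rowP => i; rewrite !mxE; case: (i == 0); rewrite -?rmorphD /=; congr intr; ring. Qed.

Lemma dual_ptZ (n : int) x : dual_pt (n *: x) = n%:~R *: dual_pt x.
Proof. by apply/rowP => i; rewrite !mxE; case: (i == 0); rewrite -?rmorphM /=; congr intr; ring. Qed.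

Lemma dual_pt_inj : injective dual_pt.
Proof.
move=> x y /rowP h; have := h 0; have := h 1; rewrite !mxE /= => /intr_inj h1 /intr_inj h0.
by apply: Z2P; lia.
Qed.

Lemma height_changeE D : real_pt R (height_change D D0) = dual_pt (cls (chi D)) - dual_pt (cls (chi D0)).
Proof.
have clsE D' : cls (chi D') = \sum_(e in D') disp e.
  rewrite /cls [RHS]big_mkcond; apply: eq_bigr => e _; rewrite /chi.
  by case: (e \in D'); rewrite ?scale1r ?scale0r.
rewrite -dual_ptB /dual_pt !clsE -/(matching_class D D0); congr (real_pt R _).
rewrite /height_change; move: (matching_class D D0) => c; apply: Z2P; rewrite !mxE /= /pairing !mxE /=; ring.
Qed.

Definition class_hull : set 'rV[R]_2 :=
  convex_hull [set dual_pt (cls (chi D)) | D in [set D : {set E} | perfect_matching D]].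

Lemma characteristic_polygonE :
  characteristic_polygon R D0 = translate (- dual_pt (cls (chi D0))) class_hull.
Proof.
rewrite -convex_hull_translate; congr convex_hull; apply/seteqP; split.
  by move=> _ [D pD <-]; rewrite height_changeE; exists (dual_pt (cls (chi D))) => //; exists D.
by move=> _ [_ [D pD <-] <-]; exists D => //; rewrite height_changeE.
Qed.

Lemma vertex_translate (A : set 'rV[R]_2) t p : vertex A p <-> vertex (translate t A) (p + t).
Proof.
split=> -[Ap vp]; split.
- by exists p.
- move=> _ _ s [x Ax <-] [y Ay <-] s01 e.
  have [-> ->] : x = p /\ y = p; last by [].
  apply: (vp _ _ s) => //; apply: (@addIr _ t); rewrite e.
  by apply/rowP => i; rewrite !mxE; ring.
- by case: Ap => q Aq /addIr <-.
move=> x y s Ax Ay s01 e.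
have [] := vp (x + t) (y + t) s _ _ s01; [by exists x|by exists y| |].
  by rewrite e; apply/rowP => i; rewrite !mxE; ring.
by move=> /addIr -> /addIr ->.
Qed.

Lemma corner_matchingE D : corner_matching R D0 D <->
  perfect_matching D /\ vertex class_hull (dual_pt (cls (chi D))).
Proof.
by rewrite /corner_matching characteristic_polygonE height_changeE -vertex_translate.
Qed.

Lemma class_hull_gen D : perfect_matching D -> class_hull (dual_pt (cls (chi D))).
Proof. by move=> pD; apply: convex_hull_gen; exists D. Qed.

Lemma multiplicity_free_cls D D' : perfect_matching D -> multiplicity_free D0 D ->
  perfect_matching D' -> cls (chi D') = cls (chi D) -> D' = D.
Proof.
move=> pD /cards1P [D1 /finset.setP h] pD' e.
have hc D2 : perfect_matching D2 -> cls (chi D2) = cls (chi D) -> D2 = D1.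
  move=> pD2 e2; apply/eqP; have := h D2; rewrite !inE pD2 /= => <-; apply/eqP.
  have inj : injective (real_pt R).
    by move=> x y /rowP xy; apply/rowP => i; have := xy i; rewrite !mxE => /intr_inj.
  by apply: inj; rewrite !height_changeE e2.
by rewrite (hc D') // (hc D).
Qed.

(** A nonzero cycle of class zero, nonnegative off [D], would write the corner
    as an average of the points of other matchings, which would then have the
    same height change as [D]. *)
Lemma corner_rigid D : corner_matching R D0 D -> multiplicity_free D0 D -> rigid D.
Proof.
move=> /corner_matchingE [pD vD] mD; split=> // g cg g0 clsg.
have [[|D1 s] [ss hg]] := circulation_decomposition pD cg g0.
  by move=> e; rewrite hg big_nil.
case/andP: ss => /andP [pD1 neD1] /allP ss; exfalso; case/eqP: neD1.
apply: (multiplicity_free_cls pD mD pD1); apply: dual_pt_inj.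
apply: (vertex_average (s := [seq dual_pt (cls (chi D')) | D' <- s]) vD).
  move=> z; rewrite inE => /orP [/eqP ->|/mapP [D' /ss /andP [pD' _] ->]]; exact: class_hull_gen.
have := cls_sum hg; rewrite clsg big_cons => h.
have d0 : dual_pt 0 = 0 by apply/rowP => i; rewrite !mxE; case: (i == 0); rewrite ?oppr0.
rewrite -[RHS]d0 h dual_ptD dual_ptB big_map; congr (_ + _); symmetry.
rewrite (big_morph dual_pt dual_ptD d0); apply: eq_bigr => D' _.
by rewrite dual_ptB.
Qed.

Hypothesis mf : forall D, corner_matching R D0 D -> multiplicity_free D0 D.

(** A unique highest point is a corner, so it comes from one matching only. *)
Lemma unique_top_strict u D : perfect_matching D ->
  (forall D', perfect_matching D' -> height u D' <= height u D /\
     (height u D' = height u D -> cls (chi D') = cls (chi D))) -> strict_top u D.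
Proof.
move=> pD top.
have cD : corner_matching R D0 D.
  apply/corner_matchingE; split=> //.
  apply: (@unique_maximum_vertex _ _ _ (u 0 0)%:~R (u 0 1)%:~R); first by exists D.
  move=> _ [D' pD' <-]; have [h1 h2] := top D' pD'.
  have [/h2 ->|ne] := eqVneq (height u D') (height u D); first by left.
  right; have {ne h1} : height u D' < height u D by rewrite lt_neqAle ne.
  have hE D2 : (u 0 0)%:~R * dual_pt (cls (chi D2)) 0 0 + (u 0 1)%:~R * dual_pt (cls (chi D2)) 0 1
      = (height u D2)%:~R :> R.
    by rewrite !mxE /= -!rmorphM -rmorphD /height /pairing /=; congr intr; ring.
  by rewrite !hE ltr_int.
split=> // D' pD' ne; have [h1 h2] := top D' pD'; rewrite lt_neqAle h1 andbT.
by apply: contra ne => /eqP /h2 /(multiplicity_free_cls pD (mf cD) pD') ->.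
Qed.

End Corners.

Arguments class_hull R G : clear implicits.
Arguments class_hull_gen R {G D}.

(** * The two polygons *)

Section ZigzagPolygon.
Local Open Scope classical_set_scope.
Variables (R : realType) (G : bicolored_graph).
Local Notation E := (edge G).
Implicit Types (e : E) (v : Z2) (D : {set E}).

Hypothesis torus : torus_graph G.
Hypothesis nouni : no_univalent_node G.
Hypothesis covered : forall e, exists2 D : {set E}, rigid D & e \in D.
Variables (F L : Z2 -> {set E}).
Hypothesis FL : forall v, v != 0 -> support_ends v (F v) (L v).
Variable T : seq Z2.
Hypothesis T_slopes : perm_eq T [seq slope z | z <- enum (zigzags G)].
Hypothesis T_sorted : sorted arg_le T.

Lemma size_T : (0 < size T)%N.
Proof.
have [e _] := slopes_not_parallel torus nouni covered FL.
by have : zslope e \in T by [rewrite (mem_T T_slopes); apply/existsP; exists e]; case: (T).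
Qed.

Lemma sum_T_eq0 : \sum_(v <- T) v = 0.
Proof. by rewrite (perm_big _ T_slopes) /= big_map big_enum; exact: sum_all_slopes. Qed.

(** One inclusion holds as the boundary points are on the sides, the other one
    as they enclose the classes of all the perfect matchings. *)
Lemma boundary_hull :
  convex_hull [set dual_pt R (boundary_point F T i) | i in [set i : nat | (i <= size T)%N]]
  = class_hull R G.
Proof.
have k0 := size_T; set A := [set dual_pt R _ | i in _].
apply/seteqP; split; apply: convex_hull_min; try by move=> *; exact: convex_hull_segment.
  have bp_in i : (i < size T)%N -> class_hull R G (dual_pt R (boundary_point F T i)).
    move=> ik; have [_ [m [N [/andP [m0 mN] N0 e]]]] :=
      boundary_point_on_edge torus nouni covered FL T_slopes T_sorted ik.
    have v0 : T`_i != 0 by apply: (T_neq0 torus nouni covered FL T_slopes); exact: mem_nth.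
    have [_ _ [pF _] [pL _] _] := FL v0.
    apply: (@convex_hull_barycenter _ _ _ _ _ _ m%:~R (N - m)%:~R 0
      (class_hull_gen R pL) (class_hull_gen R pF) (class_hull_gen R pF)).
    - by rewrite ler0z.
    - by rewrite ler0z subr_ge0.
    - by [].
    - by rewrite addr0 -rmorphD /= addrC subrK ltr0z.
    by rewrite addr0 -rmorphD /= addrC subrK scale0r addr0 -!dual_ptZ -dual_ptD e.
  move=> _ [i /= ik <-]; have [ik'|ki] := ltnP i (size T); first exact: bp_in.
  have -> : i = size T by apply/eqP; rewrite eqn_leq ik.
  have -> : boundary_point F T (size T) = boundary_point F T 0.
    by rewrite /boundary_point psum_size sum_T_eq0 psum0.
  exact: bp_in.
move=> _ [D pD <-].
have [i [j [l [a [b [c [[ik jk lk] [a0 b0 c0 abc] e]]]]]]] :=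
  boundary_encloses torus nouni covered FL T_slopes T_sorted pD.
have inA n : (n <= size T)%N -> convex_hull A (dual_pt R (boundary_point F T n)).
  by move=> nk; apply: convex_hull_gen; exists n.
apply: (@convex_hull_barycenter _ _ _ _ _ _ a%:~R b%:~R c%:~R (inA i ik) (inA j jk) (inA l lk));
  rewrite ?ler0z //.
  by rewrite -!rmorphD ltr0z.
by rewrite -!rmorphD -!dual_ptZ -!dual_ptD /= e.
Qed.

End ZigzagPolygon.

Lemma translateD (R : realType) (s t : 'rV[R]_2) A :
  translate s (translate t A) = translate (t + s) A.
Proof.
apply/seteqP; split=> [_ [_ [x Ax <-] <-]|_ [x Ax <-]].
  by exists x => //; rewrite addrA.
by exists (x + t)%R; [exists x|rewrite addrA].
Qed.

Theorem corollary1p4 (R : realType) (G : bicolored_graph)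
    (D0 : {set edge G}) (zs : seq {set edge G}) :
  dimer_model G ->
  perfect_matching D0 ->
  strongly_nondegenerate R D0 ->
  (forall D : {set edge G}, corner_matching R D0 D -> multiplicity_free D0 D) ->
  zigzag_enumeration zs ->
  exists t : 'rV[R]_2,
    zigzag_polygon R zs = translate t (characteristic_polygon R D0).
Proof.
move=> dG pD0 nondeg mf /andP [zsP /existsP [n sorted_n]].
have torus := dimer_torus_graph dG pD0; have nouni := dG.2.
have covered e : exists2 D : {set edge G}, rigid D & e \in D.
  by have [D cD eD] := nondeg e; exists D => //; exact: corner_rigid cD (mf D cD).
have [F [L FL]] := support_ends_exist (unique_top_strict mf) pD0.
set S := [seq slope z | z <- zs] in n sorted_n.
have S_slopes : perm_eq S [seq slope z | z <- enum (zigzags G)] by exact: perm_map.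
have S0 : \sum_(v <- S) v = 0 := sum_T_eq0 S_slopes.
have nk : (n <= size S)%N by have := ltn_ord n; rewrite ltnS.
have filterS : [seq v <- S | v != 0] = S.
  by apply/all_filterP/allP; exact: (T_neq0 torus nouni covered FL S_slopes).
rewrite filterS in sorted_n; set T := rot n S in sorted_n.
have T_slopes : perm_eq T [seq slope z | z <- enum (zigzags G)] by rewrite perm_rot.
have kS : (0 < size S)%N.
  by rewrite -(size_rot n); exact: (size_T torus nouni covered FL T_slopes).
(* Starting the cyclic sequence at its [n]-th term translates the points by
   the sum of the first [n] terms. *)
pose c := dual_pt R (- psum S n - cls (chi (F ax0))).
have pointsE : [set real_pt R w | w in [set` zigzag_points zs]]%classic =
    [set x + c | x in [set dual_pt R (boundary_point F T i) | i in [set i : nat | (i <= size T)%N]]]%classic.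
  have inj i : real_pt R (rot90 (psum T i + psum S n)) = dual_pt R (boundary_point F T i) + c.
    rewrite -dual_ptD /dual_pt; congr (real_pt R _); apply: Z2P.
      by rewrite !mxE /=; ring.
    by rewrite !mxE /=; ring.
  have zp : zigzag_points zs = scanl +%R 0 [seq rot90 v | v <- S].
    by rewrite /zigzag_points /S -map_comp.
  apply/seteqP; split=> [_ [w /= + <-]|_ [_ [i /= ik <-] <-]].
    rewrite zp => /(scanl_psum _ S0 kS) [i ik ->].
    have /(psum_rotP _ S0 nk) [j jk ->] : exists2 j, (j <= size S)%N & psum S i = psum S j by exists i.
    by rewrite inj; exists (dual_pt R (boundary_point F T j)) => //; exists j; rewrite //= size_rot.
  rewrite size_rot in ik; rewrite -inj; eexists; last by [].
  rewrite /= zp; apply/(scanl_psum _ S0 kS).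
  have [|j jk e] := (psum_rotP (psum T i + psum S n) S0 nk).2; first by exists i.
  by exists j; rewrite // e.
exists (dual_pt R (cls (chi D0)) + c).
rewrite /zigzag_polygon pointsE convex_hull_translate.
rewrite (boundary_hull R torus nouni covered FL T_slopes sorted_n).
by rewrite characteristic_polygonE translateD addKr.
Qed.
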